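(* Let $\alpha$ be a continuous $\|\cdot\|_1$-dominating normalized gauge norm and let $W$ be a closed subspace of $L^\alpha$. Then $zW\subseteq W$ if and only if either $W=\phi H^\alpha$ for some unimodular function $\phi$, or $W=\chi_E L^\alpha$ for some Borel set $E\subset\mathbb{T}$. Moreover, if $zW\subseteq W$ and $0\neq W\subset H^\alpha$, then $W=\varphi H^\alpha$ for some inner function $\varphi$.
   Context: $m$ is normalized arc length (Haar) measure on the unit circle $\mathbb{T}=\{\lambda\in\mathbb{C}:|\lambda|=1\}$; $L^p=L^p(\mathbb{T},m)$ consists of complex-valued functions, and functions equal a.e. $(m)$ are identified. $H^p\subset L^p$ ($p=1,2,\infty$) is the classical Hardy space of the unit disk, viewed via boundary values on $\mathbb{T}$. $z$ denotes the coordinate function on $\mathbb{T}$. A norm $\alpha$ on $L^\infty$ is a $\|\cdot\|_1$-dominating normalized gauge norm if (1) $\alpha(1)=1$; (2) $\alpha(|f|)=\alpha(f)$ for all $f\in L^\infty$; (3) $\alpha(f)\ge\|f\|_1$ for all $f\in L^\infty$. It is continuous if $\lim_{m(E)\to0^+}\alpha(\chi_E)=0$. It is extended to all measurable $f:\mathbb{T}\to\mathbb{C}$ by $\alpha(f)=\sup\{\alpha(s): s \text{ a simple function},\ 0\le s\le|f|\}$. Put $\mathcal{L}^\alpha=\{f:\alpha(f)<\infty\}$; $L^\alpha$ is the $\alpha$-closure of $L^\infty$ in $\mathcal{L}^\alpha$, and $H^\alpha$ is the $\alpha$-closure of $H^\infty$. ''Closed'' for subspaces of $L^\alpha$ refers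 to the norm $\alpha$. A unimodular function is a measurable $\phi$ on $\mathbb{T}$ with $|\phi|=1$ a.e. $(m)$; an inner function is a $\varphi\in H^\infty$ with $|\varphi|=1$ a.e. $(m)$. *)

(* Defs.v *)
From HB Require Import structures.
From mathcomp Require Import all_boot all_order all_algebra.
From mathcomp Require Import all_classical all_reals all_analysis.
From mathcomp Require Import measurable_realfun.
From mathcomp.real_closed Require Import complex.
Set Implicit Arguments.
Unset Strict Implicit.
Unset Printing Implicit Defensive.
Import Order.TTheory GRing.Theory Num.Theory.
Import numFieldNormedType.Exports.
Import HBNNSimple.
Import ComplexField.
Local Open Scope classical_set_scope.
Local Open Scope ring_scope.
Local Open Scope complex_scope.

(* [R[i]^o] is [R[i]] seen as a normed module over itself: this is where the
   library finds the topology of the complex plane. *)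
Definition unit_circle (R : realType) : set R[i]^o := [set z | `|z| = 1].

Definition circle_top (R : realType) : Type := set_type (@unit_circle R).
HB.instance Definition _ (R : realType) :=
  Topological.copy (circle_top R) (set_type (@unit_circle R)).

Lemma norm_expi (R : realType) (t : R) : @unit_circle R (cos t +i* sin t).
Proof. by rewrite /unit_circle/= normc_def /= cos2Dsin2 sqrtr1. Qed.

Definition expi_top (R : realType) (t : R) : circle_top R :=
  exist _ (cos t +i* sin t : R[i]^o) (mem_set (norm_expi t)).
HB.instance Definition _ (R : realType) :=
  isPointed.Build (circle_top R) (expi_top 0).

Definition circle (R : realType) : Type :=
  g_sigma_algebraType (@open (circle_top R)).
HB.instance Definition _ (R : realType) := Measurable.on (circle R).

Definition zcoord (R : realType) (x : circle R) : R[i] :=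
  set_val (x : circle_top R).

Definition expi (R : realType) (t : measurableTypeR R) : circle R := expi_top t.

Lemma continuous_expi (R : realType) : continuous (@expi_top R).
Proof.
apply: continuous_comp_initial => t; apply/cvgrPdist_lt => -[e e'].
rewrite ltcE/= => /andP[/eqP -> e0].
have e20 : 0 < e / 2 by rewrite divr_gt0.
have /cvgrPdist_lt/(_ _ e20) ct := @continuous_cos R t.
have /cvgrPdist_lt/(_ _ e20) st := @continuous_sin R t.
near=> s.
have -> : \val (expi_top t) - \val (expi_top s) =
    (cos t - cos s)%:C + (0 +i* 1) * (sin t - sin s)%:C :> R[i].
  by apply/eqP; rewrite eq_complex/= !(mul0r, mul1r, mulr0, subr0, addr0, add0r) !eqxx.
rewrite (le_lt_trans (ler_normD _ _))// normrM.
rewrite !normc_def/= !expr0n/= expr1n !addr0 add0r !sqrtr_sqr sqrtr1.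
rewrite -rmorphM -rmorphD ltcR mul1r (splitr e) ltrD//.
  by near: s.
by near: s.
Unshelve. all: by end_near. Qed.

Lemma measurable_expi (R : realType) : measurable_fun setT (@expi R).
Proof.
apply: (@measurability _ _ _ (circle R) _ _ (@open (circle_top R))) => //.
move=> _ [U oU <-]; rewrite setTI.
apply: open_measurable; apply: open_comp => // t _.
exact: continuous_expi.
Qed.
HB.instance Definition _ (R : realType) :=
  isMeasurableFun.Build _ _ _ _ (@expi R) (@measurable_expi R).

Lemma two_pi_gt0 (R : realType) : 0 < 2 * pi :> R.
Proof. by rewrite mulr_gt0// pi_gt0. Qed.

Definition arc_measure (R : realType) : probability (circle R) R :=
  distribution (uniform_prob (two_pi_gt0 R)) (@expi R).

(* The functions below are honest functions on the circle; spaces of classes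
   modulo a.e. equality are represented by sets of functions that are saturated
   for a.e. equality among measurable functions, so that set equality is
   equality of the spaces of classes. *)
Section spaces.
Variable R : realType.
Implicit Types (f g phi : circle R -> R[i]) (S W : set (circle R -> R[i])).
Implicit Types alpha : (circle R -> R[i]) -> R.

Definition cmeasurable f : Prop :=
  measurable_fun setT (fun x => complex.Re (f x) : measurableTypeR R) /\
  measurable_fun setT (fun x => complex.Im (f x) : measurableTypeR R).

Definition aeq f g : Prop := {ae arc_measure R, forall x, f x = g x}.

Definition Linfty : set (circle R -> R[i]) :=
  [set f | cmeasurable f /\
     exists M : R, {ae arc_measure R, forall x, Normc.normc (f x) <= M}].

Definition norm1 f : \bar R := (\int[arc_measure R]_x (Normc.normc (f x))%:E)%E.

(* [derivable] over the field [R[i]] is complex differentiability. *)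
Definition holomorphic_disk (F : R[i]^o -> R[i]^o) : Prop :=
  forall w : R[i]^o, `|w| < 1 -> derivable F w 1.

(* Radial boundary values of bounded holomorphic functions on the disk. *)
Definition Hinfty : set (circle R -> R[i]) :=
  [set f | Linfty f /\
     exists F : R[i]^o -> R[i]^o,
       [/\ holomorphic_disk F,
           exists M : R, forall w : R[i]^o, `|w| < 1 -> Normc.normc (F w) <= M &
           {ae arc_measure R, forall x,
              F (r%:C * zcoord x) @[r --> (1 : R)^'-] --> (f x : R[i]^o)}]].

Definition char_fun (E : set (circle R)) : circle R -> R[i] := \1_E.

(* [alpha] is total, but only its values on [Linfty] are ever constrained or
   used; [ae] says that it is well defined on classes. *)
Record dominating_gauge_norm alpha : Prop := GaugeNorm {
  gauge_ae : forall f g, Linfty f -> Linfty g -> aeq f g -> alpha f = alpha g ;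
  gauge_triangle : forall f g, Linfty f -> Linfty g ->
    alpha (f \+ g) <= alpha f + alpha g ;
  gauge_scale : forall (c : R[i]) f, Linfty f ->
    alpha (fun x => c * f x) = Normc.normc c * alpha f ;
  gauge_eq0 : forall f, Linfty f -> alpha f = 0 -> aeq f (fun=> 0) ;
  gauge_one : alpha (fun=> 1) = 1 ;
  gauge_abs : forall f, Linfty f -> alpha (fun x => `|f x|) = alpha f ;
  gauge_dom : forall f, Linfty f -> (norm1 f <= (alpha f)%:E)%E }.

Definition continuous_gauge alpha : Prop :=
  forall e : R, 0 < e -> exists2 d : R, 0 < d &
    forall E : set (circle R), measurable E ->
      (0 < arc_measure R E)%E -> (arc_measure R E < d%:E)%E -> alpha (char_fun E) < e.

Definition gauge_ext alpha f : \bar R :=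
  ereal_sup [set (alpha (fun x => (s x)%:C))%:E |
    s in [set s : {nnsfun circle R >-> R} |
            forall x, s x <= Normc.normc (f x)]].

Definition scrL alpha : set (circle R -> R[i]) :=
  [set f | cmeasurable f /\ (gauge_ext alpha f < +oo)%E].

Definition gauge_closure alpha S : set (circle R -> R[i]) :=
  [set f | scrL alpha f /\ forall e : R, 0 < e ->
     exists2 g, S g & (gauge_ext alpha (f \- g)%R < e%:E)%E].

Definition Lgauge alpha := gauge_closure alpha Linfty.
Definition Hgauge alpha := gauge_closure alpha Hinfty.

Record closed_subspace alpha W : Prop := ClosedSubspace {
  subspace_sub : W `<=` Lgauge alpha ;
  subspace_ae : forall f g, W f -> cmeasurable g -> aeq f g -> W g ;
  subspace_zero : W (fun=> 0) ;
  subspace_add : forall f g, W f -> W g -> W (f \+ g) ;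
  subspace_scale : forall (c : R[i]) f, W f -> W (fun x => c * f x) ;
  subspace_closed : Lgauge alpha `&` gauge_closure alpha W `<=` W }.

Definition mul_space phi S : set (circle R -> R[i]) :=
  [set f | cmeasurable f /\ exists2 h, S h & aeq f (phi \* h)].

Definition unimodular phi : Prop :=
  cmeasurable phi /\ {ae arc_measure R, forall x, `|phi x| = 1}.

Definition inner phi : Prop :=
  Hinfty phi /\ {ae arc_measure R, forall x, `|phi x| = 1}.

End spaces.

(* Main.v *)
Require Import Defs.
From HB Require Import structures.
From mathcomp Require Import all_boot all_order all_algebra.
From mathcomp Require Import all_classical all_reals all_analysis.
From mathcomp Require Import measurable_realfun.
From mathcomp.real_closed Require Import complex.
From mathcomp Require Import ring lra.
Set Implicit Arguments.
Unset Strict Implicit.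
Unset Printing Implicit Defensive.
Import Order.TTheory GRing.Theory Num.Theory.
Import numFieldNormedType.Exports.
Import HBNNSimple.
Local Open Scope classical_set_scope.
Local Open Scope ring_scope.
Local Open Scope complex_scope.

(** Beurling's theorem for gauge norms. Two properties of [alpha] carry the argument: it
   dominates the [L1] norm, and bounded multipliers act on [Lgauge alpha] continuously in
   [L1], in the sense that [u * f] tends to zero for the gauge norm when [u] tends to zero
   in [L1] while staying bounded ([Lgauge_small]).

   Let [W] be closed and invariant under [z]. A bounded analytic function is a bounded
   [L1] limit of polynomials in [z], so [W] is stable under [Hinfty] ([W_mul_Hinfty]).
   The link with Hilbert space is made by outer functions: an integrable [w >= 1] has a
   bounded analytic [k] with [|k| ^ 2 * w] constant, close to [1] in [L2] when the
   integral of [w] is close to [1] ([outer_function]). With [w] equal to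
   [1 + s * |f|], this shows that the bounded elements of [W] are dense in [W]
   ([W_bounded_dense]); with [w] equal to [1 + |f - g| ^ 2], that the bounded elements of
   their [L2] closure [N] still belong to [W] ([L2cl_bddW]).

   In [N] the classical argument applies. If some nonzero [phi] in [N] is orthogonal to
   [z * f] for all bounded [f] in [W], then [|phi|] is constant, a multiple of [phi] is a
   unimodular element of [W], and [conj phi * f] is analytic for all those [f], so that
   [W] is [phi * Hgauge alpha]. Otherwise [N] is stable under [conj z], and the projection
   [q] of [1] onto [N] is such that all the Fourier coefficients of [(1 - q) * conj f]
   vanish for [f] in [N]; so [q] is the indicator function of a set [E], and [W] is
   [chi_E * Lgauge alpha] because trigonometric polynomials are bounded [L1] approximations
   of all bounded functions. If moreover [W] lies in [Hgauge alpha], then in the first case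
   [phi] itself is analytic, and in the second one [chi_E * conj z ^ n] is analytic for all
   [n], which forces [E] to be a null set.

   All this is phrased with Fourier coefficients, whereas [Hinfty] is defined by
   holomorphic extension to the disk. The two descriptions agree ([HinftyE]): circle means
   of holomorphic functions are constant ([mean_value], from Goursat's theorem), so
   negative coefficients vanish; conversely the Cauchy integral of a function without
   negative coefficients is its Poisson integral, which converges to it radially
   almost everywhere by Fatou's theorem ([poisson_fatou]). Fatou's theorem also provides
   uniqueness of Fourier coefficients and the approximation by polynomials. *)

Local Notation Re := complex.Re.
Local Notation Im := complex.Im.
Local Notation normc := Normc.normc.
Local Arguments Normc.normc : simpl never.

(** * Complex numbers and complex-valued integrals *)

Section complex_facts.
Variable R : realType.
Implicit Types (z w : R[i]) (a b : R).

Lemma normrE z : `|z| = (normc z)%:C. Proof. by rewrite normc_def; case: z. Qed.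

Lemma normc_ge0 z : 0 <= normc z.
Proof. by rewrite -lecR -normrE normr_ge0. Qed.

Lemma normcM z w : normc (z * w) = normc z * normc w.
Proof. exact: Normc.normcM. Qed.

Lemma normc_eq0 z : normc z = 0 -> z = 0.
Proof. exact: Normc.eq0_normc. Qed.

Lemma normc_real a : normc a%:C = `|a|.
Proof. by rewrite /Normc.normc /= expr0n /= addr0 sqrtr_sqr. Qed.

Lemma normc0 : normc 0 = 0 :> R.
Proof. by rewrite -[0 : R[i]]/(0%:C) normc_real normr0. Qed.

Lemma normc1 : normc 1 = 1 :> R.
Proof. by rewrite -[1 : R[i]]/(1%:C) normc_real normr1. Qed.

Lemma normcX z n : normc (z ^+ n) = normc z ^+ n.
Proof. by elim: n => [|n ih]; rewrite ?expr0 ?normc1// !exprS normcM ih. Qed.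

Lemma normcV z : normc z^-1 = (normc z)^-1.
Proof. exact: Normc.normcV. Qed.

Lemma normcN z : normc (- z) = normc z.
Proof. by apply: complexI; rewrite -!normrE normrN. Qed.

Lemma normcD z w : normc (z + w) <= normc z + normc w.
Proof. by rewrite -lecR rmorphD/= -!normrE ler_normD. Qed.

Lemma normcB z w : normc (z - w) <= normc z + normc w.
Proof. by rewrite -(normcN w) normcD. Qed.

Lemma normc_distC z w : normc (z - w) = normc (w - z).
Proof. by rewrite -normcN opprB. Qed.

Lemma normc_conj z : normc (conjc z) = normc z.
Proof. by case: z => x y; rewrite /Normc.normc /= sqrrN. Qed.

Lemma sqr_normcE z : normc z ^+ 2 = Re z ^+ 2 + Im z ^+ 2.
Proof. by case: z => x y /=; rewrite sqr_sqrtr// addr_ge0 ?sqr_ge0. Qed.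

Lemma mul_conjc z : z * conjc z = (normc z ^+ 2)%:C.
Proof. by rewrite sqr_normcE; case: z => x y /=; simpc; congr Complex; ring. Qed.

Lemma normc_geRe z : `|Re z| <= normc z.
Proof. by rewrite -lecR -normrE normc_ge_Re. Qed.

Lemma normc_geIm z : `|Im z| <= normc z.
Proof.
rewrite -(@ler_pXn2r _ 2)// ?nnegrE ?normc_ge0// sqr_normcE real_normK ?num_real//.
by rewrite lerDr sqr_ge0.
Qed.

Lemma normc_leReIm z : normc z <= `|Re z| + `|Im z|.
Proof.
rewrite -(@ler_pXn2r _ 2)// ?nnegrE ?normc_ge0 ?addr_ge0// sqr_normcE.
rewrite sqrrD !real_normK ?num_real// lerD2r lerDl.
by rewrite mulrn_wge0// mulr_ge0.
Qed.

Lemma ReD z w : Re (z + w) = Re z + Re w. Proof. by case: z; case: w. Qed.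
Lemma ImD z w : Im (z + w) = Im z + Im w. Proof. by case: z; case: w. Qed.
Lemma ReN z : Re (- z) = - Re z. Proof. by case: z. Qed.
Lemma ImN z : Im (- z) = - Im z. Proof. by case: z. Qed.
Lemma ReM z w : Re (z * w) = Re z * Re w - Im z * Im w.
Proof. by case: z; case: w. Qed.
Lemma ImM z w : Im (z * w) = Re z * Im w + Im z * Re w.
Proof. by case: z; case: w. Qed.
Lemma Re_conj z : Re (conjc z) = Re z. Proof. by case: z. Qed.
Lemma Im_conj z : Im (conjc z) = - Im z. Proof. by case: z. Qed.

Lemma conjcM z w : conjc (z * w) = conjc z * conjc w. Proof. exact: rmorphM. Qed.
Lemma conjcB z w : conjc (z - w) = conjc z - conjc w. Proof. exact: rmorphB. Qed.
Lemma conjcN z : conjc (- z) = - conjc z. Proof. exact: rmorphN. Qed.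
Lemma conjcX z n : conjc (z ^+ n) = conjc z ^+ n. Proof. exact: rmorphXn. Qed.

Lemma complex_ext z w : Re z = Re w -> Im z = Im w -> z = w.
Proof. by case: z => ? ?; case: w => ? ? /= -> ->. Qed.

End complex_facts.

Definition cmeas d (T : measurableType d) (R : realType) (D : set T)
    (f : T -> R[i]) : Prop :=
  measurable_fun D (fun x => Re (f x) : measurableTypeR R) /\
  measurable_fun D (fun x => Im (f x) : measurableTypeR R).

Definition cintegrable d (T : measurableType d) (R : realType)
    (mu : {measure set T -> \bar R}) (D : set T) (f : T -> R[i]) : Prop :=
  mu.-integrable D (EFin \o (fun x => Re (f x))) /\
  mu.-integrable D (EFin \o (fun x => Im (f x))).

Definition cint d (T : measurableType d) (R : realType)
    (mu : {measure set T -> \bar R}) (D : set T) (f : T -> R[i]) : R[i] :=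
  (\int[mu]_(x in D) Re (f x)) +i* (\int[mu]_(x in D) Im (f x)).

Section cmeas.
Context d (T : measurableType d) (R : realType) (D : set T).
Implicit Types (f g : T -> R[i]).

Lemma cmeas_cst c : cmeas D (fun=> c : R[i]).
Proof. by split; exact: measurable_cst. Qed.

Lemma cmeas_real (u : T -> R) : measurable_fun D u -> cmeas D (fun x => (u x)%:C).
Proof. by move=> mu; split => //=; exact: measurable_cst. Qed.

Lemma cmeasD f g : cmeas D f -> cmeas D g -> cmeas D (fun x => f x + g x).
Proof.
move=> [f1 f2] [g1 g2]; split.
- by under eq_fun do rewrite ReD; exact: measurable_funD.
- by under eq_fun do rewrite ImD; exact: measurable_funD.
Qed.

Lemma cmeasN f : cmeas D f -> cmeas D (fun x => - f x).
Proof.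
move=> [f1 f2]; split.
- by under eq_fun do rewrite ReN; exact: measurableT_comp.
- by under eq_fun do rewrite ImN; exact: measurableT_comp.
Qed.

Lemma cmeasB f g : cmeas D f -> cmeas D g -> cmeas D (fun x => f x - g x).
Proof. by move=> mf mg; apply: cmeasD => //; exact: cmeasN. Qed.

Lemma cmeasM f g : cmeas D f -> cmeas D g -> cmeas D (fun x => f x * g x).
Proof.
move=> [f1 f2] [g1 g2]; split.
- under eq_fun do rewrite ReM.
  by apply: measurable_funB; exact: measurable_funM.
- under eq_fun do rewrite ImM.
  by apply: measurable_funD; exact: measurable_funM.
Qed.

Lemma cmeasX f n : cmeas D f -> cmeas D (fun x => f x ^+ n).
Proof.
move=> mf; elim: n => [|n ih]; first exact: (cmeas_cst 1).
by under eq_fun do rewrite exprS; exact: cmeasM.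
Qed.

Lemma cmeas_conj f : cmeas D f -> cmeas D (fun x => conjc (f x)).
Proof.
move=> [f1 f2]; split.
- by under eq_fun do rewrite Re_conj.
- by under eq_fun do rewrite Im_conj; exact: measurableT_comp.
Qed.

Lemma cmeas_sqnormc f : cmeas D f -> measurable_fun D (fun x => normc (f x) ^+ 2).
Proof.
move=> [f1 f2]; under eq_fun do rewrite sqr_normcE.
by apply: measurable_funD; exact: measurable_funX.
Qed.

Lemma cmeas_normc f : cmeas D f -> measurable_fun D (fun x => normc (f x)).
Proof.
move=> mf; rewrite (_ : (fun x => _) = (fun x => Num.sqrt (normc (f x) ^+ 2))).
  exact: (measurableT_comp (continuous_measurable_fun (@sqrt_continuous R)) (cmeas_sqnormc mf)).
by apply/funext => x; rewrite sqrtr_sqr ger0_norm// normc_ge0.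
Qed.

Lemma measurable_inv (u : T -> R) : (forall x, 0 <= u x) ->
  measurable_fun D u -> measurable_fun D (fun x => (u x)^-1).
Proof.
move=> u0 mu; under eq_fun do rewrite -powR_inv1 ?u0//.
exact: (measurableT_comp (measurable_powR _)).
Qed.

Lemma cmeasV f : cmeas D f -> cmeas D (fun x => (f x)^-1).
Proof.
move=> mf; rewrite (_ : (fun x => _) =
    (fun x => ((normc (f x) ^+ 2)^-1)%:C * conjc (f x))).
  apply: cmeasM; last exact: cmeas_conj.
  apply: cmeas_real; apply: measurable_inv => [x|]; first exact: sqr_ge0.
  exact: cmeas_sqnormc.
by apply/funext => x; rewrite invc_norm normrE -rmorphXn/= -fmorphV.
Qed.

End cmeas.

Section cintegrable.
Context d (T : measurableType d) (R : realType).
Variables (mu : {measure set T -> \bar R}) (D : set T).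
Hypothesis mD : measurable D.
Implicit Types (f g : T -> R[i]) (u v : T -> R).
Local Notation intg f := (cintegrable mu D f).
Local Notation rintg u := (mu.-integrable D (EFin \o u)).

Lemma rintegrable_le u v : measurable_fun D u ->
  (forall x, D x -> `|u x| <= v x) -> rintg v -> rintg u.
Proof.
move=> mu' uv; apply: le_integrable => //; first exact/measurable_EFinP.
by move=> x Dx; rewrite /= lee_fin (le_trans (uv x Dx))// ler_norm.
Qed.

Lemma cintegrable_cmeas f : intg f -> cmeas D f.
Proof.
by case=> /measurable_int/measurable_EFinP ? /measurable_int/measurable_EFinP.
Qed.

Lemma rintegrable_meas u : rintg u -> measurable_fun D u.
Proof. by move/measurable_int/measurable_EFinP. Qed.

Lemma rintegrableD u v : rintg u -> rintg v -> rintg (fun x => u x + v x).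
Proof. by move=> ui vi; have := integrableD mD ui vi. Qed.

Lemma rintegrableB u v : rintg u -> rintg v -> rintg (fun x => u x - v x).
Proof. by move=> ui vi; have := integrableB mD ui vi. Qed.

Lemma rintegrableZ (k : R) u : rintg u -> rintg (fun x => k * u x).
Proof. by move=> ui; have := integrableZl mD k ui. Qed.

Lemma cintegrable_normc f : intg f -> rintg (fun x => normc (f x)).
Proof.
move=> fi; have mf := cintegrable_cmeas fi; case: fi => f1 f2.
apply: rintegrable_le (rintegrableD (integrable_norm f1) (integrable_norm f2)).
  exact: cmeas_normc.
by move=> x _ /=; rewrite ger0_norm ?normc_ge0 ?normc_leReIm.
Qed.

Lemma cintegrable_le f u : cmeas D f -> (forall x, D x -> normc (f x) <= u x) ->
  rintg u -> intg f.
Proof.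
move=> [f1 f2] fu ui; split; apply: rintegrable_le ui => // x Dx.
- by rewrite (le_trans (normc_geRe _))// fu.
- by rewrite (le_trans (normc_geIm _))// fu.
Qed.

Lemma cintegrable_normcE f : cmeas D f -> rintg (fun x => normc (f x)) -> intg f.
Proof. by move=> mf; apply: cintegrable_le. Qed.

Lemma cintegrableD f g : intg f -> intg g -> intg (fun x => f x + g x).
Proof.
move=> fi gi; apply: cintegrable_le (rintegrableD (cintegrable_normc fi) (cintegrable_normc gi)).
  by apply: cmeasD; exact: cintegrable_cmeas.
by move=> x _; exact: normcD.
Qed.

Lemma cintegrableZ (c : R[i]) f : intg f -> intg (fun x => c * f x).
Proof.
move=> fi; apply: cintegrable_le (rintegrableZ (normc c) (cintegrable_normc fi)).
  by apply: cmeasM; [exact: cmeas_cst|exact: cintegrable_cmeas].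
by move=> x _; rewrite normcM.
Qed.

Lemma cintegrableB f g : intg f -> intg g -> intg (fun x => f x - g x).
Proof.
move=> fi gi; apply: cintegrable_le (rintegrableD (cintegrable_normc fi) (cintegrable_normc gi)).
  by apply: cmeasB; exact: cintegrable_cmeas.
by move=> x _; exact: normcB.
Qed.

Lemma cintegrable_real u : rintg u -> intg (fun x => (u x)%:C).
Proof.
move=> ui; apply: cintegrable_le (integrable_norm ui).
  exact/cmeas_real/rintegrable_meas.
by move=> x _; rewrite normc_real.
Qed.

Lemma cintegrableMbd f g (M : R) : cmeas D g -> (forall x, D x -> normc (g x) <= M) ->
  intg f -> intg (fun x => g x * f x).
Proof.
move=> mg gM fi; apply: cintegrable_le (rintegrableZ M (cintegrable_normc fi)).
  by apply: cmeasM => //; exact: cintegrable_cmeas.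
by move=> x Dx; rewrite normcM ler_wpM2r ?normc_ge0 ?gM.
Qed.

Lemma cintegrable_conj f : intg f -> intg (fun x => conjc (f x)).
Proof.
move=> fi; apply: cintegrable_le (cintegrable_normc fi).
  exact/cmeas_conj/cintegrable_cmeas.
by move=> x _; rewrite normc_conj.
Qed.

Lemma cintegrable0 : intg (fun=> 0).
Proof. by split; exact: integrable0. Qed.

Lemma cintegrable_sum (I : Type) (s : seq I) (h : I -> T -> R[i]) :
  (forall i, intg (h i)) -> intg (fun x => \sum_(i <- s) h i x).
Proof.
move=> hi; elim: s => [|i s ih].
  by under eq_fun do rewrite big_nil; exact: cintegrable0.
by under eq_fun do rewrite big_cons; exact: cintegrableD.
Qed.

Lemma eq_cint f g : (forall x, D x -> f x = g x) -> cint mu D f = cint mu D g.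
Proof.
move=> fg; rewrite /cint; congr Complex; apply: eq_Rintegral => x /[!inE] Dx;
by rewrite fg.
Qed.

Lemma cint0 : cint mu D (fun=> 0) = 0.
Proof. by rewrite /cint /Rintegral/= integral0. Qed.

Lemma cintD f g : intg f -> intg g ->
  cint mu D (fun x => f x + g x) = cint mu D f + cint mu D g.
Proof.
move=> [f1 f2] [g1 g2]; apply: complex_ext; rewrite /= -RintegralD//.
- by apply: eq_Rintegral => x _; rewrite ReD.
- by apply: eq_Rintegral => x _; rewrite ImD.
Qed.

Lemma cintZ (c : R[i]) f : intg f ->
  cint mu D (fun x => c * f x) = c * cint mu D f.
Proof.
move=> [f1 f2]; apply: complex_ext; rewrite ?ReM ?ImM/=.
- rewrite -!RintegralZl// -RintegralB//; try exact: rintegrableZ.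
  by apply: eq_Rintegral => x _; rewrite ReM.
- rewrite -!RintegralZl// -RintegralD//; try exact: rintegrableZ.
  by apply: eq_Rintegral => x _; rewrite ImM.
Qed.

Lemma cintB f g : intg f -> intg g ->
  cint mu D (fun x => f x - g x) = cint mu D f - cint mu D g.
Proof.
move=> [f1 f2] [g1 g2]; apply: complex_ext; rewrite ?ReD ?ImD ?ReN ?ImN /= -RintegralB//.
- by apply: eq_Rintegral => x _; rewrite ReD ReN.
- by apply: eq_Rintegral => x _; rewrite ImD ImN.
Qed.

Lemma cint_conj f : intg f ->
  cint mu D (fun x => conjc (f x)) = conjc (cint mu D f).
Proof.
move=> [f1 f2]; apply: complex_ext; rewrite ?Re_conj ?Im_conj /=.
- by apply: eq_Rintegral => x _; rewrite Re_conj.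
- rewrite -mulN1r -RintegralZl//.
  by apply: eq_Rintegral => x _; rewrite Im_conj mulN1r.
Qed.

Lemma cint_real u : cint mu D (fun x => (u x)%:C) = (\int[mu]_(x in D) u x)%:C.
Proof. by rewrite /cint /Rintegral/= integral0. Qed.

Lemma cint_sum (I : Type) (s : seq I) (h : I -> T -> R[i]) :
  (forall i, intg (h i)) ->
  cint mu D (fun x => \sum_(i <- s) h i x) = \sum_(i <- s) cint mu D (h i).
Proof.
move=> hi; elim: s => [|i s ih].
  by rewrite big_nil -[RHS]cint0; apply: eq_cint => x _; rewrite big_nil.
rewrite big_cons -ih -cintD//; last exact: cintegrable_sum.
by apply: eq_cint => x _; rewrite big_cons.
Qed.

(** With [c] the integral, [normc c ^ 2] is the integral of the real part of
   [conjc c * f], which is at most [normc c] times the integral of [normc f]. *)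
Lemma normc_cint_le f : intg f ->
  normc (cint mu D f) <= \int[mu]_(x in D) normc (f x).
Proof.
move=> fi; set c := cint mu D f.
have [->|c0] := eqVneq (normc c) 0.
  by apply: Rintegral_ge0 => x _; exact: normc_ge0.
have cp : 0 < normc c by rewrite lt_def c0 normc_ge0.
rewrite -(ler_pM2l cp) -expr2.
have -> : normc c ^+ 2 = Re (cint mu D (fun x => conjc c * f x)).
  by rewrite cintZ// mulrC mul_conjc.
rewrite -RintegralZl//; last exact: cintegrable_normc.
apply: le_Rintegral => //.
- by case: (cintegrableZ (conjc c) fi).
- exact/rintegrableZ/cintegrable_normc.
- move=> x _; rewrite (le_trans (ler_norm _))// (le_trans (normc_geRe _))//.
  by rewrite normcM normc_conj.
Qed.

Lemma ae_eq_Rintegral u v : measurable_fun D u -> measurable_fun D v ->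
  {ae mu, forall x, D x -> u x = v x} ->
  \int[mu]_(x in D) u x = \int[mu]_(x in D) v x.
Proof.
move=> mu' mv uv; rewrite /Rintegral; congr fine.
apply: ae_eq_integral => //; [exact/measurable_EFinP|exact/measurable_EFinP|].
by apply: filterS uv => x uvx Dx; rewrite uvx.
Qed.

Lemma ae_rintegrable u v : measurable_fun D u -> measurable_fun D v ->
  {ae mu, forall x, D x -> u x = v x} -> rintg u -> rintg v.
Proof.
move=> mu' mv uv /integrableP[_ ufin]; apply/integrableP; split.
  exact/measurable_EFinP.
rewrite (_ : (\int[mu]_(x in D) _)%E = \int[mu]_(x in D) `|(EFin \o u) x|)%E//.
apply: ae_eq_integral => //.
- by do 2 apply: measurableT_comp => //.
- by do 2 apply: measurableT_comp => //.
- by apply: filterS uv => x uvx Dx; rewrite /= uvx.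
Qed.

Lemma ae_rintegrable_le u v : measurable_fun D u ->
  {ae mu, forall x, D x -> `|u x| <= v x} -> rintg v -> rintg u.
Proof.
move=> mu' uv vi; have mv := rintegrable_meas vi.
move/integrableP : vi => [_ vfin]; apply/integrableP; split.
  exact/measurable_EFinP.
apply: le_lt_trans vfin; apply: ae_ge0_le_integral => //.
- by do 2 apply: measurableT_comp => //.
- by do 2 apply: measurableT_comp => //.
- by apply: filterS uv => x uvx Dx; rewrite lee_fin (le_trans (uvx Dx)) ?ler_norm.
Qed.

Lemma ae_le_Rintegral u v : rintg u -> rintg v ->
  {ae mu, forall x, D x -> u x <= v x} ->
  \int[mu]_(x in D) u x <= \int[mu]_(x in D) v x.
Proof.
move=> ui vi uv; have mu' := rintegrable_meas ui; have mv := rintegrable_meas vi.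
rewrite -subr_ge0 -RintegralB//.
rewrite (@ae_eq_Rintegral (fun x => v x - u x) (fun x => `|v x - u x|)).
- by apply: Rintegral_ge0 => x _.
- exact: measurable_funB.
- by apply: measurableT_comp => //; exact: measurable_funB.
- by apply: filterS uv => x uvx Dx; rewrite ger0_norm// subr_ge0 uvx.
Qed.

Lemma ae_cintegrable_le f u : cmeas D f ->
  {ae mu, forall x, D x -> normc (f x) <= u x} -> rintg u -> intg f.
Proof.
move=> [f1 f2] fu ui; split; apply: ae_rintegrable_le ui => //; apply: filterS fu => x fu Dx.
- by rewrite (le_trans (normc_geRe _))// fu.
- by rewrite (le_trans (normc_geIm _))// fu.
Qed.

Lemma ae_cintegrable f g : cmeas D f -> cmeas D g ->
  {ae mu, forall x, D x -> f x = g x} -> intg f -> intg g.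
Proof.
move=> [f1 f2] [g1 g2] fg [i1 i2]; split.
- by apply: ae_rintegrable i1 => //; apply: filterS fg => x h /h ->.
- by apply: ae_rintegrable i2 => //; apply: filterS fg => x h /h ->.
Qed.

End cintegrable.

Lemma eq_lew (R : realType) (a b : R) : a = b -> a <= b.
Proof. by move=> ->. Qed.

(** * Square-integrable functions *)

Lemma geometric_cauchy (R : realType) (u : R^nat) (s : R) :
  (forall n, `|u n.+1 - u n| <= s * 2^-1 ^+ n) ->
  cvgn u /\ forall n, `|limn u - u n| <= 2 * s * 2^-1 ^+ n.
Proof.
move=> us.
have s0 : 0 <= s by have := us 0; rewrite expr0 mulr1; exact: le_trans.
have tail n k : `|u (n + k)%N - u n| <= 2 * s * 2^-1 ^+ n * (1 - 2^-1 ^+ k).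
  elim: k => [|k ih]; first by rewrite addn0 expr0 !subrr normr0 mulr0.
  rewrite addnS -(subrK (u (n + k)%N) (u _.+1)) -addrA (le_trans (ler_normD _ _))//.
  rewrite (le_trans (lerD (us _) ih))// exprD exprS.
  by apply/eq_lew; field.
have tail' n k : `|u (n + k)%N - u n| <= 2 * s * 2^-1 ^+ n.
  apply: (le_trans (tail n k)); apply: ler_piMr; first by rewrite !mulr_ge0// exprn_ge0.
  by rewrite gerBl exprn_ge0.
have g0 : (2 * s * 2^-1 ^+ n) @[n --> \oo] --> (0 : R).
  rewrite -[0 in X in _ --> X](mulr0 (2 * s)); apply: cvgMr.
  by apply: cvg_expr; rewrite ger0_norm// invf_lt1// ltr1n.
have cu : cvgn u.
  apply/cauchy_cvgP/cauchy_exP => e e0.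
  have /cvgrPdist_lt/(_ _ e0)[N _ HN] := g0.
  exists (u N); exists N => // n /= Nn.
  rewrite /ball/= distrC -(subnKC Nn) (le_lt_trans (tail' N _))//.
  by have /= := HN N (leqnn N); rewrite sub0r normrN; apply: le_lt_trans; exact: ler_norm.
split => // n.
have cn : `|u m - u n| @[m --> \oo] --> `|limn u - u n|.
  by apply: cvg_norm; apply: cvgB; [exact: cu|exact: cvg_cst].
apply: (cvgr_to_le cn).
exists n => // m /= nm; by rewrite -(subnKC nm).
Qed.

Lemma geometric_cauchy_complex (R : realType) (a : nat -> R[i]) (s : R) :
  (forall n, normc (a n.+1 - a n) <= s * 2^-1 ^+ n) ->
  [/\ cvgn (fun n => Re (a n)), cvgn (fun n => Im (a n)) &
   forall n, normc ((limn (fun n => Re (a n)) +i* limn (fun n => Im (a n))) - a n)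
     <= 4 * s * 2^-1 ^+ n].
Proof.
move=> h.
have hr n : `|Re (a n.+1) - Re (a n)| <= s * 2^-1 ^+ n.
  by rewrite -ReN -ReD (le_trans (normc_geRe _))// h.
have hi n : `|Im (a n.+1) - Im (a n)| <= s * 2^-1 ^+ n.
  by rewrite -ImN -ImD (le_trans (normc_geIm _))// h.
have [cr br] := geometric_cauchy hr; have [ci bi] := geometric_cauchy hi.
split => // n; rewrite (le_trans (normc_leReIm _))// ReD ImD ReN ImN /=.
by rewrite (le_trans (lerD (br n) (bi n)))//; apply/eq_lew; ring.
Qed.

Definition L2 d (T : measurableType d) (R : realType)
    (mu : {measure set T -> \bar R}) (f : T -> R[i]) : Prop :=
  cmeas setT f /\ mu.-integrable setT (EFin \o (fun x => normc (f x) ^+ 2)).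

Definition nsq d (T : measurableType d) (R : realType)
    (mu : {measure set T -> \bar R}) (f : T -> R[i]) : R :=
  \int[mu]_x normc (f x) ^+ 2.

Definition ip d (T : measurableType d) (R : realType)
    (mu : {measure set T -> \bar R}) (f g : T -> R[i]) : R[i] :=
  cint mu setT (fun x => f x * conjc (g x)).

Definition L2cl d (T : measurableType d) (R : realType)
    (mu : {measure set T -> \bar R}) (M : set (T -> R[i])) : set (T -> R[i]) :=
  [set q | L2 mu q /\ forall e : R, 0 < e ->
     exists2 h, M h & nsq mu (fun x => q x - h x) < e].

Section L2.
Context d (T : measurableType d) (R : realType) (mu : {measure set T -> \bar R}).
Implicit Types (f g h : T -> R[i]).
Local Notation L2 := (L2 mu).
Local Notation nsq := (nsq mu).
Local Notation L2cl := (L2cl mu).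
Local Notation ip := (ip mu).
Local Notation mT := (@measurableT _ T).

Lemma L2_cmeas f : L2 f -> cmeas setT f. Proof. by case. Qed.

Lemma L2D f g : L2 f -> L2 g -> L2 (fun x => f x + g x).
Proof.
move=> [mf fi] [mg gi]; split; first exact: cmeasD.
apply: (rintegrable_le mT) (rintegrableZ mT 2 (rintegrableD mT fi gi)).
  exact/cmeas_sqnormc/cmeasD.
move=> x _; rewrite ger0_norm ?sqr_ge0//.
rewrite (@le_trans _ _ ((normc (f x) + normc (g x)) ^+ 2))//.
  by rewrite lerXn2r ?nnegrE ?addr_ge0 ?normc_ge0 ?normcD.
rewrite -subr_ge0 [X in 0 <= X](_ : _ = (normc (f x) - normc (g x)) ^+ 2) ?sqr_ge0//.
by ring.
Qed.

Lemma L2Z (c : R[i]) f : L2 f -> L2 (fun x => c * f x).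
Proof.
move=> [mf fi]; split; first by apply: cmeasM => //; exact: cmeas_cst.
under eq_fun do rewrite normcM exprMn.
exact: (rintegrableZ mT).
Qed.

Lemma L2B f g : L2 f -> L2 g -> L2 (fun x => f x - g x).
Proof.
move=> Lf Lg; under eq_fun do rewrite -mulN1r.
by apply: L2D => //; exact: L2Z.
Qed.

Lemma L2_conj f : L2 f -> L2 (fun x => conjc (f x)).
Proof.
move=> [mf fi]; split; first exact: cmeas_conj.
by under eq_fun do rewrite normc_conj.
Qed.

Lemma L2M_cintegrable f g : L2 f -> L2 g -> cintegrable mu setT (fun x => f x * g x).
Proof.
move=> [mf fi] [mg gi].
apply: (cintegrable_le mT) (rintegrableD mT fi gi) => [|x _]; first exact: cmeasM.
rewrite normcM; have := sqr_ge0 (normc (f x) - normc (g x)).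
have := normc_ge0 (f x); have := normc_ge0 (g x).
move: (normc _) (normc _) => a b; nra.
Qed.

Lemma L2_normcM_integrable f g : L2 f -> L2 g ->
  mu.-integrable setT (EFin \o (fun x => normc (f x) * normc (g x))).
Proof.
move=> Lf Lg; have := cintegrable_normc mT (L2M_cintegrable Lf Lg).
by under eq_fun do rewrite normcM.
Qed.

Lemma ip_cintegrable f g : L2 f -> L2 g ->
  cintegrable mu setT (fun x => f x * conjc (g x)).
Proof. by move=> Lf /L2_conj; exact: L2M_cintegrable. Qed.

Lemma nsq_ge0 f : 0 <= nsq f.
Proof. by apply: Rintegral_ge0 => x _; exact: sqr_ge0. Qed.

Lemma ip_conj f g : L2 f -> L2 g -> conjc (ip f g) = ip g f.
Proof.
move=> Lf Lg; rewrite -(cint_conj mT)//; last exact: ip_cintegrable.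
by apply: eq_cint => x _; rewrite conjcM conjcK mulrC.
Qed.

Lemma ipBl f g h : L2 f -> L2 g -> L2 h -> ip (fun x => f x - g x) h = ip f h - ip g h.
Proof.
move=> Lf Lg Lh; rewrite -(cintB mT); [|exact: ip_cintegrable|exact: ip_cintegrable].
by apply: eq_cint => x _; rewrite mulrBl.
Qed.

Lemma ipZl (c : R[i]) f g : L2 f -> L2 g -> ip (fun x => c * f x) g = c * ip f g.
Proof.
move=> Lf Lg; rewrite -(cintZ mT); last exact: ip_cintegrable.
by apply: eq_cint => x _; rewrite mulrA.
Qed.

Lemma nsqZ (c : R[i]) f : L2 f -> nsq (fun x => c * f x) = normc c ^+ 2 * nsq f.
Proof.
move=> [_ fi]; rewrite /nsq -RintegralZl//.
by apply: eq_Rintegral => x _; rewrite normcM exprMn.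
Qed.

Lemma nsqBZ (c : R[i]) f g : L2 f -> L2 g ->
  nsq (fun x => f x - c * g x) =
  nsq f - 2 * Re (conjc c * ip f g) + normc c ^+ 2 * nsq g.
Proof.
move=> Lf Lg; have Lcg := L2Z c Lg.
have -> : Re (conjc c * ip f g) = Re (ip f (fun x => c * g x)).
  rewrite -[in RHS](Re_conj (ip _ _)) ip_conj// ipZl//.
  by rewrite -(Re_conj (c * ip g f)) conjcM ip_conj.
rewrite -nsqZ// /ip /= -RintegralZl//; last by case: (ip_cintegrable Lf Lcg).
rewrite -RintegralB//; [|by case: Lf|]; last first.
  by apply: (rintegrableZ mT); case: (ip_cintegrable Lf Lcg).
rewrite -RintegralD//; [|apply: rintegrableB => //|by case: Lcg].
- apply: eq_Rintegral => x _; rewrite !sqr_normcE.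
  by case: (f x) => a b; case: (c * g x) => a' b' /=; ring.
- by case: Lf.
- by apply: (rintegrableZ mT); case: (ip_cintegrable Lf Lcg).
Qed.

Lemma nsqB_parallelogram f g : L2 f -> L2 g ->
  nsq (fun x => f x - g x) + nsq (fun x => f x + g x) = 2 * (nsq f + nsq g).
Proof.
move=> Lf Lg.
have := nsqBZ 1 Lf Lg; have := nsqBZ (-1) Lf Lg.
rewrite normcN normc1 conjcN conjc1 expr1n !mul1r mulN1r ReN.
have -> : nsq (fun x => f x - -1 * g x) = nsq (fun x => f x + g x).
  by congr (nsq _); apply/funext => x; rewrite mulN1r opprK.
have -> : nsq (fun x => f x - 1 * g x) = nsq (fun x => f x - g x).
  by congr (nsq _); apply/funext => x; rewrite mul1r.
by move=> -> ->; ring.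
Qed.

Lemma nsqD_le f g : L2 f -> L2 g -> nsq (fun x => f x + g x) <= 2 * (nsq f + nsq g).
Proof. by move=> Lf Lg; rewrite -nsqB_parallelogram// lerDr nsq_ge0. Qed.

Lemma nsqB_le f g : L2 f -> L2 g -> nsq (fun x => f x - g x) <= 2 * (nsq f + nsq g).
Proof. by move=> Lf Lg; rewrite -nsqB_parallelogram// lerDl nsq_ge0. Qed.

Lemma cauchy_schwarz f g : L2 f -> L2 g ->
  (\int[mu]_x (normc (f x) * normc (g x))) ^+ 2 <= nsq f * nsq g.
Proof.
move=> Lf Lg; set C := Rintegral _ _ _.
have ifg := L2_normcM_integrable Lf Lg.
have C0 : 0 <= C by apply: Rintegral_ge0 => x _; rewrite mulr_ge0 ?normc_ge0.
have H t : 0 <= t ^+ 2 * nsq f - 2 * t * C + nsq g.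
  have [_ fi] := Lf; have [_ gi] := Lg.
  rewrite -!RintegralZl// -RintegralB//; [|exact: rintegrableZ|exact: rintegrableZ].
  rewrite -RintegralD//; last by apply: rintegrableB => //; exact: rintegrableZ.
  apply: Rintegral_ge0 => x _.
  rewrite [X in 0 <= X](_ : _ = (t * normc (f x) - normc (g x)) ^+ 2) ?sqr_ge0//.
  by ring.
have [A0|A0] := eqVneq (nsq f) 0.
  rewrite A0 mul0r; have := H ((nsq g + 1) / (2 * C)); rewrite A0 mulr0 add0r.
  have [->|Cn] := eqVneq C 0; first by rewrite expr0n.
  rewrite (_ : 2 * _ * C = nsq g + 1); last by field.
  by lra.
have Ap : 0 < nsq f by rewrite lt_def A0 nsq_ge0.
have := H (C / nsq f).
rewrite (_ : _ + nsq g = (nsq f * nsq g - C ^+ 2) / nsq f); last by field.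
by rewrite pmulr_lge0 ?invr_gt0// subr_ge0.
Qed.

Lemma normc_ip_le f g : L2 f -> L2 g -> normc (ip f g) ^+ 2 <= nsq f * nsq g.
Proof.
move=> Lf Lg; apply: le_trans (cauchy_schwarz Lf Lg).
rewrite lerXn2r ?nnegrE ?normc_ge0//.
  by apply: Rintegral_ge0 => x _; rewrite mulr_ge0 ?normc_ge0.
rewrite (le_trans (normc_cint_le mT (ip_cintegrable Lf Lg)))//.
by apply/eq_lew/eq_Rintegral => x _; rewrite normcM normc_conj.
Qed.

(** Pointwise, [4 ^ n * |f_{n+1} - f_n| ^ 2] is dominated by a single integrable
   function, so the sequence converges geometrically almost everywhere. *)
Lemma L2_complete (f : nat -> T -> R[i]) : (forall n, L2 (f n)) ->
  (forall n, nsq (fun x => f n.+1 x - f n x) <= 16^-1 ^+ n) ->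
  exists2 q, L2 q & forall e : R, 0 < e -> exists N, forall n, (N <= n)%N ->
    nsq (fun x => q x - f n x) < e.
Proof.
move=> Lf fn.
pose D n x : R := 4 ^+ n * normc (f n.+1 x - f n x) ^+ 2.
have D0 n x : 0 <= D n x by rewrite /D mulr_ge0 ?sqr_ge0 ?exprn_ge0.
have LB n : L2 (fun x => f n.+1 x - f n x) by exact: L2B.
have mD n : measurable_fun setT (D n).
  by apply: measurable_funM => //; case: (LB n) => /cmeas_sqnormc.
pose S x : \bar R := (\sum_(n <oo) (D n x)%:E)%E.
have S0 x : (0 <= S x)%E by apply: nneseries_ge0 => n _ _; rewrite lee_fin.
have mS : measurable_fun setT S.
  by apply: ge0_emeasurable_sum => [n x _ _|n _]; [rewrite lee_fin|exact/measurable_EFinP].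
have iS : (\int[mu]_x S x <= 2%:E)%E.
  rewrite integral_nneseries//; last 2 first.
  - by move=> n; exact/measurable_EFinP.
  - by move=> n x _; rewrite lee_fin.
  have iD n : (\int[mu]_x (D n x)%:E <= (4^-1 ^+ n)%:E)%E.
    have [_ iB] := LB n.
    rewrite -[leLHS]fineK; last first.
      by apply: integrable_fin_num => //; apply: (rintegrableZ mT).
    rewrite -/(Rintegral _ _ _) lee_fin RintegralZl//.
    rewrite (le_trans (ler_wpM2l _ (fn n))) ?exprn_ge0//.
    by rewrite -exprMn (_ : 4 * 16^-1 = 4^-1)//; field.
  apply: (@le_trans _ _ (\sum_(n <oo) (4^-1 ^+ n)%:E)%E).
    by apply: lee_nneseries => [n _ _|n _]; [apply: integral_ge0 => x _; rewrite lee_fin|exact: iD].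
  apply: lime_le; first by apply: is_cvg_nneseries => n _ _; rewrite lee_fin exprn_ge0.
  apply: nearW => n; rewrite sumEFin lee_fin.
  suff -> : \sum_(0 <= i < n) (4^-1 : R) ^+ i = 4/3 - 4/3 * 4^-1 ^+ n.
    have : 0 <= (4^-1 : R) ^+ n by exact: exprn_ge0.
    lra.
  elim: n => [|n ih]; first by rewrite big_geq// expr0; field.
  by rewrite big_nat_recr//= ih exprS; field.
have intS : mu.-integrable setT S.
  apply/integrableP; split => //; under eq_integral do rewrite gee0_abs//.
  by rewrite (le_lt_trans iS)// ltry.
pose A := [set x | S x \is a fin_num].
have mA : measurable A by have := emeasurable_fin_num measurableT mS; rewrite setTI.
pose s x : R := fine (S x).
have DS n x : A x -> D n x <= s x.
  move=> Ax; rewrite -lee_fin fineK//.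
  have := @nneseries_lim_ge _ (fun n => (D n x)%:E) xpredT 0%N.
  move=> /(_ n.+1).
  rewrite big_nat_recr//= => H; apply: (le_trans _ (H _)).
    by rewrite leeDr// sume_ge0// => i _; rewrite lee_fin.
  by move=> i _ _; rewrite lee_fin.
pose h n x := (\1_A x : R)%:C * f n x.
have hs x n : normc (h n.+1 x - h n x) <= Num.sqrt (s x) * 2^-1 ^+ n.
  rewrite /h -mulrBr normcM normc_real indicE; case: (boolP (x \in A)) => xA; last first.
    by rewrite normr0 mul0r mulr_ge0 ?sqrtr_ge0 ?exprn_ge0.
  move: xA; rewrite inE => Ax; rewrite normr1 mul1r.
  rewrite -(@ler_pXn2r _ 2)// ?nnegrE ?normc_ge0 ?mulr_ge0 ?sqrtr_ge0 ?exprn_ge0//.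
  rewrite exprMn sqr_sqrtr ?fine_ge0//.
  have := DS n x Ax; rewrite /D mulrC -ler_pdivlMr ?exprn_gt0//.
  have -> : (2^-1 : R) ^+ n ^+ 2 = (4 ^+ n)^-1 by rewrite -exprM mulnC exprM -exprVn; congr (_ ^+ n); field.
  by [].
have hc x := geometric_cauchy_complex (hs x).
pose q x := limn (fun n => Re (h n x)) +i* limn (fun n => Im (h n x)).
have mh n : cmeas setT (h n).
  apply: cmeasM; last by case: (Lf n).
  by apply: cmeas_real; exact: measurable_indic.
have mq : cmeas setT q.
  split.
  - apply: (@measurable_fun_cvg _ _ _ _ (fun n x => Re (h n x))) => [n|x _].
      by case: (mh n).
    by have [] := hc x.
  - apply: (@measurable_fun_cvg _ _ _ _ (fun n x => Im (h n x))) => [n|x _].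
      by case: (mh n).
    by have [] := hc x.
have ints : mu.-integrable setT (EFin \o s).
  apply/integrableP; split; first by apply/measurable_EFinP; exact: measurableT_comp.
  rewrite (le_lt_trans _ (le_lt_trans iS (ltry 2)))//.
  apply: ge0_le_integral => //.
  - apply: measurableT_comp => //; apply/measurable_EFinP.
    exact: measurableT_comp.
  - move=> x _; rewrite /= ger0_norm ?fine_ge0// /s.
    by have := S0 x; case: (S x) => // r; rewrite leey.
have aeA : {ae mu, forall x, A x}.
  by apply: filterS (integrable_ae measurableT intS) => x; exact.
have qA x : A x -> forall n, normc (q x - f n x) ^+ 2 <= 16 * 4^-1 ^+ n * s x.
  move=> Ax n; have [_ _ /(_ n)] := hc x; rewrite -/(q x).
  rewrite {1}/h indicE mem_set// mul1r => qx.
  rewrite -(@ler_pXn2r _ 2) ?nnegrE ?normc_ge0 ?mulr_ge0 ?sqrtr_ge0 ?exprn_ge0// in qx.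
  rewrite (le_trans qx)// !exprMn sqr_sqrtr ?fine_ge0//.
  rewrite -!exprM (mulnC n) [in leLHS]exprM (_ : 2^-1 ^+ 2 = 4^-1); last by field.
  by apply/eq_lew; ring.
have mqf n : cmeas setT (fun x => q x - f n x).
  by apply: cmeasB => //; case: (Lf n).
have iqf n : mu.-integrable setT (EFin \o (fun x => normc (q x - f n x) ^+ 2)).
  apply: (ae_rintegrable_le measurableT _ _ (rintegrableZ measurableT (16 * 4^-1 ^+ n) ints)).
    exact: cmeas_sqnormc.
  by apply: filterS aeA => x Ax _; rewrite ger0_norm ?sqr_ge0 ?qA.
have Lqf n : L2 (fun x => q x - f n x) by [].
exists q.
  have -> : q = (fun x => (q x - f 0%N x) + f 0%N x) by apply/funext => x; rewrite subrK.
  exact: L2D.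
have nqf n : nsq (fun x => q x - f n x) <= 16 * 4^-1 ^+ n * \int[mu]_x s x.
  rewrite -RintegralZl//; apply: (ae_le_Rintegral measurableT) => //.
    exact: (rintegrableZ measurableT).
  by apply: filterS aeA => x Ax _; exact: qA.
have c0 : (16 * 4^-1 ^+ n * \int[mu]_x s x) @[n --> \oo] --> (0 : R).
  rewrite -[0 in X in _ --> X](mul0r (\int[mu]_x s x)); apply: cvgMl.
  rewrite -[0 in X in _ --> X](mulr0 16); apply: cvgMr.
  by apply: cvg_expr; rewrite ger0_norm// invf_lt1// ltr1n.
move=> e e0; have /cvgrPdist_lt/(_ _ e0)[N _ HN] := c0.
exists N => n Nn; rewrite (le_lt_trans (nqf n))//.
by have /= := HN n Nn; rewrite sub0r normrN; apply: le_lt_trans; exact: ler_norm.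
Qed.

(** A minimizing sequence is Cauchy by the parallelogram identity, and its limit is
   the projection. *)
Lemma L2_projection (M : set (T -> R[i])) g : M `<=` L2 -> L2 g -> M !=set0 ->
  (forall f h, M f -> M h -> M (fun x => f x + h x)) ->
  (forall (c : R[i]) f, M f -> M (fun x => c * f x)) ->
  exists2 q, L2cl M q & forall h, M h -> ip (fun x => g x - q x) h = 0.
Proof.
move=> ML Lg [m0 Mm0] MD MZ.
pose dist f := nsq (fun x => g x - f x).
pose V := [set dist f | f in M].
have hV : has_inf V.
  by split; [exists (dist m0), m0|exists 0 => _ [f _ <-]; exact: nsq_ge0].
pose dd := inf V.
have dle f : M f -> dd <= dist f by move=> Mf; apply: ge_inf; [case: hV|exists f].
have hn n : exists f, M f /\ dist f < dd + 16^-1 ^+ n / 4.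
  have e0 : 0 < 16^-1 ^+ n / 4 :> R by rewrite divr_gt0// exprn_gt0.
  by have [_ [f Mf <-] lt] := inf_adherent e0 hV; exists f.
have [f /all_and2[Mf fd]] := choice hn.
have Lgf n : L2 (fun x => g x - f n x) by apply: L2B => //; exact/ML/Mf.
have fcauchy n : nsq (fun x => f n.+1 x - f n x) <= 16^-1 ^+ n.
  have par := nsqB_parallelogram (Lgf n) (Lgf n.+1).
  have E1 : nsq (fun x => g x - f n x - (g x - f n.+1 x)) = nsq (fun x => f n.+1 x - f n x).
    by congr (nsq _); apply/funext => x; ring.
  have Mmid : M (fun x => 2^-1 * (f n x + f n.+1 x)) by apply/MZ/MD.
  have E2 : nsq (fun x => g x - f n x + (g x - f n.+1 x)) =
      4 * dist (fun x => 2^-1 * (f n x + f n.+1 x)).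
    have -> : (4 : R) = normc (2%:C) ^+ 2.
      by rewrite normc_real ger0_norm// -natrX.
    rewrite -(nsqZ _ (L2B Lg (ML _ Mmid))).
    congr (nsq _); apply/funext => x.
    have -> : (2%:C : R[i]) = 2 by rewrite rmorph_nat.
    by field.
  rewrite E1 E2 in par.
  have := dle _ Mmid; have := fd n; have := fd n.+1; rewrite exprS.
  move: par; rewrite -!/(dist _).
  have : 0 < 16^-1 ^+ n :> R by rewrite exprn_gt0.
  by move: (dist _) (dist (f n)) (dist (f n.+1)) (16^-1 ^+ n) (nsq _) => *; lra.
have [q Lq qf] := L2_complete (fun n => ML _ (Mf n)) fcauchy.
exists q.
  by split => // e /qf[N /(_ N (leqnn N)) lt]; exists (f N).
move=> h Mh; have Lh := ML _ Mh.
have Lgq : L2 (fun x => g x - q x) by exact: L2B.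
pose H := nsq h; have H0 : 0 <= H by exact: nsq_ge0.
have small n : normc (ip (fun x => g x - f n x) h) ^+ 2 <= (H + 1) * 16^-1 ^+ n.
  set a := ip _ _.
  pose s := (H + 1)^-1; have s0 : 0 < s by rewrite invr_gt0; lra.
  have Mp : M (fun x => f n x + s%:C * a * h x) by apply: MD => //; exact: MZ.
  have := dle _ Mp.
  have -> : dist (fun x => f n x + s%:C * a * h x) =
      nsq (fun x => (g x - f n x) - (s%:C * a) * h x).
    by congr (nsq _); apply/funext => x; ring.
  rewrite nsqBZ// -/a -/H conjcM conjc_real -mulrA (mulrC (conjc a)) mul_conjc.
  have -> : Re (s%:C * (normc a ^+ 2)%:C) = s * normc a ^+ 2 by rewrite -rmorphM.
  rewrite normcM normc_real exprMn (ger0_norm (ltW s0)).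
  have := fd n; rewrite -/(dist _).
  have sH : s * (H + 1) = 1 by rewrite mulVf//; lra.
  have : 0 < 16^-1 ^+ n :> R by rewrite exprn_gt0.
  move: (normc a ^+ 2) (sqr_ge0 (normc a)) (dist _) (16^-1 ^+ n) => A A0 dn e e0 h1 h2.
  have h3 : s * A * (2 - s * H) <= e by lra.
  have h4 : s * A <= e.
    apply: le_trans h3; rewrite ler_peMr ?mulr_ge0 ?(ltW s0)//.
    have : s * H = 1 - s by lra.
    lra.
  have -> : A = (H + 1) * (s * A) by rewrite mulrA (mulrC _ s) sH mul1r.
  by apply: ler_wpM2l => //; lra.
apply: normc_eq0; apply/eqP; rewrite -sqrf_eq0; apply/eqP.
apply/eqP; rewrite eq_le sqr_ge0 andbT; apply/ler_addgt0Pr => e e0; rewrite add0r.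
have e10 : 0 < e / (4 * (H + 1)) by rewrite divr_gt0// mulr_gt0//; lra.
have [N qN] := qf _ e10.
have c0 : (16^-1 ^+ n) @[n --> \oo] --> (0 : R).
  by apply: cvg_expr; rewrite ger0_norm// invf_lt1// ltr1n.
have /cvgrPdist_lt/(_ _ e10)[N' _ HN'] := c0.
pose n := maxn N N'.
have a1 : nsq (fun x => q x - f n x) < e / (4 * (H + 1)) by apply: qN; exact: leq_maxl.
have a2 : 16^-1 ^+ n < e / (4 * (H + 1)).
  have /= := HN' n (leq_maxr _ _); rewrite sub0r normrN; apply: le_lt_trans; exact: ler_norm.
have Lqf : L2 (fun x => q x - f n x) by apply: L2B => //; exact/ML/Mf.
have -> : ip (fun x => g x - q x) h =
    ip (fun x => g x - f n x) h - ip (fun x => q x - f n x) h.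
  rewrite -(ipBl (Lgf n) Lqf Lh); apply: eq_cint => x _.
  by rewrite opprB addrA subrK.
have b1 := small n.
have b2 := normc_ip_le Lqf Lh; rewrite -/H in b2.
have b3 := normcB (ip (fun x => g x - f n x) h) (ip (fun x => q x - f n x) h).
move: b1 b2 b3; set u := normc (ip _ _); set v := normc (ip _ _); set w := normc _ => b1 b2 b3.
have w0 : 0 <= w by exact: normc_ge0.
have u0 : 0 <= u by exact: normc_ge0.
have v0 : 0 <= v by exact: normc_ge0.
have b4 : w ^+ 2 <= 2 * (u ^+ 2 + v ^+ 2).
  by have := sqr_ge0 (u - v); nra.
have E : e = (H + 1) * (e / (4 * (H + 1))) * 4 by field; lra.
have b5 : (H + 1) * 16^-1 ^+ n <= (H + 1) * (e / (4 * (H + 1))).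
  by rewrite ler_wpM2l ?(ltW a2)//; lra.
have b6 : nsq (fun x => q x - f n x) * H <= (e / (4 * (H + 1))) * (H + 1).
  by apply: ler_pM => //; [exact: nsq_ge0|exact: ltW|lra].
lra.
Qed.

Lemma ip_L2cl0 (M : set (T -> R[i])) r q : M `<=` L2 -> L2 r ->
  (forall f, M f -> ip r f = 0) -> L2cl M q -> ip r q = 0.
Proof.
move=> ML Lr r0 [Lq qM]; apply: normc_eq0; apply/eqP; rewrite -sqrf_eq0.
rewrite eq_le sqr_ge0 andbT; apply/ler_addgt0Pr => e e0; rewrite add0r.
have N0 : 0 < nsq r + 1 by have := nsq_ge0 r; lra.
have [f Mf fe] := qM _ (divr_gt0 e0 N0).
have Lqf : L2 (fun x => q x - f x) by apply: L2B => //; exact: ML.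
have -> : ip r q = ip r (fun x => q x - f x).
  rewrite -[RHS]conjcK ip_conj// ipBl//; last exact: ML.
  by rewrite conjcB (ip_conj Lq Lr) (ip_conj (ML _ Mf) Lr) (r0 _ Mf) subr0.
apply: (le_trans (normc_ip_le Lr Lqf)).
have -> : e = (nsq r + 1) * (e / (nsq r + 1)) by field; lra.
by apply: ler_pM; rewrite ?nsq_ge0 ?lerDl// ltW.
Qed.

Lemma sub_L2cl (M : set (T -> R[i])) : M `<=` L2 -> M `<=` L2cl M.
Proof.
move=> ML f Mf; split; first exact: ML.
move=> e e0; exists f => //; rewrite (_ : nsq _ = 0)//.
rewrite /nsq /Rintegral (eq_integral (cst 0%E)) ?integral0// => x _.
by rewrite subrr normc0 expr0n.
Qed.

End L2.

Section L2closure.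
Context d (T : measurableType d) (R : realType) (mu : {measure set T -> \bar R}).
Implicit Types (f g h u : T -> R[i]) (M : set (T -> R[i])).
Local Notation mT := (@measurableT _ T).

Lemma L2_rotate u f : cmeas setT u -> (forall x, normc (u x) = 1) -> L2 mu f ->
  L2 mu (fun x => u x * f x).
Proof.
move=> mu' u1 [mf fi]; split; first exact: cmeasM.
by under eq_fun do rewrite normcM u1 mul1r.
Qed.

Lemma nsq_rotate u f : (forall x, normc (u x) = 1) -> nsq mu (fun x => u x * f x) = nsq mu f.
Proof. by move=> u1; apply: eq_Rintegral => x _; rewrite normcM u1 mul1r. Qed.

(** Multiplication by [u] is an isometry, so it is enough to multiply elements of [M]. *)
Lemma L2cl_rotate M M' u f : M `<=` L2 mu -> M' `<=` L2 mu -> cmeas setT u ->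
  (forall x, normc (u x) = 1) -> (forall h, M h -> L2cl mu M' (fun x => u x * h x)) ->
  L2cl mu M f -> L2cl mu M' (fun x => u x * f x).
Proof.
move=> ML ML' mu' u1 uM [Lf fM]; split; first exact: L2_rotate.
move=> e e0; have e40 : 0 < e / 4 by rewrite divr_gt0.
have [h Mh fh] := fM _ e40; have Lh := ML _ Mh.
have [_ /(_ _ e40)[h' Mh' hh']] := uM h Mh.
exists h' => //; have Lh' := ML' _ Mh'.
have -> : (fun x => u x * f x - h' x) = fun x => u x * (f x - h x) + (u x * h x - h' x).
  by apply/funext => x; ring.
have Lfh : L2 mu (fun x => f x - h x) by exact: L2B.
have Luh : L2 mu (fun x => u x * h x - h' x) by apply: L2B => //; exact: L2_rotate.
apply: (le_lt_trans (nsqD_le (L2_rotate mu' u1 Lfh) Luh)).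
by rewrite nsq_rotate//; move: fh hh'; move: (nsq _ _) (nsq _ _); clear => a b; lra.
Qed.

Lemma L2clB M f g : M `<=` L2 mu -> (forall f h, M f -> M h -> M (fun x => f x + h x)) ->
  (forall (c : R[i]) f, M f -> M (fun x => c * f x)) ->
  L2cl mu M f -> L2cl mu M g -> L2cl mu M (fun x => f x - g x).
Proof.
move=> ML MD MZ [Lf fM] [Lg gM]; split; first exact: L2B.
move=> e e0; have e40 : 0 < e / 4 by rewrite divr_gt0.
have [h Mh fh] := fM _ e40; have [h' Mh' gh'] := gM _ e40.
exists (fun x => h x + -1 * h' x); first exact/MD/MZ.
have -> : (fun x => f x - g x - (h x + -1 * h' x)) = fun x => (f x - h x) - (g x - h' x).
  by apply/funext => x; ring.
have Lfh : L2 mu (fun x => f x - h x) by apply: L2B => //; exact: ML.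
have Lgh : L2 mu (fun x => g x - h' x) by apply: L2B => //; exact: ML.
apply: (le_lt_trans (nsqB_le Lfh Lgh)).
by move: fh gh'; move: (nsq _ _) (nsq _ _); clear => a b; lra.
Qed.

Lemma L2clZ M (c : R[i]) f : M `<=` L2 mu ->
  (forall (c : R[i]) f, M f -> M (fun x => c * f x)) ->
  L2cl mu M f -> L2cl mu M (fun x => c * f x).
Proof.
move=> ML MZ [Lf fM]; split; first exact: L2Z.
move=> e e0; have C0 : 0 < normc c ^+ 2 + 1 by rewrite ltr_wpDl ?sqr_ge0.
have [h Mh fh] := fM _ (divr_gt0 e0 C0).
exists (fun x => c * h x); first exact: MZ.
under eq_fun do rewrite -mulrBr.
rewrite nsqZ; last by apply: L2B => //; exact: ML.
rewrite ltr_pdivlMr// mulrC in fh; apply: le_lt_trans fh.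
by rewrite ler_wpM2r ?nsq_ge0// lerDl.
Qed.

End L2closure.

(** * Goursat's theorem *)

Section goursat.
Variable R : realType.
Implicit Types (G : R -> R -> R[i]).
Local Notation leb := (@lebesgue_measure R).

(** Complex differentiability of [G s t], seen as a function of [s + i t]. *)
Definition cdiff_at G (s0 t0 : R) : Prop := exists A : R[i], forall e : R, 0 < e ->
  exists2 d : R, 0 < d & forall s t, `|s - s0| < d -> `|t - t0| < d ->
    normc (G s t - G s0 t0 - A * ((s - s0) +i* (t - t0))) <= e * (`|s - s0| + `|t - t0|).

Lemma normc_pair (x y : R) : normc (x +i* y) <= `|x| + `|y|.
Proof. exact: normc_leReIm. Qed.

Lemma cdiff_continuous G s0 t0 (e : R) : cdiff_at G s0 t0 -> 0 < e ->
  exists2 d : R, 0 < d & forall s t, `|s - s0| < d -> `|t - t0| < d ->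
    normc (G s t - G s0 t0) < e.
Proof.
move=> [A /(_ 1 ltr01)[d d0 H]] e0.
pose k := 1 + normc A.
have k0 : 0 < k by rewrite ltr_pwDl// normc_ge0.
exists (Num.min d (e / (4 * k))); first by rewrite lt_min d0 divr_gt0// mulr_gt0.
move=> s t; rewrite !lt_min => /andP[sd se] /andP[td te].
have := H s t sd td; rewrite mul1r => Hst.
have := normcD (G s t - G s0 t0 - A * ((s - s0) +i* (t - t0))) (A * ((s - s0) +i* (t - t0))).
rewrite subrK normcM => B1.
have B2 : normc A * normc ((s - s0) +i* (t - t0)) <= normc A * (`|s - s0| + `|t - t0|).
  by rewrite ler_wpM2l ?normc_ge0 ?normc_pair.
have B3 : k * (`|s - s0| + `|t - t0|) < k * (e / (2 * k)).
  rewrite ltr_pM2l// (_ : e / (2 * k) = e / (4 * k) + e / (4 * k)); first exact: ltrD.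
  by field; lra.
have E : k * (e / (2 * k)) = e / 2 by field; lra.
move: B3; rewrite E {1}/k mulrDl mul1r => B3; lra.
Qed.

Lemma cont_of_normc (f : R -> R[i]) (x0 : R) :
  (forall e : R, 0 < e -> exists2 d : R, 0 < d & forall x, `|x - x0| < d -> normc (f x - f x0) < e) ->
  {for x0, continuous (fun x => Re (f x))} /\ {for x0, continuous (fun x => Im (f x))}.
Proof.
move=> H; split; apply/cvgrPdist_lt => e e0; have [d d0 Hd] := H e e0;
  exists d => // x /= xd; rewrite distrC in xd; have := Hd x xd => ?; rewrite distrC.
- by rewrite -ReN -ReD (le_lt_trans (normc_geRe _)).
- by rewrite -ImN -ImD (le_lt_trans (normc_geIm _)).
Qed.

Lemma cont_cintegrable (f : R -> R[i]) (a b : R) :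
  (forall x0, x0 \in `[a, b] -> forall e : R, 0 < e ->
     exists2 d : R, 0 < d & forall x, `|x - x0| < d -> normc (f x - f x0) < e) ->
  cintegrable leb `[a, b] f.
Proof.
move=> H; split; apply: continuous_compact_integrable; try exact: segment_compact;
  apply: continuous_in_subspaceT => x /[!inE] xab;
  by have [] := cont_of_normc (H x xab).
Qed.

Lemma cint_itv_split (f : R -> R[i]) (a b c : R) : a <= b -> b <= c ->
  cintegrable leb `[a, c] f ->
  cint leb `[a, c] f = cint leb `[a, b] f + cint leb `[b, c] f.
Proof.
move=> ab bc [f1 f2].
have split1 (u : R -> R) : leb.-integrable `[a, c] (EFin \o u) ->
    \int[leb]_(x in `[a, c]) u x =
    \int[leb]_(x in `[a, b]) u x + \int[leb]_(x in `[b, c]) u x.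
  move=> ui; apply/eqP; rewrite addrC -subr_eq Rintegral_itvB ?bnd_simp//.
  rewrite Rintegral_itv_obnd_cbnd//.
  apply: integrableS ui => //; apply: subset_itvr; by rewrite bnd_simp.
by apply: complex_ext; rewrite /= split1.
Qed.

Lemma normc_cint_itv_le (f : R -> R[i]) (a b M : R) : a <= b ->
  cintegrable leb `[a, b] f -> (forall x, x \in `[a, b] -> normc (f x) <= M) ->
  normc (cint leb `[a, b] f) <= M * (b - a).
Proof.
move=> ab fi fM; apply: (le_trans (normc_cint_le _ fi)) => //.
have <- : \int[leb]_(x in `[a, b]) M = M * (b - a).
  rewrite Rintegral_cst//= lebesgue_measure_itv/= lte_fin.
  have [ab'|ba] := ltP a b; first by rewrite -EFinB.
  by rewrite (_ : b = a) ?subrr//; apply: le_anti; rewrite ab ba.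
apply: le_Rintegral => //; first exact: cintegrable_normc.
  apply: continuous_compact_integrable; first exact: segment_compact.
  by apply: continuous_subspaceT => x; exact: cvg_cst.
Qed.

Lemma cint_itv_cst (c : R[i]) (a b : R) : a <= b ->
  cint leb `[a, b] (fun=> c) = c * (b - a)%:C.
Proof.
move=> ab; have E (k : R) : \int[leb]_(x in `[a, b]) k = k * (b - a).
  rewrite Rintegral_cst//= lebesgue_measure_itv/= lte_fin.
  have [ab'|ba] := ltP a b; first by rewrite -EFinB.
  by rewrite (_ : b = a) ?subrr//; apply: le_anti; rewrite ab ba.
by apply: complex_ext; rewrite /= ?ReM ?ImM E /= ?mulr0 ?subr0 ?add0r.
Qed.

(** The contour integral of [G] along the boundary of the rectangle with lower left corner
   [a + i c] and sides [l] and [h]. *)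
Definition boundary_int G (a c l h : R) : R[i] :=
  (0 +i* 1) * (cint leb `[c, c + h] (fun t => G (a + l) t) -
               cint leb `[c, c + h] (fun t => G a t)) -
  (cint leb `[a, a + l] (fun s => G s (c + h)) -
   cint leb `[a, a + l] (fun s => G s c)).

Definition cdiff_on G (a c l h : R) : Prop :=
  forall s t, a <= s <= a + l -> c <= t <= c + h -> cdiff_at G s t.

Lemma vert_cintegrable G a c l h s : cdiff_on G a c l h -> a <= s <= a + l ->
  cintegrable leb `[c, c + h] (fun t => G s t).
Proof.
move=> D sa; apply: cont_cintegrable => t; rewrite in_itv/= => tc e e0.
have [d d0 H] := cdiff_continuous (D s t sa tc) e0.
by exists d => // t' t'd; apply: H => //; rewrite subrr normr0.
Qed.

Lemma horiz_cintegrable G a c l h t : cdiff_on G a c l h -> c <= t <= c + h ->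
  cintegrable leb `[a, a + l] (fun s => G s t).
Proof.
move=> D tc; apply: cont_cintegrable => s; rewrite in_itv/= => sa e e0.
have [d d0 H] := cdiff_continuous (D s t sa tc) e0.
by exists d => // s' s'd; apply: H => //; rewrite subrr normr0.
Qed.

Lemma cdiff_onS G a c l h a' c' l' h' : cdiff_on G a c l h ->
  a <= a' -> a' + l' <= a + l -> c <= c' -> c' + h' <= c + h -> cdiff_on G a' c' l' h'.
Proof.
move=> D aa al cc ch s t /andP[s1 s2] /andP[t1 t2]; apply: D; apply/andP; split.
- exact: le_trans s1.
- exact: le_trans al.
- exact: le_trans t1.
- exact: le_trans ch.
Qed.

Lemma boundary_int_hsplit G a c l1 l2 h : 0 <= l1 -> 0 <= l2 -> 0 <= h ->
  cdiff_on G a c (l1 + l2) h ->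
  boundary_int G a c (l1 + l2) h = boundary_int G a c l1 h + boundary_int G (a + l1) c l2 h.
Proof.
move=> l10 l20 h0 D; rewrite /boundary_int !addrA.
have cc : c <= c <= c + h by rewrite lexx lerDl.
have ch : c <= c + h <= c + h by rewrite lexx lerDl h0.
rewrite !(@cint_itv_split _ a (a + l1) (a + l1 + l2)) ?lerDl//.
- by ring.
- by rewrite -addrA; exact: (horiz_cintegrable D).
- by rewrite -addrA; exact: (horiz_cintegrable D).
Qed.

Lemma boundary_int_vsplit G a c l h1 h2 : 0 <= h1 -> 0 <= h2 -> 0 <= l ->
  cdiff_on G a c l (h1 + h2) ->
  boundary_int G a c l (h1 + h2) = boundary_int G a c l h1 + boundary_int G a (c + h1) l h2.
Proof.
move=> h10 h20 l0 D; rewrite /boundary_int !addrA.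
have aa : a <= a <= a + l by rewrite lexx lerDl.
have al : a <= a + l <= a + l by rewrite lexx lerDl l0.
rewrite !(@cint_itv_split _ c (c + h1) (c + h1 + h2)) ?lerDl//.
- by ring.
- by rewrite -addrA; exact: (vert_cintegrable D).
- by rewrite -addrA; exact: (vert_cintegrable D).
Qed.

Fact quarter_ineq (e e1 e2 e3 e4 u v : R) : v <= e3 + e4 -> u <= e1 + e2 -> e <= u + v ->
  4 * e1 < e -> 4 * e2 < e -> 4 * e3 < e -> e <= 4 * e4.
Proof. lra. Qed.

Lemma boundary_int_quarter G a c l h : 0 <= l -> 0 <= h -> cdiff_on G a c l h ->
  exists p : R * R, [/\ (p.1 = a \/ p.1 = a + l / 2), (p.2 = c \/ p.2 = c + h / 2) &
    normc (boundary_int G a c l h) <= 4 * normc (boundary_int G p.1 p.2 (l / 2) (h / 2))].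
Proof.
move=> l0 h0 D.
have l20 : 0 <= l / 2 by rewrite divr_ge0.
have h20 : 0 <= h / 2 by rewrite divr_ge0.
have El : l = l / 2 + l / 2 by field.
have Eh : h = h / 2 + h / 2 by field.
have D1 : cdiff_on G a c (l / 2) (h / 2 + h / 2) by apply: (cdiff_onS D); lra.
have D2 : cdiff_on G (a + l / 2) c (l / 2) (h / 2 + h / 2) by apply: (cdiff_onS D); lra.
have D3 : cdiff_on G a c (l / 2 + l / 2) h by apply: (cdiff_onS D); lra.
have E : boundary_int G a c l h =
    (boundary_int G a c (l / 2) (h / 2) + boundary_int G a (c + h / 2) (l / 2) (h / 2)) +
    (boundary_int G (a + l / 2) c (l / 2) (h / 2) +
     boundary_int G (a + l / 2) (c + h / 2) (l / 2) (h / 2)).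
  have H1 := boundary_int_hsplit l20 l20 h0 D3.
  have H2 := boundary_int_vsplit h20 h20 l20 D1.
  have H3 := boundary_int_vsplit h20 h20 l20 D2.
  rewrite -El in H1; rewrite -Eh in H2 H3.
  by rewrite H1 H2 H3.
have := normcD (boundary_int G a c (l / 2) (h / 2) + boundary_int G a (c + h / 2) (l / 2) (h / 2))
  (boundary_int G (a + l / 2) c (l / 2) (h / 2) +
     boundary_int G (a + l / 2) (c + h / 2) (l / 2) (h / 2)).
rewrite -E.
have := normcD (boundary_int G a c (l / 2) (h / 2)) (boundary_int G a (c + h / 2) (l / 2) (h / 2)).
have := normcD (boundary_int G (a + l / 2) c (l / 2) (h / 2))
   (boundary_int G (a + l / 2) (c + h / 2) (l / 2) (h / 2)).
set e1 := boundary_int G a c _ _; set e2 := boundary_int G a (c + h / 2) _ _.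
set e3 := boundary_int G (a + l / 2) c _ _; set e4 := boundary_int G (a + l / 2) (c + h / 2) _ _.
set e := boundary_int _ _ _ _ _ => i1 i2 i3.
have [c1|c1] := leP (normc e) (4 * normc e1).
  by exists (a, c); split => //; left.
have [c2|c2] := leP (normc e) (4 * normc e2).
  by exists (a, c + h / 2); split => //; [left|right].
have [c3|c3] := leP (normc e) (4 * normc e3).
  by exists (a + l / 2, c); split => //; [right|left].
exists (a + l / 2, c + h / 2); split; [by right|by right|].
exact: quarter_ineq i1 i2 i3 c1 c2 c3.
Qed.

(** [boundary_int] vanishes on affine functions, so only the error of the linear
   approximation contributes. *)
Lemma boundary_int_small G a c l h (B : R[i]) (C0 : R[i]) (s0 t0 e : R) :
  0 <= l -> 0 <= h -> cdiff_on G a c l h ->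
  (forall s t, a <= s <= a + l -> c <= t <= c + h ->
    normc (G s t - C0 - B * ((s - s0) +i* (t - t0))) <= e) ->
  normc (boundary_int G a c l h) <= 2 * e * (l + h).
Proof.
move=> l0 h0 D H.
have aa : a <= a <= a + l by rewrite lexx lerDl.
have al : a <= a + l <= a + l by rewrite lexx lerDl l0.
have cc : c <= c <= c + h by rewrite lexx lerDl.
have ch : c <= c + h <= c + h by rewrite lexx lerDl h0.
have cal : a <= a + l by lra.
have cch : c <= c + h by lra.
have iV s : a <= s <= a + l -> _ := fun p => vert_cintegrable D p.
have iH t : c <= t <= c + h -> _ := fun p => horiz_cintegrable D p.
have icst (x y : R) (k : R[i]) : cintegrable leb `[x, y] (fun=> k).
  apply: cont_cintegrable => x0 _ e' e'0; exists 1 => // z _.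
  by rewrite subrr normc0.
pose vd t := G (a + l) t - G a t - B * l%:C.
pose hd s := G s (c + h) - G s c - B * (0 +i* h).
have mI (x y : R) : measurable `[x, y] by [].
have ivd : cintegrable leb `[c, c + h] vd.
  by apply: cintegrableB => //; apply: cintegrableB => //; exact: iV.
have ihd : cintegrable leb `[a, a + l] hd.
  by apply: cintegrableB => //; apply: cintegrableB => //; exact: iH.
have E : boundary_int G a c l h = (0 +i* 1) * cint leb `[c, c + h] vd - cint leb `[a, a + l] hd.
  rewrite /vd /hd !cintB//; try (by apply: cintegrableB => //; [exact: iV|exact: iV]);
    try (by apply: cintegrableB => //; [exact: iH|exact: iH]); try exact: iV; try exact: iH.
  rewrite !cint_itv_cst//.
  have -> : c + h - c = h by ring.
  have -> : a + l - a = l by ring.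
  have -> : (0 +i* h) = (0 +i* 1) * h%:C :> R[i] by simpc.
  by rewrite /boundary_int; ring.
have vb : normc (cint leb `[c, c + h] vd) <= (2 * e) * (c + h - c).
  apply: normc_cint_itv_le => // t; rewrite in_itv/= => tc.
  have := normcB (G (a + l) t - C0 - B * ((a + l - s0) +i* (t - t0)))
     (G a t - C0 - B * ((a - s0) +i* (t - t0))).
  have := H _ _ al tc; have := H _ _ aa tc.
  set u := normc _; set v := normc _.
  rewrite [X in normc X <= _](_ : _ = vd t).
    by move=> a1 a2 a3; rewrite (le_trans a3)// mulr_natl mulr2n lerD.
  have -> : ((a + l - s0) +i* (t - t0)) = ((a - s0) +i* (t - t0)) + l%:C.
    by simpc; congr Complex; ring.
  by rewrite /vd; ring.
have hb : normc (cint leb `[a, a + l] hd) <= (2 * e) * (a + l - a).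
  apply: normc_cint_itv_le => // s; rewrite in_itv/= => sa.
  have := normcB (G s (c + h) - C0 - B * ((s - s0) +i* (c + h - t0)))
     (G s c - C0 - B * ((s - s0) +i* (c - t0))).
  have := H _ _ sa ch; have := H _ _ sa cc.
  set u := normc _; set v := normc _.
  rewrite [X in normc X <= _](_ : _ = hd s).
    by move=> a1 a2 a3; rewrite (le_trans a3)// mulr_natl mulr2n lerD.
  have -> : ((s - s0) +i* (c + h - t0)) = ((s - s0) +i* (c - t0)) + (0 +i* h).
    by simpc; congr Complex; ring.
  by rewrite /hd; ring.
rewrite E (le_trans (normcB _ _))// normcM.
have -> : normc (0 +i* 1) = 1 :> R by rewrite /Normc.normc expr0n expr1n add0r sqrtr1.
by lra.
Qed.

Fact dist_in_box (p q s s0 : R) : p <= s -> s <= p + q -> `|s0 - p| <= 2 * q ->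
  `|s - s0| <= 3 * q.
Proof.
move=> p1 p2 p3; have := ler_distD p s s0; rewrite (distrC p) (@ger0_norm _ (s - p)) ?subr_ge0//.
lra.
Qed.

(** Goursat: bisection produces nested rectangles on which the integral is at least
   [4 ^ -n] times the original, while differentiability at their common point makes
   it [o(4 ^ -n)]. *)
Lemma goursat G a c l h : 0 <= l -> 0 <= h -> cdiff_on G a c l h ->
  boundary_int G a c l h = 0.
Proof.
move=> l0 h0 D.
pose sub n (p : R * R) := [/\ a <= p.1, p.1 + l * 2^-1 ^+ n <= a + l,
  c <= p.2 & p.2 + h * 2^-1 ^+ n <= c + h].
pose BI n (p : R * R) := boundary_int G p.1 p.2 (l * 2^-1 ^+ n) (h * 2^-1 ^+ n).
have step (n : nat) (p : R * R) : exists q : R * R, sub n p ->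
    [/\ sub n.+1 q, p.1 <= q.1 <= p.1 + l * 2^-1 ^+ n / 2,
    p.2 <= q.2 <= p.2 + h * 2^-1 ^+ n / 2 & normc (BI n p) <= 4 * normc (BI n.+1 q)].
  have e0 : 0 <= (2^-1 : R) ^+ n by rewrite exprn_ge0.
  have le0 : 0 <= l * 2^-1 ^+ n by rewrite mulr_ge0.
  have he0 : 0 <= h * 2^-1 ^+ n by rewrite mulr_ge0.
  have [[a1 a2 c1 c2]|ns] := pselect (sub n p); last by exists p => /ns.
  have Dp : cdiff_on G p.1 p.2 (l * 2^-1 ^+ n) (h * 2^-1 ^+ n) by apply: (cdiff_onS D).
  have [[qa qb] [/= q1 q2 qn]] := boundary_int_quarter le0 he0 Dp.
  have El : l * 2^-1 ^+ n.+1 = l * 2^-1 ^+ n / 2 by rewrite exprS; field.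
  have Eh : h * 2^-1 ^+ n.+1 = h * 2^-1 ^+ n / 2 by rewrite exprS; field.
  exists (qa, qb) => _; rewrite /BI/sub El Eh /=; split => //; clear - q1 q2 le0 he0 a1 a2 c1 c2.
  - by move: (l * _) (h * _) le0 he0 a1 a2 c1 c2 q1 q2 => u v ? ? ? ? ? ? [] -> [] ->; split; lra.
  - by move: (l * _) le0 a1 a2 q1 => u ? ? ? [] ->; apply/andP; split; lra.
  - by move: (h * _) he0 c1 c2 q2 => u ? ? ? [] ->; apply/andP; split; lra.
have [nxt nxtP] : {nxt : nat -> R * R -> R * R | forall n p, sub n p ->
    [/\ sub n.+1 (nxt n p), p.1 <= (nxt n p).1 <= p.1 + l * 2^-1 ^+ n / 2,
    p.2 <= (nxt n p).2 <= p.2 + h * 2^-1 ^+ n / 2 & normc (BI n p) <= 4 * normc (BI n.+1 (nxt n p))]}.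
  exists (fun n p => sval (cid (step n p))) => n p sp.
  by case: (cid (step n p)) => q /= /(_ sp).
pose P := fix P n := if n is m.+1 then nxt m (P m) else (a, c).
have sP n : sub n (P n).
  elim: n => [|n ih] /=; first by rewrite /sub expr0 !mulr1 /=; split.
  by have [] := nxtP n _ ih.
have bP n : normc (boundary_int G a c l h) <= 4 ^+ n * normc (BI n (P n)).
  elim: n => [|n ih]; first by rewrite expr0 mul1r /BI expr0 !mulr1.
  apply: (le_trans ih); rewrite exprSr -mulrA ler_wpM2l ?exprn_ge0//.
  by have [] := nxtP n _ (sP n).
have st1 n : `|(P n.+1).1 - (P n).1| <= l * 2^-1 ^+ n.
  have [_ /andP[q1 q2] _ _] := nxtP n _ (sP n).
  have e0 : 0 <= l * 2^-1 ^+ n by rewrite mulr_ge0// exprn_ge0.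
  by rewrite ger0_norm ?subr_ge0//= lerBlDl (le_trans q2)// lerD2l; lra.
have st2 n : `|(P n.+1).2 - (P n).2| <= h * 2^-1 ^+ n.
  have [_ _ /andP[q1 q2] _] := nxtP n _ (sP n).
  have e0 : 0 <= h * 2^-1 ^+ n by rewrite mulr_ge0// exprn_ge0.
  by rewrite ger0_norm ?subr_ge0//= lerBlDl (le_trans q2)// lerD2l; lra.
have [cs bs] := geometric_cauchy st1; have [ct bt] := geometric_cauchy st2.
set s0 := limn _ in bs; set t0 := limn _ in bt.
have hs0 : a <= s0 <= a + l.
  apply/andP; split.
  - apply: (cvgr_to_ge cs); apply: nearW => n; by case: (sP n).
  - apply: (cvgr_to_le cs); apply: nearW => n; case: (sP n) => _ H _ _.
    by apply: le_trans H; rewrite lerDl mulr_ge0// exprn_ge0.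
have ht0 : c <= t0 <= c + h.
  apply/andP; split.
  - apply: (cvgr_to_ge ct); apply: nearW => n; by case: (sP n).
  - apply: (cvgr_to_le ct); apply: nearW => n; case: (sP n) => _ _ _ H.
    by apply: le_trans H; rewrite lerDl mulr_ge0// exprn_ge0.
have [A HA] := D s0 t0 hs0 ht0.
apply: normc_eq0; apply/eqP; rewrite eq_le normc_ge0 andbT.
apply/ler_addgt0Pr => e e0; rewrite add0r.
pose K := l + h + 1; have K0 : 0 < K by rewrite /K; lra.
have e'0 : 0 < e / (6 * K ^+ 2) by rewrite divr_gt0// mulr_gt0// exprn_gt0.
have [d d0 Hd] := HA _ e'0.
have c0 : (K * 2^-1 ^+ n) @[n --> \oo] --> (0 : R).
  rewrite -[0 in X in _ --> X](mulr0 K); apply: cvgMr.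
  by apply: cvg_expr; rewrite ger0_norm// invf_lt1// ltr1n.
have d30 : 0 < d / 3 by rewrite divr_gt0.
have /cvgrPdist_lt/(_ _ d30)[N _ /(_ N (leqnn N))/=] := c0.
set u := 2^-1 ^+ N; have u0 : 0 < u by rewrite exprn_gt0.
rewrite sub0r normrN ger0_norm ?mulr_ge0 ?(ltW K0) ?(ltW u0)// => Ku.
have [p1 p2 p3 p4] := sP N; rewrite -/u in p2 p4.
have := bs N; have := bt N; rewrite -/u => bt' bs'.
have lu : 0 <= l * u by rewrite mulr_ge0// ltW.
have hu : 0 <= h * u by rewrite mulr_ge0// ltW.
have KE : K * u = l * u + h * u + u by rewrite /K; ring.
have small : normc (BI N (P N)) <= 2 * (e / (6 * K ^+ 2) * (3 * (K * u))) * (l * u + h * u).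
  rewrite /BI -/u; apply: (@boundary_int_small _ _ _ _ _ A (G s0 t0) s0 t0) => //.
    exact: (cdiff_onS D).
  move=> s t /andP[s1 s2] /andP[t1 t2].
  have Hs : `|s - s0| <= 3 * (l * u) by apply: (dist_in_box s1 s2); rewrite mulrA.
  have Ht : `|t - t0| <= 3 * (h * u) by apply: (dist_in_box t1 t2); rewrite mulrA.
  have [b1 b2 b3] : [/\ 3 * (l * u) < d, 3 * (h * u) < d & 
      3 * (l * u) + 3 * (h * u) <= 3 * (K * u)].
    move: Ku KE lu hu u0; move: (K * u) (l * u) (h * u) => x y z; clear => *; split; lra.
  apply: (le_trans (Hd s t (le_lt_trans Hs b1) (le_lt_trans Ht b2))).
  by rewrite ler_pM2l// (le_trans (lerD Hs Ht)).
apply: (le_trans (bP N)).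
apply: (le_trans (ler_wpM2l _ small)); first by rewrite exprn_ge0.
have uu : 4 ^+ N * u ^+ 2 = 1.
  by rewrite /u -exprM mulnC exprM -exprMn (_ : 4 * 2^-1 ^+ 2 = 1) ?expr1n//; field.
have -> : 4 ^+ N * (2 * (e / (6 * K ^+ 2) * (3 * (K * u))) * (l * u + h * u)) =
    (4 ^+ N * u ^+ 2) * (e * ((l + h) / K)).
  by move: (4 ^+ N) K0; clearbody K u => F K0; field; rewrite gt_eqF.
by rewrite uu mul1r ler_piMr ?(ltW e0)// ler_pdivrMr// mul1r /K lerDl.
Qed.

End goursat.

(** * Integration on the circle *)

Section circle_integral.
Variable R : realType.
Local Notation m := (arc_measure R).
Local Notation leb := (@lebesgue_measure R).
Implicit Types (u : circle R -> R) (f : circle R -> R[i]).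

Lemma zcoord_expi (t : R) : zcoord (expi t) = cos t +i* sin t :> R[i].
Proof. by []. Qed.

Lemma normc_zcoord (x : circle R) : normc (zcoord x) = 1.
Proof.
apply: complexI; rewrite -normrE.
exact: (set_mem (valP (x : circle_top R))).
Qed.

Lemma circle_measurable (g : circle_top R -> R) : continuous g ->
  measurable_fun setT (g : circle R -> R).
Proof.
move=> /continuousP cg; apply: (measurability _ (RGenOpens.measurableE R)).
move=> _ [_ [a [b ->] <-]]; rewrite setTI; apply: sub_sigma_algebra.
exact/cg/interval_open.
Qed.

Lemma continuous_ReIm_zcoord :
  continuous (fun x : circle_top R => Re (zcoord x)) /\
  continuous (fun x : circle_top R => Im (zcoord x)).
Proof.
have cRe : continuous (fun z : R[i]^o => Re z : R).
  move=> z; apply/(@cvgrPdist_lt _ _ _ (nbhs z) (nbhs_filter z)) => e e0; exists e%:C => /=; first by rewrite ltcR.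
  move=> w /=; rewrite normrE ltcR; apply: le_lt_trans.
  by rewrite -ReN -ReD; exact: normc_geRe.
have cIm : continuous (fun z : R[i]^o => Im z : R).
  move=> z; apply/(@cvgrPdist_lt _ _ _ (nbhs z) (nbhs_filter z)) => e e0; exists e%:C => /=; first by rewrite ltcR.
  move=> w /=; rewrite normrE ltcR; apply: le_lt_trans.
  by rewrite -ImN -ImD; exact: normc_geIm.
by split => x; apply: continuous_comp; [exact: initial_continuous|exact: cRe|
  exact: initial_continuous|exact: cIm].
Qed.

Lemma cmeas_zcoord : cmeas setT (@zcoord R).
Proof. by case: continuous_ReIm_zcoord => /circle_measurable ? /circle_measurable. Qed.

Definition clip_acos (x : R) : R := acos (Num.max (-1) (Num.min 1 x)).

Lemma clip_itv (x : R) : -1 <= Num.max (-1) (Num.min 1 x) <= 1.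
Proof. by rewrite le_max lexx/= ge_max ge_min lexx/= andbT; lra. Qed.

Lemma measurable_clip_acos : measurable_fun setT clip_acos.
Proof.
apply: nonincreasing_measurable => // x y xy; rewrite /clip_acos.
have := clip_itv x; have := clip_itv y.
have : Num.max (-1) (Num.min 1 x) <= Num.max (-1) (Num.min 1 y).
  by rewrite ge_max le_max lexx/= le_max le_min !ge_min lexx/= xy !orbT.
move: (Num.max _ _) (Num.max _ _) => a b ab b1 a1.
rewrite leNgt; apply/negP; rewrite -ltr_cos ?in_itv/= ?acos_ge0 ?acos_lepi//.
by rewrite !acosK ?in_itv// => /(le_lt_trans ab); rewrite ltxx.
Qed.

(** [acos] determines the argument up to sign, and the imaginary part gives the sign; the
   clipping extends [acos] to a monotone, hence measurable, function on the line. *)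
Definition arg (x : circle R) : R :=
  if 0 <= Im (zcoord x) then clip_acos (Re (zcoord x))
  else 2 * pi - clip_acos (Re (zcoord x)).

Lemma clip_id (x : R) : -1 <= x <= 1 -> Num.max (-1) (Num.min 1 x) = x.
Proof. by move=> /andP[x1 x2]; rewrite min_r// max_r. Qed.

Lemma circle_inj (x y : circle R) : zcoord x = zcoord y -> x = y.
Proof. exact: val_inj. Qed.

Lemma sqr_ReIm_zcoord (x : circle R) : Re (zcoord x) ^+ 2 + Im (zcoord x) ^+ 2 = 1.
Proof. by rewrite -sqr_normcE normc_zcoord expr1n. Qed.

Lemma Re_zcoord_itv (x : circle R) : -1 <= Re (zcoord x) <= 1.
Proof. by rewrite -ler_norml -(normc_zcoord x) normc_geRe. Qed.

Lemma expi_arg (x : circle R) : expi (arg x) = x.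
Proof.
apply: circle_inj; rewrite zcoord_expi /arg /clip_acos (clip_id (Re_zcoord_itv x)).
have Eac := acosK (Re_zcoord_itv x).
have Esin : sin (acos (Re (zcoord x))) = `|Im (zcoord x)|.
  rewrite sin_acos ?Re_zcoord_itv// -(sqr_ReIm_zcoord x) addrC addKr.
  exact: sqrtr_sqr.
have c2 a : cos (2 * pi - a) = cos a :> R.
  by rewrite addrC mulrC mulr_natr cosD2pi cosN.
have s2 a : sin (2 * pi - a) = - sin a :> R.
  by rewrite addrC mulrC mulr_natr sinD2pi sinN.
case: ifPn => [i0|]; last rewrite -ltNge => i0.
- by rewrite Eac Esin ger0_norm//; case: (zcoord x).
- by rewrite c2 s2 Eac Esin ltr0_norm// opprK; case: (zcoord x).
Qed.

Lemma arg_expi (t : R) : 0 <= t -> t < 2 * pi -> arg (expi t) = t.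
Proof.
move=> t0 t2; rewrite /arg zcoord_expi /=.
have ct (y : R) : -1 <= cos y <= 1 by rewrite cos_geN1 cos_le1.
rewrite /clip_acos clip_id//.
have [tp|tp] := leP t pi.
  by rewrite sin_ge0_pi ?t0// cosK// in_itv/= t0.
have -> : cos t = cos (2 * pi - t) by rewrite addrC mulrC mulr_natr cosD2pi cosN.
have -> : sin t = - sin (2 * pi - t).
  by rewrite (addrC _ (- t)) mulrC mulr_natr sinD2pi sinN opprK.
have s0 : 0 < sin (2 * pi - t) by apply: sin_gt0_pi; rewrite -?(rwP andP); lra.
rewrite leNgt oppr_lt0 s0/= cosK; first by ring.
by rewrite in_itv/=; apply/andP; split; lra.
Qed.

Lemma measurable_arg : measurable_fun setT arg.
Proof.
have [mRe mIm] := cmeas_zcoord.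
have mac : measurable_fun setT (fun x : circle R => clip_acos (Re (zcoord x))).
  exact: (measurableT_comp measurable_clip_acos).
apply: measurable_fun_ifT => //.
- apply: measurable_fun_ler => //; exact: measurable_cst.
- by apply: measurable_funB => //; exact: measurable_cst.
Qed.

Lemma arg_itv (x : circle R) : 0 <= arg x < 2 * pi.
Proof.
have pi0 := pi_gt0 R.
have a0 := acos_ge0 (Re_zcoord_itv x); have a1 := acos_lepi (Re_zcoord_itv x).
rewrite /arg /clip_acos clip_id ?Re_zcoord_itv//; case: ifPn => [i0|].
  by apply/andP; split => //; lra.
rewrite -ltNge => i0; apply/andP; split; first lra.
suff : 0 < acos (Re (zcoord x)) by lra.
apply: acos_gt0; have /andP[-> r1] := Re_zcoord_itv x; rewrite lt_neqAle r1 andbT /=.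
by apply/eqP => r; have := sqr_ReIm_zcoord x; rewrite r; nra.
Qed.

(** The exceptional set on the circle is the preimage of a null set of the line by [arg],
   which inverts [expi] off the end points of the period. *)
Lemma ae_circle (P : circle R -> Prop) :
  {ae leb, forall t, 0 < t < 2 * pi -> P (expi t)} -> {ae m, forall x, P x}.
Proof.
move=> [N [mN N0 NP]].
have mA : measurable (arg @^-1` (N `|` [set 0])).
  by rewrite -[_ @^-1` _]setTI; apply: measurable_arg => //; apply: measurableU.
exists (arg @^-1` (N `|` [set 0])); split => //.
- have -> : m (arg @^-1` (N `|` [set 0%R])) =
      (\int[leb]_(x in @expi R @^-1` (arg @^-1` (N `|` [set 0%R]))) (uniform_pdf 0 (2 * pi) x)%:E)%E by [].
  rewrite integral_uniform_pdf.
  have mU : measurable (@expi R @^-1` (arg @^-1` (N `|` [set 0%R])) `&` `[0%R, (2 * pi : R)%R]).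
    apply: measurableI => //; rewrite -[X in measurable X]setTI.
    exact: measurable_expi.
  apply: null_set_integral => //.
    by apply/measurable_EFinP/measurable_funTS; exact: measurable_uniform_pdf.
  apply: (@subset_measure0 _ _ _ _ _ (N `|` [set 0%R] `|` [set (2 * pi)%R])) => //.
  - by do 2 apply: measurableU => //.
  - move=> t [/= tN]; rewrite in_itv/= => /andP[t0 t2].
    have [tE|tl] := eqVneq t (2 * pi); first by right.
    left; move: tN; rewrite /preimage/= arg_expi//.
    by rewrite lt_neqAle tl.
  - have n1 (a : R) : leb.-negligible [set a].
      by apply/negligibleP => //; exact: lebesgue_measure_set1.
    have nN : leb.-negligible N by apply/negligibleP.
    apply/negligibleP; first by do 2 apply: measurableU => //.
    by apply: negligibleU => //; exact: negligibleU.
- move=> x /= nP; rewrite /preimage/=.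
  have /andP[a0 a2] := arg_itv x.
  have [->|an] := eqVneq (arg x) 0; first by right.
  left; apply: NP => /=; rewrite expi_arg => h; apply: nP; apply: h.
  by rewrite lt_neqAle eq_sym an a0.
Qed.

Lemma arc_integral_ge0 (g : circle R -> \bar R) : measurable_fun setT g ->
  (forall x, 0 <= g x)%E ->
  (\int[m]_x g x = ((2 * pi : R)^-1)%R%:E * \int[leb]_(t in `[0%R, (2 * pi : R)%R]) g (expi t))%E.
Proof.
move=> mg g0; rewrite ge0_integral_distribution//.
rewrite integral_uniform//; first by rewrite subr0.
- exact: measurableT_comp.
- by move=> t; exact: g0.
Qed.

Lemma arc_rintegrable u : m.-integrable setT (EFin \o u) ->
  leb.-integrable `[0, 2 * pi] (EFin \o (u \o @expi R)).
Proof.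
move=> /integrableP[mu ui]; apply/integrableP; split.
  by apply: measurable_funTS; exact: (measurableT_comp mu (@measurable_expi R)).
rewrite arc_integral_ge0 in ui; last 2 first.
- exact: measurableT_comp.
- by [].
have K0 : 0 < (2 * pi : R)^-1 by rewrite invr_gt0 two_pi_gt0.
move: ui; rewrite -/(comp _ _); set X := (X in (_ * X < _)%E).
rewrite (_ : (\int[_]_(_ in _) _)%E = X)//.
by case: X => [r| |]; rewrite ?ltry// gt0_muley ?lte_fin.
Qed.

Lemma arc_Rintegral u : m.-integrable setT (EFin \o u) ->
  \int[m]_x u x = (2 * pi)^-1 * \int[leb]_(t in `[0, 2 * pi]) u (expi t).
Proof.
move=> ui; have mu := rintegrable_meas ui.
rewrite /Rintegral integralE arc_integral_ge0//; last exact/measurable_funepos/measurable_EFinP.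
rewrite arc_integral_ge0//; last exact/measurable_funeneg/measurable_EFinP.
have ue := arc_rintegrable ui.
have fp : (\int[leb]_(t in `[0%R, (2 * pi : R)%R]) (EFin \o (u \o @expi R))^\+ t)%E \is a fin_num.
  exact: integrable_pos_fin_num.
have fn : (\int[leb]_(t in `[0%R, (2 * pi : R)%R]) (EFin \o (u \o @expi R))^\- t)%E \is a fin_num.
  exact: integrable_neg_fin_num.
rewrite [in RHS]integralE.
set Ip := (X in fine (_ * X - _)); set In := (X in fine (_ - _ * X)).
have Ep : Ip = (\int[leb]_(t in `[0%R, (2 * pi : R)%R]) (EFin \o (u \o @expi R))^\+ t)%E.
  by apply: eq_integral => t _; rewrite !funeposE.
have En : In = (\int[leb]_(t in `[0%R, (2 * pi : R)%R]) (EFin \o (u \o @expi R))^\- t)%E.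
  by apply: eq_integral => t _; rewrite !funenegE.
rewrite -[X in _ = _ * fine X]/(\int[leb]_(t in `[0%R, (2 * pi : R)%R]) (EFin \o (u \o @expi R))^\+ t -
  \int[leb]_(t in `[0%R, (2 * pi : R)%R]) (EFin \o (u \o @expi R))^\- t)%E -Ep -En.
rewrite -Ep in fp; rewrite -En in fn; clearbody Ip In.
by rewrite -(fineK fp) -(fineK fn) -!EFinM -!EFinB /= mulrBr.
Qed.

Lemma arc_cintegrable f : cintegrable m setT f ->
  cintegrable leb `[0, 2 * pi] (f \o @expi R).
Proof. by move=> [f1 f2]; split; [exact: (arc_rintegrable f1)|exact: (arc_rintegrable f2)]. Qed.

Lemma arc_cint f : cintegrable m setT f ->
  cint m setT f = ((2 * pi)^-1)%:C * cint leb `[0, 2 * pi] (fun t => f (expi t)).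
Proof.
move=> [f1 f2]; apply: complex_ext.
- by rewrite ReM/= mul0r subr0 arc_Rintegral.
- by rewrite ImM/= mul0r addr0 arc_Rintegral.
Qed.

Lemma arc_cintegrable_bounded f (M : R) : cmeas setT f ->
  {ae m, forall x, normc (f x) <= M} -> cintegrable m setT f.
Proof.
move=> mf fM; apply: (@ae_cintegrable_le _ _ _ _ _ measurableT f (fun=> M)) => //.
  by apply: filterS fM.
exact: finite_measure_integrable_cst.
Qed.

End circle_integral.

(** * Circle means of holomorphic functions *)

Section mean_value.
Variable R : realType.
Local Notation m := (arc_measure R).
Local Notation leb := (@lebesgue_measure R).
Implicit Types (F : R[i]^o -> R[i]^o).

Lemma derivable_expansion F (w0 : R[i]) : derivable (F : R[i]^o -> R[i]^o) w0 1 ->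
  exists A : R[i], forall e : R, 0 < e -> exists2 d : R, 0 < d &
    forall w : R[i], normc (w - w0) < d ->
      normc (F w - F w0 - A * (w - w0)) <= e * normc (w - w0).
Proof.
move=> dF; exists ('D_1 F w0 : R[i]^o) => e e0.
set A : R[i] := 'D_1 F w0.
have /cvgrPdist_le/(_ e%:C) := dF; rewrite -/('D_1 F w0).
rewrite ltcR => /(_ e0) [d /= d0 Hd].
have dE : d = (Re d)%:C by move: d0; rewrite ltcE => /andP[/eqP h _]; apply: complex_ext.
exists (Re d); first by move: d0; rewrite dE ltcR.
move=> w wd; have [->|ww0] := eqVneq w w0.
  by rewrite !subrr mulr0 subr0 normc0 mulr0.
have h0 : w - w0 != 0 by rewrite subr_eq0.
have := Hd (w - w0); rewrite /ball/= sub0r normrN normrE dE ltcR => /(_ wd h0).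
rewrite normrE lecR /shift/= -[(w - w0) *: 1]/((w - w0) * 1) mulr1 subrK.
rewrite -[_ *: _]/((w - w0)^-1 * (F w - F w0)) => H.
have -> : F w - F w0 - A * (w - w0) = - ((A - (w - w0)^-1 * (F w - F w0)) * (w - w0)).
  by field.
by rewrite normcN normcM ler_wpM2r ?normc_ge0.
Qed.

Lemma expansion_derivable F (w0 A : R[i]) :
  (forall e : R, 0 < e -> exists2 d : R, 0 < d &
    forall w : R[i], normc (w - w0) < d ->
      normc (F w - F w0 - A * (w - w0)) <= e * normc (w - w0)) ->
  derivable (F : R[i]^o -> R[i]^o) w0 1.
Proof.
move=> H; apply/cvg_ex; exists (A : R[i]^o).
apply/cvgrPdist_le => e; rewrite ltcE => /andP[/eqP eI eR].
have eE : e = (Re e)%:C by exact: complex_ext.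
have [d d0 Hd] := H _ eR; exists d%:C => /=; first by rewrite ltcR.
move=> h; rewrite /ball/= sub0r normrN normrE ltcR => hd h0.
have := Hd (h + w0); rewrite addrK => /(_ hd) H1.
rewrite eE normrE lecR /shift/= -[h *: 1]/(h * 1) mulr1 -[_ *: _]/(h^-1 * (F (h + w0) - F w0)).
have -> : A - h^-1 * (F (h + w0) - F w0) = - (h^-1 * (F (h + w0) - F w0 - A * h)) by field.
rewrite normcN normcM normcV ler_pdivrMl ?lt_def ?normc_ge0 ?andbT//; last first.
  by apply/eqP => /normc_eq0 hh; rewrite hh eqxx in h0.
by rewrite [X in _ <= X]mulrC.
Qed.

Lemma derivable_mul_id F (w0 : R[i]) : derivable (F : R[i]^o -> R[i]^o) w0 1 ->
  derivable ((fun w => F w * w) : R[i]^o -> R[i]^o) w0 1.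
Proof.
move=> /derivable_expansion[A HA].
apply: (@expansion_derivable _ _ (A * w0 + F w0)) => e e0.
pose K := normc w0 + 1; have K0 : 0 < K by rewrite ltr_wpDl// normc_ge0.
pose a := normc A + 1; have a0 : 0 < a by rewrite ltr_wpDl// normc_ge0.
have [d d0 Hd] := HA (e / (2 * K)) (divr_gt0 e0 (mulr_gt0 (ltr0Sn _ _) K0)).
exists (Num.min (Num.min d 1) (e / (2 * a))).
  by rewrite !lt_min d0 ltr01 divr_gt0// mulr_gt0.
move=> w; rewrite !lt_min => /andP[/andP[wd w1] we].
have -> : F w * w - F w0 * w0 - (A * w0 + F w0) * (w - w0) =
  (F w - F w0 - A * (w - w0)) * w + A * (w - w0) * (w - w0) by ring.
apply: (le_trans (normcD _ _)); rewrite !normcM.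
set n := normc (w - w0) in wd w1 we *; have n0 : 0 <= n by exact: normc_ge0.
have wK : normc w <= K by have := normcD (w - w0) w0; rewrite subrK -/n /K; lra.
have k1 : normc (F w - F w0 - A * (w - w0)) * normc w <= e / 2 * n.
  apply: (@le_trans _ _ (e / (2 * K) * n * K)).
    by apply: ler_pM => //; rewrite ?normc_ge0//; exact: Hd.
  by apply: eq_lew; field; lra.
have k2 : normc A * n * n <= e / 2 * n.
  rewrite ler_wpM2r//; apply: (@le_trans _ _ (a * (e / (2 * a)))).
    by apply: ler_pM; [exact: normc_ge0|exact: n0|rewrite /a; lra|exact: ltW].
  by apply: eq_lew; field; lra.
lra.
Qed.

Lemma derivable_normc_cont F (w0 : R[i]) (e : R) : derivable (F : R[i]^o -> R[i]^o) w0 1 -> 0 < e ->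
  exists2 d : R, 0 < d & forall w : R[i], normc (w - w0) < d -> normc (F w - F w0) < e.
Proof.
move=> /derivable_expansion[A /(_ 1 ltr01)[d d0 H]] e0.
have k0 : 0 < 1 + normc A by rewrite ltr_pwDl// normc_ge0.
exists (Num.min d (e / (2 * (1 + normc A)))).
  by rewrite lt_min d0 divr_gt0// mulr_gt0.
move=> w; rewrite lt_min => /andP[wd we].
have := H w wd; have := normcD (F w - F w0 - A * (w - w0)) (A * (w - w0)).
rewrite subrK normcM mul1r => h1 h2.
have h3 : (1 + normc A) * normc (w - w0) < e / 2.
  rewrite (_ : e / 2 = (1 + normc A) * (e / (2 * (1 + normc A)))) ?ltr_pM2l//.
  by field; lra.
by lra.
Qed.

(** The complex exponential of [s + i t]. *)
Definition cexp (s t : R) : R[i] := (expR s * cos t) +i* (expR s * sin t).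

Lemma cexpD s t a b : cexp (s + a) (t + b) = cexp s t * cexp a b.
Proof. by apply: complex_ext; rewrite ?ReM ?ImM /= expRD ?cosD ?sinD; ring. Qed.

Lemma normc_cexp s t : normc (cexp s t) = expR s.
Proof.
apply/eqP; rewrite -(@eqrXn2 _ 2)// ?normc_ge0 ?expR_ge0//.
by rewrite sqr_normcE /= !exprMn -mulrDr cos2Dsin2 mulr1.
Qed.

Lemma cexp_periodic s : cexp s (2 * pi) = cexp s 0.
Proof. by rewrite /cexp (mulr_natl pi 2) cos2pi sin2pi cos0 sin0. Qed.

Lemma is_derive0_bound (f : R -> R) (l e : R) : is_derive (0 : R) 1 f l -> 0 < e ->
  exists2 d : R, 0 < d & forall h, `|h| < d -> `|f h - f 0 - l * h| <= e * `|h|.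
Proof.
move=> [df fl] e0; move: df; rewrite /derivable => df.
have : (fun h : R => h^-1 *: ((f \o shift 0) (h *: 1) - f 0)) @ 0^' --> l.
  by rewrite -fl; exact: df.
move=> /cvgrPdist_le/(_ _ e0)[d /= d0 Hd]; exists d => // h hd.
have [->|h0] := eqVneq h 0; first by rewrite subrr sub0r mulr0 oppr0 normr0 mulr0.
have := Hd h; rewrite /ball/= sub0r normrN => /(_ hd h0).
rewrite /shift/= -[h *: 1]/(h * 1) mulr1 addr0 -[_ *: _]/(h^-1 * (f h - f 0)) => H.
have -> : f h - f 0 - l * h = - ((l - h^-1 * (f h - f 0)) * h) by field.
by rewrite normrN normrM ler_wpM2r.
Qed.

Lemma cexp_expansion0 (e : R) : 0 < e -> exists2 d : R, 0 < d &
  forall a b, `|a| < d -> `|b| < d ->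
    normc (cexp a b - 1 - (a +i* b)) <= e * (`|a| + `|b|).
Proof.
move=> e0.
have [e' [e'0 e'1 e'e]] : exists e' : R, [/\ 0 < e', e' <= 1 & 16 * e' <= e].
  exists (Num.min 1 (e / 16)); split; first by rewrite lt_min ltr01 divr_gt0.
    by rewrite ge_min lexx.
  by rewrite -ler_pdivlMl// mulrC ge_min lexx orbT.
have [d1 d10 H1] := is_derive0_bound (is_derive_expR 0) e'0.
have [d2 d20 H2] := is_derive0_bound (is_derive_cos 0) e'0.
have [d3 d30 H3] := is_derive0_bound (is_derive_sin 0) e'0.
exists (Num.min (Num.min d1 e') (Num.min d2 d3)).
  by rewrite !lt_min d10 e'0 d20 d30.
move=> a b; rewrite !lt_min => /andP[/andP[a1 ae] /andP[a2 a3]] /andP[/andP[b1 be] /andP[b2 b3]].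
have := H1 a a1; have := H2 b b2; have := H3 b b3.
rewrite expR0 cos0 sin0 subr0 oppr0 mul0r subr0 !mul1r => h3 h2 h1.
apply: (le_trans (normc_leReIm _)); rewrite !(ReD, ImD, ReN, ImN) /= oppr0 addr0.
have cb : `|cos b| <= 1 by rewrite ler_norml cos_geN1 cos_le1.
have ea : `|expR a - 1| <= 2 * `|a|.
  have := ler_normD (expR a - 1 - a) a; rewrite subrK => h.
  have : e' * `|a| <= `|a| by rewrite ler_piMl.
  lra.
have ea3 : `|expR a| <= 3.
  have := ler_normD (expR a - 1) 1; rewrite subrK normr1 => h; lra.
have B1 : `|expR a * cos b - 1 - a| <= e' * `|a| + 2 * (e' * `|b|).
  have -> : expR a * cos b - 1 - a = (expR a - 1 - a) * cos b + (1 + a) * (cos b - 1) by ring.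
  apply: (le_trans (ler_normD _ _)); rewrite !normrM; apply: lerD.
    by apply: le_trans h1; rewrite ler_piMr.
  apply: ler_pM => //.
  by have := ler_normD 1 a; rewrite normr1; lra.
have B2 : `|expR a * sin b - b| <= 3 * (e' * `|b|) + 2 * e' * `|b|.
  have -> : expR a * sin b - b = expR a * (sin b - b) + (expR a - 1) * b by ring.
  apply: (le_trans (ler_normD _ _)); rewrite !normrM; apply: lerD.
    by apply: ler_pM.
  by rewrite ler_wpM2r//; lra.
have p1 : 0 <= e' * `|a| by rewrite mulr_ge0// ltW.
have p2 : 0 <= e' * `|b| by rewrite mulr_ge0// ltW.
have q : 16 * e' * (`|a| + `|b|) <= e * (`|a| + `|b|) by rewrite ler_wpM2r// addr_ge0.
lra.
Qed.

Lemma cdiff_at_cexp F s0 t0 : derivable (F : R[i]^o -> R[i]^o) (cexp s0 t0) 1 ->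
  cdiff_at (fun s t => F (cexp s t)) s0 t0.
Proof.
move=> /derivable_expansion[A HA]; set w0 := cexp s0 t0; exists (A * w0) => e e0.
pose N := normc w0; have N0 : 0 <= N by exact: normc_ge0.
have N1 : 0 < N + 1 by rewrite ltr_wpDl.
pose a := normc A; have a0 : 0 <= a by exact: normc_ge0.
have e10 : 0 < e / (4 * (N + 1)) by rewrite divr_gt0// mulr_gt0.
have [d d0 Hd] := HA _ e10.
pose e2 := Num.min 1 (e / (2 * (a * N + 1))).
have aN : 0 <= a * N by rewrite mulr_ge0.
have aN1 : 0 < a * N + 1 by rewrite ltr_wpDl.
have e20 : 0 < e2 by rewrite lt_min ltr01 divr_gt0// mulr_gt0.
have [d2 d20 Hd2] := cexp_expansion0 e20.
exists (Num.min d2 (d / (4 * (N + 1)))).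
  by rewrite lt_min d20 divr_gt0// mulr_gt0.
move=> s t; rewrite !lt_min => /andP[sd sd'] /andP[td td'].
have := Hd2 _ _ sd td.
set p := (s - s0) +i* (t - t0); set c := cexp (s - s0) (t - t0).
set n := `|s - s0| + `|t - t0| => Hc.
have n0 : 0 <= n by rewrite addr_ge0.
have wE : cexp s t = w0 * c by rewrite -cexpD; congr cexp; ring.
have cp : normc (c - 1) <= 2 * n.
  have := normcD (c - 1 - p) p; rewrite subrK => h.
  have h2 : normc p <= n by exact: normc_pair.
  have h3 : e2 * n <= n by rewrite ler_piMl// ge_min lexx.
  lra.
have wE2 : cexp s t - w0 = w0 * (c - 1) by rewrite wE; ring.
have nw : normc (cexp s t - w0) <= 2 * N * n.
  by rewrite wE2 normcM -mulrA mulrCA ler_wpM2l.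
have nd : n < d / (2 * (N + 1)).
  rewrite (_ : d / (2 * (N + 1)) = d / (4 * (N + 1)) + d / (4 * (N + 1))); first exact: ltrD.
  by field; rewrite gt_eqF.
have wd : normc (cexp s t - w0) < d.
  apply: (le_lt_trans nw); apply: (@le_lt_trans _ _ (2 * (N + 1) * n)).
    by rewrite ler_wpM2r// ler_pM2l// lerDl.
  rewrite (_ : d = 2 * (N + 1) * (d / (2 * (N + 1)))); last by field; rewrite gt_eqF.
  by rewrite ltr_pM2l// mulr_gt0.
have K1 := Hd _ wd.
have -> : F (cexp s t) - F w0 - A * w0 * p =
   (F (cexp s t) - F w0 - A * (cexp s t - w0)) + A * w0 * (c - 1 - p).
  by rewrite wE2; ring.
apply: (le_trans (normcD _ _)); rewrite !normcM -/a -/N.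
have K2 : e / (4 * (N + 1)) * normc (cexp s t - w0) <= e / 2 * n.
  apply: (@le_trans _ _ (e / (4 * (N + 1)) * (2 * (N + 1) * n))).
    apply: ler_wpM2l; first exact: ltW.
    by apply: (le_trans nw); rewrite ler_wpM2r// ler_pM2l// lerDl.
  by apply: eq_lew; field; rewrite gt_eqF.
have K3 : a * N * normc (c - 1 - p) <= e / 2 * n.
  apply: (@le_trans _ _ (a * N * (e2 * n))); first by rewrite ler_wpM2l.
  rewrite mulrA ler_wpM2r//.
  apply: (@le_trans _ _ ((a * N + 1) * (e / (2 * (a * N + 1))))).
    by apply: ler_pM => //; [exact: ltW|rewrite lerDl|rewrite ge_min lexx orbT].
  by apply: eq_lew; field; rewrite gt_eqF.
lra.
Qed.

Lemma circle_fun_arg F (r : R) (x : circle R) : 0 < r ->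
  F (r%:C * zcoord x) = F (cexp (ln r) (arg x)).
Proof.
move=> r0; rewrite /cexp lnK ?posrE// -{1}(expi_arg x) zcoord_expi.
by congr F; simpc.
Qed.

Lemma normc_radius (r : R) (x : circle R) : 0 <= r -> normc (r%:C * zcoord x) = r.
Proof. by move=> r0; rewrite normcM normc_zcoord mulr1 normc_real ger0_norm. Qed.

Lemma cmeas_dilate F (r : R) : @holomorphic_disk R F -> 0 < r < 1 ->
  cmeas setT (fun x : circle R => F (r%:C * zcoord x)).
Proof.
move=> hF /andP[r0 r1].
have D t : cdiff_at (fun s t => F (cexp s t)) (ln r) t.
  by apply: cdiff_at_cexp; apply: hF; rewrite normrE normc_cexp lnK ?posrE// ltcR.
have C t0 (e : R) : 0 < e -> exists2 d : R, 0 < d & forall t, `|t - t0| < d ->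
    normc (F (cexp (ln r) t) - F (cexp (ln r) t0)) < e.
  move=> e0; have [d d0 H] := cdiff_continuous (D t0) e0.
  by exists d => // t td; apply: H => //; rewrite subrr normr0.
have mG : cmeas setT (fun t : measurableTypeR R => F (cexp (ln r) t)).
  by split; apply: continuous_measurable_fun => t;
    have [] := cont_of_normc (C t).
case: mG => mR mI; split.
- have := measurableT_comp mR (@measurable_arg R).
  by apply: eq_measurable_fun => x _ /=; rewrite circle_fun_arg.
- have := measurableT_comp mI (@measurable_arg R).
  by apply: eq_measurable_fun => x _ /=; rewrite circle_fun_arg.
Qed.

Fact mul_i_subr_eq0 (x y : R[i]) : (0 +i* 1) * (x - y) = 0 -> x = y.
Proof.
move/eqP; rewrite mulf_eq0 subr_eq0 => /orP[/eqP[/eqP]|/eqP//].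
by rewrite oner_eq0.
Qed.

(** Goursat's theorem on the rectangle [ln r1, ln r2] x [0, 2 pi] in logarithmic
   coordinates shows that circle means do not depend on the radius. *)
Lemma mean_value F (r : R) : @holomorphic_disk R F -> 0 < r < 1 ->
  cintegrable m setT (fun x => F (r%:C * zcoord x)) ->
  cint m setT (fun x => F (r%:C * zcoord x)) = F 0.
Proof.
move=> hF r01 iF; have /andP[r0 r1] := r01.
have pi0 := two_pi_gt0 R.
pose G s t := F (cexp s t).
pose J s := cint leb `[0, 2 * pi] (fun t => G s t).
have DG s t : s < 0 -> cdiff_at G s t.
  move=> s0; apply: cdiff_at_cexp; apply: hF.
  by rewrite normrE normc_cexp ltcR -expR0 ltr_expR.
have iG s : s < 0 -> cintegrable leb `[0, 2 * pi] (fun t => G s t).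
  move=> s0; apply: cont_cintegrable => t _ e e0.
  have [d d0 H] := cdiff_continuous (DG s t s0) e0.
  by exists d => // t' td; apply: H => //; rewrite subrr normr0.
have Jcst s1 s2 : s1 <= s2 -> s2 < 0 -> J s2 = J s1.
  move=> s12 s20.
  have l0 : 0 <= s2 - s1 by rewrite subr_ge0.
  have D : cdiff_on G s1 0 (s2 - s1) (2 * pi).
    by move=> s t /andP[_ s2'] _; apply: DG; rewrite subrKC in s2'; exact: le_lt_trans s20.
  have := goursat l0 (ltW pi0) D; rewrite /boundary_int subrKC add0r.
  rewrite (_ : cint leb `[s1, s2] (fun s => G s (2 * pi)) = cint leb `[s1, s2] (fun s => G s 0)); last first.
    by apply: eq_cint => s _; rewrite /G cexp_periodic.
  by rewrite (subrr (cint leb `[s1, s2] (fun s => G s 0))) subr0 => /mul_i_subr_eq0.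
have lnr0 : ln r < 0 by rewrite ln_lt0// r0.
have JF : J (ln r) = F 0 * (2 * pi - 0)%:C.
  apply/eqP; rewrite -subr_eq0; apply/eqP/normc_eq0/eqP; rewrite eq_le normc_ge0 andbT.
  apply/ler_addgt0Pr => e e0; rewrite add0r.
  have e'0 : 0 < e / (2 * pi) by rewrite divr_gt0.
  have dF0 : derivable F 0 1 by apply: hF; rewrite normr0 ltr01.
  have [d d0 Hd] := derivable_normc_cont dF0 e'0.
  pose s := Num.min (ln r) (ln (d / 2)).
  have sr : s <= ln r by rewrite ge_min lexx.
  have sd : expR s < d.
    apply: (@le_lt_trans _ _ (d / 2)); last by lra.
    rewrite -[leRHS]lnK ?posrE ?divr_gt0// ler_expR.
    by rewrite ge_min lexx orbT.
  have s0 : s < 0 by exact: le_lt_trans lnr0.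
  have icst : cintegrable leb `[0, 2 * pi] (fun=> F 0).
    apply: cont_cintegrable => x0 _ e' e'0'; exists 1 => // z _.
    by rewrite subrr normc0.
  rewrite (Jcst _ _ sr lnr0) /J -cint_itv_cst ?(ltW pi0)// -cintB//; last exact: iG.
  have -> : e = e / (2 * pi) * (2 * pi - 0) by rewrite subr0 divfK// gt_eqF.
  apply: normc_cint_itv_le; first exact: ltW.
    by apply: cintegrableB => //; exact: iG.
  move=> t _; rewrite ltW//; apply: Hd.
  by rewrite subr0 normc_cexp.
rewrite arc_cint//.
have -> : cint leb `[0, 2 * pi] (fun t => F (r%:C * zcoord (expi t))) = J (ln r).
  apply: eq_cint => t _; rewrite /G /cexp lnK ?posrE// zcoord_expi.
  by congr F; simpc.
rewrite JF subr0 mulrCA -rmorphM/= mulVf ?mulr1//.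
by rewrite gt_eqF.
Qed.

End mean_value.

(** * Cauchy and Poisson integrals *)

Section cauchy_poisson.
Variable R : realType.
Local Notation m := (arc_measure R).
Local Notation leb := (@lebesgue_measure R).
Local Notation zc := (@zcoord R).
Local Notation mT := (@measurableT _ (circle R)).
Implicit Types (f h : circle R -> R[i]) (w : R[i]).
Local Notation intg := (cintegrable m setT).

Lemma cint_cst (c : R[i]) : cint m setT (fun=> c) = c.
Proof.
have E (k : R) : \int[m]_(x in setT) k = k.
  rewrite Rintegral_cst// -[RHS]mulr1; congr (_ * _).
  exact: (congr1 fine (@probability_setT _ _ _ m)).
by apply: complex_ext; exact: E.
Qed.

Lemma cintegrable_cst (c : R[i]) : intg (fun=> c).
Proof. by split; exact: finite_measure_integrable_cst. Qed.

Lemma normc_zcX (x : circle R) n : normc (zc x ^+ n) = 1.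
Proof. by rewrite normcX normc_zcoord expr1n. Qed.

Lemma cmeas_zcX n : cmeas setT (fun x => zc x ^+ n).
Proof. exact/cmeasX/cmeas_zcoord. Qed.

Lemma cintegrableMzX h n : intg h -> intg (fun x => h x * zc x ^+ n).
Proof.
move=> ih; under eq_fun do rewrite mulrC.
apply: (cintegrableMbd mT (M := 1)) => //; first exact: cmeas_zcX.
by move=> x _; rewrite normc_zcX.
Qed.

Lemma cintegrableMzcX h n : intg h -> intg (fun x => h x * conjc (zc x) ^+ n).
Proof.
move=> ih; under eq_fun do rewrite mulrC -conjcX.
apply: (cintegrableMbd mT (M := 1)) => //; first exact/cmeas_conj/cmeas_zcX.
by move=> x _; rewrite normc_conj normc_zcX.
Qed.

Lemma holomorphicMX (F : R[i]^o -> R[i]^o) n : @holomorphic_disk R F ->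
  @holomorphic_disk R (fun w => F w * w ^+ n).
Proof.
move=> hF w w1; have dF := hF w w1.
elim: n => [|n ih].
  by rewrite (_ : (fun _ => _) = F)//; apply/funext => v; rewrite expr0 mulr1.
rewrite (_ : (fun _ => _) = (fun v : R[i]^o => F v * v ^+ n * v)).
  exact: derivable_mul_id.
by apply/funext => v; rewrite exprSr mulrA.
Qed.

Lemma cint_dilate_zX (F : R[i]^o -> R[i]^o) (r : R) n : @holomorphic_disk R F -> 0 < r < 1 ->
  intg (fun x => F (r%:C * zc x)) ->
  cint m setT (fun x => F (r%:C * zc x) * zc x ^+ n.+1) = 0.
Proof.
move=> hF r01 iF; have /andP[r0 r1] := r01.
have E x : F (r%:C * zc x) * (r%:C * zc x) ^+ n.+1 = (r%:C ^+ n.+1) * (F (r%:C * zc x) * zc x ^+ n.+1).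
  by rewrite exprMn; ring.
have iF' := cintegrableMzX n.+1 iF.
have := mean_value (holomorphicMX (n := n.+1) hF) r01.
rewrite expr0n mulr0 (_ : (fun x => F (r%:C * zc x) * (r%:C * zc x) ^+ n.+1) =
  (fun x => (r%:C ^+ n.+1) * (F (r%:C * zc x) * zc x ^+ n.+1))); last first.
  by apply/funext => x; rewrite E.
move=> /(_ (cintegrableZ mT _ iF')); rewrite cintZ// => /eqP; rewrite mulf_eq0 => /orP[|/eqP//].
by rewrite expf_eq0/= => /eqP/(congr1 (@complex.Re R))/= r00; rewrite r00 ltxx in r0.
Qed.

Lemma cint_zX n : cint m setT (fun x => zc x ^+ n.+1) = 0.
Proof.
have h1 : @holomorphic_disk R (fun=> 1) by move=> w _; exact: derivable_cst.
have h01 : 0 < (2^-1 : R) < 1 by apply/andP; split; lra.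
have := cint_dilate_zX n h1 h01 (cintegrable_cst 1).
by under eq_cint do rewrite mul1r.
Qed.

(** Only nonnegative indices are covered: the coefficient of index [- n] is the integral
   against [zcoord ^ n], equivalently the conjugate of [coef] at the conjugate function. *)
Definition coef h n : R[i] := cint m setT (fun y => h y * conjc (zc y) ^+ n).

Definition cauchy_int h w : R[i] :=
  cint m setT (fun y => (1 - w * conjc (zc y))^-1 * h y).

Lemma one_sub_ge w (y : circle R) : 1 - normc w <= normc (1 - w * conjc (zc y)).
Proof.
have := normcD (1 - w * conjc (zc y)) (w * conjc (zc y)).
by rewrite subrK normc1 normcM normc_conj normc_zcoord mulr1; lra.
Qed.

Lemma one_sub_neq0 w (y : circle R) : normc w < 1 -> 1 - w * conjc (zc y) != 0.
Proof.
move=> w1; apply/eqP => h0; have := one_sub_ge w y.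
by rewrite h0 normc0; lra.
Qed.

Lemma cmeas_cauchy w : cmeas setT (fun y => (1 - w * conjc (zc y))^-1).
Proof.
apply: cmeasV; apply: cmeasB; first exact: cmeas_cst.
by apply: cmeasM; [exact: cmeas_cst|exact/cmeas_conj/cmeas_zcoord].
Qed.

Lemma normc_cauchy_le w (y : circle R) : normc w < 1 ->
  normc (1 - w * conjc (zc y))^-1 <= (1 - normc w)^-1.
Proof.
move=> w1; have := one_sub_ge w y; rewrite normcV => h.
by rewrite lef_pV2 ?posrE//; lra.
Qed.

Lemma cauchy_cintegrable h w : normc w < 1 -> intg h ->
  intg (fun y => (1 - w * conjc (zc y))^-1 * h y).
Proof.
move=> w1 ih; apply: (cintegrableMbd mT (M := (1 - normc w)^-1)) ih; first exact: cmeas_cauchy.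
by move=> y _; exact: normc_cauchy_le.
Qed.

Lemma geom_expansion (u : R[i]) N : 1 - u != 0 ->
  (1 - u)^-1 = \sum_(i < N) u ^+ i + u ^+ N * (1 - u)^-1.
Proof.
move=> u1; elim: N => [|N ih]; first by rewrite big_ord0 expr0 add0r mul1r.
by rewrite {1}ih big_ord_recr/= exprS; field.
Qed.

Lemma cauchy_int_approx h w N : normc w < 1 -> intg h ->
  normc (cauchy_int h w - \sum_(i < N) w ^+ i * coef h i) <=
  normc w ^+ N / (1 - normc w) * \int[m]_x normc (h x).
Proof.
move=> w1 ih.
have E : \sum_(i < N) w ^+ i * coef h i =
    cint m setT (fun y => \sum_(i < N) w ^+ i * (h y * conjc (zc y) ^+ i)).
  rewrite cint_sum//; last by move=> i; apply: cintegrableZ => //; exact: cintegrableMzcX.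
  by apply: eq_bigr => i _; rewrite -cintZ//; exact: cintegrableMzcX.
have iS : intg (fun y => \sum_(i < N) w ^+ i * (h y * conjc (zc y) ^+ i)).
  by apply: cintegrable_sum => // i; apply: cintegrableZ => //; exact: cintegrableMzcX.
rewrite E /cauchy_int -cintB//; last exact: cauchy_cintegrable.
apply: (le_trans (normc_cint_le mT _)).
  by apply: cintegrableB => //; exact: cauchy_cintegrable.
have ih' := cintegrable_normc mT ih.
rewrite -RintegralZl//; apply: le_Rintegral => //.
- by apply: cintegrable_normc => //; apply: cintegrableB => //; exact: cauchy_cintegrable.
- exact: rintegrableZ.
move=> y _; set u := w * conjc (zc y).
have -> : (1 - u)^-1 * h y - \sum_(i < N) w ^+ i * (h y * conjc (zc y) ^+ i) =
    (u ^+ N * (1 - u)^-1) * h y.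
  rewrite {1}(geom_expansion N (one_sub_neq0 y w1)) mulrDl mulr_suml.
  rewrite (_ : \sum_(i < N) u ^+ i * h y = \sum_(i < N) w ^+ i * (h y * conjc (zc y) ^+ i)).
    by rewrite addrAC subrr add0r.
  by apply: eq_bigr => i _; rewrite /u exprMn; ring.
rewrite normcM ler_wpM2r ?normc_ge0// normcM normcX.
have -> : normc u = normc w by rewrite /u normcM normc_conj normc_zcoord mulr1.
by rewrite ler_wpM2l ?exprn_ge0 ?normc_ge0// normc_cauchy_le.
Qed.

Lemma cvg_geom (r C : R) : 0 <= r < 1 -> (r ^+ N * C) @[N --> \oo] --> (0 : R).
Proof.
move=> /andP[r0 r1]; rewrite -[0 in X in _ --> X](mul0r C); apply: cvgMl.
by apply: cvg_expr; rewrite ger0_norm.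
Qed.

Lemma cauchy_int_coef0 h w : normc w < 1 -> intg h ->
  (forall n, coef h n.+1 = 0) -> cauchy_int h w = coef h 0.
Proof.
move=> w1 ih h0; apply/eqP; rewrite -subr_eq0; apply/eqP/normc_eq0/eqP.
rewrite eq_le normc_ge0 andbT; apply/ler_addgt0Pr => e e0; rewrite add0r.
have w01 : 0 <= normc w < 1 by rewrite normc_ge0.
pose C := (1 - normc w)^-1 * \int[m]_x normc (h x).
have /cvgrPdist_lt/(_ _ e0)[N _ HN] := cvg_geom C w01.
have := HN N.+1 (leqnSn N); rewrite /= sub0r normrN => HN'.
have := cauchy_int_approx N.+1 w1 ih.
rewrite big_ord_recl expr0 mul1r big1 ?addr0; last by move=> i _; rewrite h0 mulr0.
move=> H; apply: (le_trans H); rewrite -mulrA -/C.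
by apply/ltW/(le_lt_trans _ HN'); exact: ler_norm.
Qed.

Lemma cauchy_int1 w : normc w < 1 -> cauchy_int (fun=> 1) w = 1.
Proof.
move=> w1; rewrite cauchy_int_coef0//; first last.
- move=> n; rewrite /coef; under eq_cint do rewrite mul1r -conjcX.
  rewrite cint_conj//; last by have := cintegrableMzX n.+1 (cintegrable_cst 1); under eq_fun do rewrite mul1r.
  by rewrite cint_zX conjc0.
- exact: cintegrable_cst.
by rewrite /coef; under eq_cint do rewrite expr0 mulr1; rewrite cint_cst.
Qed.

Definition poisson_kernel w (y : circle R) : R :=
  (1 - normc w ^+ 2) / normc (1 - w * conjc (zc y)) ^+ 2.

(** The Poisson kernel is twice the real part of the Cauchy kernel, minus one: this is
   what relates Poisson and Cauchy integrals. *)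
Lemma poisson_kernelE w y : normc w < 1 ->
  (poisson_kernel w y)%:C = (1 - w * conjc (zc y))^-1 + conjc (1 - w * conjc (zc y))^-1 - 1.
Proof.
move=> w1; set u := w * conjc (zc y).
have nu : normc w = normc u by rewrite /u normcM normc_conj normc_zcoord mulr1.
have u0 : 1 - u != 0 by exact: one_sub_neq0.
have cu0 : conjc (1 - u) != 0 by rewrite conjc_eq0.
rewrite /poisson_kernel -/u nu rmorphM/= fmorphV/= -(mul_conjc (1 - u)) rmorphB/= -mul_conjc.
rewrite conjc_inv; move: cu0; rewrite conjcB conjc1 => cu0.
by field; rewrite u0 cu0.
Qed.

Lemma poisson_kernel_ge0 w y : normc w < 1 -> 0 <= poisson_kernel w y.
Proof.
move=> w1; rewrite divr_ge0 ?sqr_ge0// subr_ge0 exprn_ile1 ?normc_ge0//.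
exact: ltW.
Qed.

Lemma measurable_poisson_kernel w : measurable_fun setT (poisson_kernel w).
Proof.
apply: measurable_funM; first exact: measurable_cst.
apply: measurable_inv => [y|]; first exact: sqr_ge0.
apply: cmeas_sqnormc; apply: cmeasB; first exact: cmeas_cst.
by apply: cmeasM; [exact: cmeas_cst|exact/cmeas_conj/cmeas_zcoord].
Qed.

Definition poisson_int h w : R[i] :=
  cint m setT (fun y => (poisson_kernel w y)%:C * h y).

Lemma poisson_intE h w : normc w < 1 -> intg h ->
  poisson_int h w = cauchy_int h w + conjc (cauchy_int (fun y => conjc (h y)) w) - coef h 0.
Proof.
move=> w1 ih; have ich := cintegrable_conj mT ih.
have i1 := cauchy_cintegrable w1 ih.
have i2 := cintegrable_conj mT (cauchy_cintegrable w1 ich).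
have i3 : intg (fun y => h y * conjc (zc y) ^+ 0) by under eq_fun do rewrite expr0 mulr1.
rewrite /coef /cauchy_int -cint_conj//; last exact: cauchy_cintegrable.
rewrite -cintD// -cintB//; last exact: cintegrableD.
apply: eq_cint => y _; rewrite poisson_kernelE// expr0 mulr1.
by rewrite conjcM conjcK; ring.
Qed.

Lemma poisson_cintegrable h w : normc w < 1 -> intg h ->
  intg (fun y => (poisson_kernel w y)%:C * h y).
Proof.
move=> w1 ih; apply: (cintegrableMbd mT (M := (1 - normc w ^+ 2) / (1 - normc w) ^+ 2)) => //.
  exact: (cmeas_real (measurable_poisson_kernel w)).
move=> y _; rewrite normc_real ger0_norm ?poisson_kernel_ge0//.
have := normc_ge0 w => w0.
apply: ler_wpM2l; first by rewrite subr_ge0 exprn_ile1// ltW.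
rewrite lef_pV2 ?posrE ?exprn_gt0 ?subr_gt0//.
  by rewrite lerXn2r ?nnegrE ?normc_ge0 ?one_sub_ge// subr_ge0 ltW.
by have := one_sub_ge w y; lra.
Qed.

Lemma poisson_int1 w : normc w < 1 -> poisson_int (fun=> 1) w = 1.
Proof.
move=> w1; rewrite poisson_intE//; last exact: cintegrable_cst.
rewrite (_ : (fun _ => conjc 1) = fun=> 1); last by apply/funext => y; rewrite conjc1.
rewrite cauchy_int1// /coef; under eq_cint do rewrite expr0 mulr1.
by rewrite cint_cst conjc1; ring.
Qed.

Lemma poisson_kernel_Rintegral w : normc w < 1 -> \int[m]_y poisson_kernel w y = 1.
Proof.
move=> w1; apply: complexI; rewrite -cint_real.
transitivity (poisson_int (fun=> 1) w); last by rewrite poisson_int1.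
by apply: eq_cint => y _; rewrite mulr1.
Qed.

Lemma poisson_kernel_rintegrable w : normc w < 1 ->
  m.-integrable setT (EFin \o poisson_kernel w).
Proof.
move=> w1; have [+ _] := poisson_cintegrable w1 (cintegrable_cst 1).
by under eq_fun do rewrite mulr1.
Qed.

Lemma normc_poisson_le h w (M : R) : normc w < 1 -> cmeas setT h ->
  {ae m, forall x, normc (h x) <= M} -> normc (poisson_int h w) <= M.
Proof.
move=> w1 mh hM; have ih := arc_cintegrable_bounded mh hM.
apply: (le_trans (normc_cint_le mT (poisson_cintegrable w1 ih))).
rewrite -[leRHS]mulr1 -(poisson_kernel_Rintegral w1) -RintegralZl//; last exact: poisson_kernel_rintegrable.
apply: ae_le_Rintegral => //.
- exact/cintegrable_normc/poisson_cintegrable.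
- exact/rintegrableZ/poisson_kernel_rintegrable.
apply: filterS hM => y hy _; rewrite normcM normc_real ger0_norm ?poisson_kernel_ge0// mulrC.
by rewrite ler_wpM2r ?poisson_kernel_ge0.
Qed.

(** The Poisson kernel has mass one, which puts [c] under the integral sign. *)
Lemma normc_poisson_sub_le h w (c : R[i]) : normc w < 1 -> intg h ->
  normc (poisson_int h w - c) <= \int[m]_y (poisson_kernel w y * normc (h y - c)).
Proof.
move=> w1 ih.
have ihc : intg (fun y => h y - c) by apply: cintegrableB => //; exact: cintegrable_cst.
have -> : poisson_int h w - c = poisson_int (fun y => h y - c) w.
  rewrite -[c in LHS]mulr1 -(poisson_int1 w1) /poisson_int -cintZ//; last first.
    by apply: poisson_cintegrable => //; exact: cintegrable_cst.
  rewrite -cintB//; [|exact: poisson_cintegrable|].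
    by apply: eq_cint => y _; ring.
  by apply: cintegrableZ => //; apply: poisson_cintegrable => //; exact: cintegrable_cst.
apply: (le_trans (normc_cint_le mT (poisson_cintegrable w1 ihc))).
apply: eq_lew; apply: eq_Rintegral => y _.
by rewrite normcM normc_real ger0_norm// poisson_kernel_ge0.
Qed.

End cauchy_poisson.

(** * Fatou's theorem: Poisson integrals converge at Lebesgue points *)

Section fatou.
Variable R : realType.
Local Notation m := (arc_measure R).
Local Notation leb := (@lebesgue_measure R).
Local Notation zc := (@zcoord R).
Implicit Types (D p : R -> R).

Lemma dyadic_scale (eta dl : R) : 0 < eta -> eta <= dl ->
  exists K : nat, 2 ^+ K * eta <= dl < 2 ^+ K.+1 * eta.
Proof.
move=> eta0 etad.
have ex : exists K : nat, dl < 2 ^+ K.+1 * eta.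
  exists (Num.bound (dl / eta)); rewrite -ltr_pdivrMr//.
  have h1 : dl / eta < (Num.bound (dl / eta))%:R.
    by apply: archi_boundP; rewrite divr_ge0// ltW// (lt_le_trans eta0).
  apply: (lt_le_trans h1); rewrite -natrX ler_nat.
  exact/ltnW/(leq_trans (ltnSn _))/ltnW/ltn_expl.
case: (ex_minnP ex) => -[|K] H1 H2.
  by exists 0%N; rewrite expr0 mul1r etad.
exists K.+1; rewrite H1 andbT leNgt; apply/negP => h.
by have := H2 K h; rewrite ltnn.
Qed.

(** An approximate identity with peak [2 / eta] and decay [16 eta / s ^ 2], summed over
   dyadic rings around [t]: the ball of radius [eta] contributes [2 * e], and the ring
   between radii [2 ^ K * eta] and [2 ^ K.+1 * eta] at most [64 * 2 ^ - K.+1 * e]. *)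
Lemma dyadic_bound D p (t eta dl e : R) :
  measurable_fun setT D -> measurable_fun setT p ->
  (forall s, 0 <= D s) -> (forall s, 0 <= p s) -> 0 < eta -> 0 <= e ->
  (forall rho, 0 < rho -> rho <= dl ->
     (\int[leb]_(s in ball t rho) (D s)%:E <= (e * rho)%:E)%E) ->
  (forall s, ball t dl s -> p s <= 2 / eta) ->
  (forall s, ball t dl s -> p s * (s - t) ^+ 2 <= 16 * eta) ->
  forall K : nat, 2 ^+ K * eta <= dl ->
  (\int[leb]_(s in ball t (2 ^+ K * eta)) (p s * D s)%:E <= ((66 - 64 * 2^-1 ^+ K) * e)%:E)%E.
Proof.
move=> mD mp D0 p0 eta0 e0 HD Hp1 Hp2.
have mDp : measurable_fun setT (fun s => (p s * D s)%:E).
  by apply/measurable_EFinP; exact: measurable_funM.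
have mDe : measurable_fun setT (fun s => (D s)%:E) by exact/measurable_EFinP.
have mb r : measurable (ball t r : set (measurableTypeR R)) by exact: measurable_ball.
have bound (A : set R) (c rho : R) : measurable A -> 0 <= c -> 0 < rho -> rho <= dl ->
    A `<=` ball t rho -> (forall s, A s -> p s <= c) ->
    (\int[leb]_(s in A) (p s * D s)%:E <= (c * (e * rho))%:E)%E.
  move=> mA c0 r0 rd AB pc.
  apply: (@le_trans _ _ (\int[leb]_(s in A) (c%:E * (D s)%:E))%E).
    apply: ge0_le_integral => //.
    - by move=> s _; rewrite lee_fin mulr_ge0.
    - exact: measurable_funTS.
    - by apply: measurable_funTS; exact: measurable_funeM.
    - by move=> s As; rewrite -EFinM lee_fin ler_wpM2r// pc.
  rewrite ge0_integralZl_EFin//; last exact: measurable_funTS.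
    rewrite EFinM lee_wpmul2l ?lee_fin//; apply: le_trans (HD _ r0 rd).
    apply: ge0_subset_integral => //; first exact: measurable_funTS.
    by move=> s _; rewrite lee_fin.
  by move=> s _; rewrite lee_fin.
elim=> [|K IH] Kd.
  rewrite expr0 mul1r in Kd *; rewrite expr0.
  apply: (le_trans (@bound (ball t eta) (2 / eta) eta _ _ _ _ _ _)) => //.
  - exact: measurable_ball.
  - by rewrite divr_ge0// ltW.
  - by move=> s bs; apply: Hp1; exact: le_ball bs.
  - by rewrite lee_fin; apply: eq_lew; field; lra.
have q0 : 0 < 2 ^+ K :> R by rewrite exprn_gt0.
have Kd' : 2 ^+ K * eta <= dl.
  by apply: le_trans Kd; rewrite ler_pM2r// exprS; lra.
have -> : ball t (2 ^+ K.+1 * eta) =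
    ball t (2 ^+ K * eta) `|` (ball t (2 ^+ K.+1 * eta) `\` ball t (2 ^+ K * eta)) :> set R.
  rewrite setDUK//; apply: le_ball; rewrite ler_pM2r// exprS; lra.
rewrite ge0_integral_setU//; last 4 first.
- exact: measurableD.
- exact: measurable_funTS.
- by move=> s _; rewrite lee_fin mulr_ge0.
- by apply/disj_setPS => s [bs [_ nbs]].
have ring : (\int[leb]_(s in ball t (2 ^+ K.+1 * eta) `\` ball t (2 ^+ K * eta)) (p s * D s)%:E
    <= (32 * 2^-1 ^+ K * e)%:E)%E.
  apply: (le_trans (@bound _ (16 / (4 ^+ K * eta)) (2 ^+ K.+1 * eta) _ _ _ _ _ _)) => //.
  - by apply: measurableD; exact: measurable_ball.
  - by rewrite divr_ge0// mulr_ge0 ?exprn_ge0// ltW.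
  - by rewrite mulr_gt0// exprn_gt0.
  - move=> s [bs nbs]; have bd : ball t dl s by exact: le_ball bs.
    have h1 : 2 ^+ K * eta <= `|s - t|.
      by rewrite leNgt distrC; apply/negP.
    have h2 := Hp2 s bd.
    have h3 : (2 ^+ K * eta) ^+ 2 <= (s - t) ^+ 2.
      rewrite -(real_normK (num_real (s - t))) lerXn2r ?nnegrE//.
      by rewrite mulr_ge0// ltW.
    have h4 : (2 ^+ K * eta) ^+ 2 = 4 ^+ K * eta * eta.
      by rewrite exprMn -exprM mulnC exprM (_ : 2 ^+ 2 = 4) ?expr2 ?mulrA//; ring.
    have k0 : 0 < 4 ^+ K * eta :> R by rewrite mulr_gt0// exprn_gt0.
    rewrite ler_pdivlMr//; rewrite -(ler_pM2r eta0) -mulrA -h4.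
    apply: le_trans h2; exact: ler_wpM2l.
  - rewrite lee_fin; apply: eq_lew.
    have -> : (4 : R) ^+ K = 2 ^+ K * 2 ^+ K by rewrite -exprMn; congr (_ ^+ _); ring.
    by rewrite exprS exprVn; field; lra.
apply: (le_trans (leeD (IH Kd') ring)).
by rewrite -EFinD lee_fin; apply: eq_lew; rewrite exprS; field.
Qed.

Lemma one_sub_cos_ge : exists2 d : R, 0 < d & forall a : R, `|a| < d -> a ^+ 2 / 8 <= 1 - cos a.
Proof.
have [d d0 H] := @is_derive0_bound R sin (cos 0) 2^-1 (is_derive_sin 0) ltac:(lra).
exists d => // a ad.
have a2 : `|a / 2| < d by rewrite normrM (ger0_norm (x := 2^-1))//; have := normr_ge0 a; lra.
have := H _ a2; rewrite sin0 cos0 subr0 mul1r => h.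
have h2 : `|a / 2| / 2 <= `|sin (a / 2)|.
  by have := ler_distD (sin (a / 2)) (a / 2) 0; rewrite !subr0 (distrC _ (sin _)); lra.
have -> : 1 - cos a = 2 * sin (a / 2) ^+ 2.
  have {1}-> : a = (a / 2) *+ 2 by rewrite mulr2n; field.
  by rewrite cos_mulr2n -mulr_natl; have := cos2Dsin2 (a / 2); lra.
have h3 : (`|a / 2| / 2) ^+ 2 <= `|sin (a / 2)| ^+ 2.
  by rewrite lerXn2r ?nnegrE ?divr_ge0.
move: h3; rewrite exprMn !real_normK ?num_real// => h3; lra.
Qed.

Lemma one_sub_cos_far (a b : R) : 0 <= a <= pi -> a <= `|b| <= 2 * pi - a ->
  1 - cos a <= 1 - cos b.
Proof.
move=> /andP[a0 ap] /andP[ab ba].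
have H (c : R) : a <= c <= pi -> cos c <= cos a.
  move=> /andP[b1 b2]; rewrite leNgt ltr_cos ?in_itv/= ?a0 ?b2 ?andbT// -?leNgt//.
  exact: le_trans b1.
have -> : cos b = cos `|b|.
  by case: (leP 0 b) => q; [rewrite ger0_norm|rewrite ltr0_norm ?cosN].
rewrite lerD2l lerN2.
have [q|q] := leP `|b| pi; first by apply: H; rewrite q ab.
rewrite (_ : cos `|b| = cos (2 * pi - `|b|)); first by apply: H; apply/andP; split; lra.
by rewrite (mulr_natl pi 2) addrC cosD2pi cosN.
Qed.

Lemma poisson_den (r s t : R) :
  normc (1 - (r%:C * zc (expi t)) * conjc (zc (expi s))) ^+ 2 =
  (1 - r) ^+ 2 + 2 * r * (1 - cos (s - t)).
Proof.
rewrite !zcoord_expi sqr_normcE !(ReD, ImD, ReN, ImN, ReM, ImM) /= cosB.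
have := cos2Dsin2 s; have := cos2Dsin2 t.
move: (cos s) (sin s) (cos t) (sin t) => a b c d h1 h2.
rewrite (_ : _ + _ = 1 - 2 * r * (a * c + b * d) + r ^+ 2 * ((c ^+ 2 + d ^+ 2) * (a ^+ 2 + b ^+ 2))).
  by ring.
by rewrite h1 h2; ring.
Qed.

Lemma Rintegral_le_ereal d (T : measurableType d) (mu : {measure set T -> \bar R})
    (A : set T) (u : T -> R) (B : R) : (forall x, A x -> 0 <= u x) ->
  (\int[mu]_(x in A) (u x)%:E <= B%:E)%E -> \int[mu]_(x in A) u x <= B.
Proof.
move=> u0 uB; rewrite -lee_fin fineK// ge0_fin_numE; first exact: le_lt_trans (ltry B).
by apply: integral_ge0 => x Ax; rewrite lee_fin u0.
Qed.

Lemma lebesgue_pt_bound (u : R -> R) (t e : R) : measurable_fun setT u -> lebesgue_pt u t -> 0 < e ->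
  exists2 d : R, 0 < d & forall rho, 0 < rho -> rho < d ->
    (\int[leb]_(s in ball t rho) `|u s - u t|%:E <= (e * rho)%:E)%E.
Proof.
move=> mu lu e0; have e20 : (0 < (e / 2)%:E)%E by rewrite lte_fin divr_gt0.
have [d /= d0 Hd] := lu _ (open_ereal_lt' e20).
exists d => // rho r0 rd.
have hin : ball_ [eta Num.norm] 0 d rho by rewrite /ball_/= sub0r normrN gtr0_norm.
have := Hd rho hin r0; rewrite /= /davg /iavg.
have -> : leb (ball t rho) = (rho *+ 2)%:E by rewrite lebesgue_measure_ball// ltW.
rewrite inver mulrn_eq0/= gt_eqF//.
set I := (X in (_ * X < _)%E); rewrite -/I => H.
have r20 : 0 < rho *+ 2 by rewrite mulrn_wgt0.
have -> : I = ((rho *+ 2)%:E * ((rho *+ 2)^-1%:E * I))%E.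
  by rewrite muleA -EFinM mulfV ?mul1e// gt_eqF.
apply: (@le_trans _ _ ((rho *+ 2)%:E * (e / 2)%:E)%E).
  by rewrite lee_wpmul2l ?lee_fin ?(ltW r20)// ltW.
by rewrite -EFinM lee_fin; apply: eq_lew; rewrite -mulr_natl; field.
Qed.

(** Cut off outside one period, to be integrable on the whole line as Lebesgue's
   differentiation theorem requires. *)
Definition pullback (u : circle R -> R) : R -> R :=
  (fun s => u (expi s)) \_ `[0, 2 * pi].

Lemma pullback_lebesgue (u : circle R -> R) : m.-integrable setT (EFin \o u) ->
  measurable_fun setT (pullback u) /\ {ae leb, forall t, lebesgue_pt (pullback u) t}.
Proof.
move=> ui; have iu := arc_rintegrable ui.
have ip : leb.-integrable setT (EFin \o pullback u).
  have -> : EFin \o pullback u = (EFin \o (u \o @expi R)) \_ `[0, 2 * pi].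
    by rewrite /pullback restrict_EFin.
  have mI : measurable (`[0, 2 * pi]%classic : set (measurableTypeR R)) by [].
  by have [H _] := @integrable_mkcond _ _ _ leb _ (EFin \o (u \o @expi R)) mI; exact: H.
split; first exact: rintegrable_meas ip.
apply: lebesgue_differentiation; apply: open_integrable_locally => //.
exact: openT.
Qed.

(** At a common Lebesgue point of the real and imaginary parts, the dyadic estimate bounds
   the contribution near the point, and the kernel is uniformly small away from it. *)
Theorem poisson_fatou (h : circle R -> R[i]) : cintegrable m setT h ->
  {ae m, forall x, forall e : R, 0 < e -> exists2 d : R, 0 < d & forall r : R,
    1 - d < r < 1 -> normc (poisson_int h (r%:C * zc x) - h x) < e}.
Proof.
move=> ih; have [iR iI] := ih.
have [mu lu] := pullback_lebesgue iR; have [mv lv] := pullback_lebesgue iI.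
apply: ae_circle; apply: (@filterS2 _ (almost_everywhere leb) _ _ _ _ _ lu lv) => t {}lu {}lv /andP[t0 t2] e e0.
set c := h (expi t); set u := pullback _ in mu lu; set v := pullback _ in mv lv.
have mT : measurable [set: R] by [].
have mI : measurable (`[0, 2 * pi]%classic : set (measurableTypeR R)) by [].
pose D s : R := normc ((u s +i* v s) - c).
have mD : measurable_fun setT D.
  apply: (@cmeas_normc _ (measurableTypeR R) R setT (fun s => (u s +i* v s) - c)).
  by apply: cmeasB; [split|exact: cmeas_cst].
have D0 s : 0 <= D s by exact: normc_ge0.
have DI s : s \in `[0, 2 * pi] -> D s = normc (h (expi s) - c).
  move=> sI; rewrite /D /u /v /pullback !patchE mem_set//.
  by congr (normc (_ - _)); case: (h (expi s)).
have tI : t \in `[0, 2 * pi] by rewrite in_itv/= !ltW.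
have uvt : u t +i* v t = c.
  by rewrite /u /v /pullback !patchE mem_set// /c; case: (h (expi t)).
(* The dyadic bound [66 * (e / 100)] is to leave room for the remote part, below [e / 4];
   each of the real and imaginary parts gets half of [e / 100]. *)
have e10 : 0 < e / 200 by rewrite divr_gt0 ?ltr0n.
have [du du0 Hu] := lebesgue_pt_bound mu lu e10.
have [dv dv0 Hv] := lebesgue_pt_bound mv lv e10.
have [dc dc0 Hc] := one_sub_cos_ge.
have [dl [dl0 dlu dlv dlc [dlt dl2]]] : exists dl : R,
    [/\ 0 < dl, dl < du, dl < dv, dl < dc & dl < t /\ dl < 2 * pi - t].
  have : 0 < Num.min (Num.min du dv) (Num.min dc (Num.min t (2 * pi - t))).
    by rewrite !lt_min du0 dv0 dc0 t0 subr_gt0.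
  set mn := Num.min _ _ => mn0; exists (mn / 2).
  have : mn / 2 < mn by clear - mn0; lra.
  rewrite {2}/mn !lt_min => /andP[/andP[m1 m2] /and3P[m3 m4 m5]].
  by split => //; rewrite divr_gt0.
have HD rho : 0 < rho -> rho <= dl ->
    (\int[leb]_(s in ball t rho) (D s)%:E <= (e / 100 * rho)%:E)%E.
  move=> r0 rd.
  have -> : e / 100 * rho = e / 200 * rho + e / 200 * rho by field.
  rewrite EFinD; apply: (@le_trans _ _ (\int[leb]_(s in ball t rho) `|u s - u t|%:E +
    \int[leb]_(s in ball t rho) `|v s - v t|%:E)%E); last first.
    by apply: leeD; [apply: Hu|apply: Hv] => //; exact: le_lt_trans rd _.
  have mb : measurable (ball t rho : set (measurableTypeR R)) by exact: measurable_ball.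
  have mu' (w : R -> R) : measurable_fun setT w -> measurable_fun (ball t rho) (fun s => `|w s - w t|%:E).
    move=> mw; apply: measurable_funTS; apply/measurable_EFinP.
    by apply: measurableT_comp => //; apply: measurable_funB.
  rewrite -ge0_integralD//; [|exact: mu'|exact: mu'].
  apply: ge0_le_integral => //.
  - by move=> s _; rewrite lee_fin.
  - by apply: measurable_funTS; exact/measurable_EFinP.
  - by apply: emeasurable_funD; exact: mu'.
  - move=> s _; rewrite -EFinD lee_fin /D -uvt (le_trans (normc_leReIm _))//.
pose kap := 1 - cos (dl / 2).
have kap0 : 0 < kap.
  have i1 : dl / 2 \in `[0, pi] by rewrite in_itv/=; clear - dl0 dlt dl2; apply/andP; split; lra.
  have i0 : 0 \in `[0, (pi : R)] by rewrite in_itv/= lexx pi_ge0.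
  by rewrite subr_gt0 -[X in _ < X]cos0 ltr_cos//; clear - dl0; lra.
have [A [A0 HA]] : exists A : R, 0 <= A /\ (\int[leb]_(s in `[0%R, (2 * pi : R)%R]) (D s)%:E <= A%:E)%E.
  have ihc : cintegrable m setT (fun y => h y - c).
    by apply: cintegrableB => //; exact: cintegrable_cst.
  have iD : leb.-integrable `[0, 2 * pi] (EFin \o D).
    apply: eq_integrable (cintegrable_normc _ (arc_cintegrable ihc)) => //.
    by move=> s /[!inE] sI; rewrite /= DI.
  exists (\int[leb]_(s in `[0, 2 * pi]) D s); split.
    by apply: Rintegral_ge0 => s _.
  by rewrite /Rintegral fineK//; exact: integrable_fin_num.
exists (Num.min (Num.min 2^-1 dl) (kap * e / (8 * (A + 1)))).
  by rewrite !lt_min dl0 invr_gt0 ltr0n divr_gt0// mulr_gt0//; clear - A0; lra.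
move=> r /andP[rl r1]; pose eta := 1 - r.
have eta0 : 0 < eta by rewrite subr_gt0.
have : eta < Num.min (Num.min 2^-1 dl) (kap * e / (8 * (A + 1))) by rewrite /eta; clear - rl; lra.
rewrite !lt_min => /andP[/andP[eta1 etad] etaA].
have r0 : 0 <= r by rewrite /eta in eta1; clear - eta1; lra.
set w := r%:C * zc (expi t).
have nw : normc w = r by exact: normc_radius.
have w1 : normc w < 1 by rewrite nw.
pose p s := poisson_kernel w (expi s).
have p0 s : 0 <= p s by exact: poisson_kernel_ge0.
have mp : measurable_fun setT p.
  exact: (measurableT_comp (measurable_poisson_kernel w) (@measurable_expi R)).
have pE s : p s = (1 - r ^+ 2) / ((1 - r) ^+ 2 + 2 * r * (1 - cos (s - t))).
  by rewrite /p /poisson_kernel nw poisson_den.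
have num : 0 <= 1 - r ^+ 2 <= 2 * eta.
  by rewrite /eta; clear - r0 r1; apply/andP; split; nra.
have cos1 (a : R) : 0 <= 1 - cos a by rewrite subr_ge0 cos_le1.
have den s : (1 - r) ^+ 2 <= (1 - r) ^+ 2 + 2 * r * (1 - cos (s - t)).
  by rewrite lerDl !mulr_ge0.
have den2 s : 1 - cos (s - t) <= (1 - r) ^+ 2 + 2 * r * (1 - cos (s - t)).
  by have := cos1 (s - t); have := sqr_ge0 (1 - r); rewrite /eta in eta1; move: (cos _) ((1 - r) ^+ 2) eta1; clear => *; nra.
have Hp1 s : ball t dl s -> p s <= 2 / eta.
  move=> _; rewrite pE ler_pdivrMr; last by apply: lt_le_trans (den s); rewrite exprn_gt0.
  case/andP: num => _ num; apply: (le_trans num).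
  apply: (@le_trans _ _ (2 / eta * (1 - r) ^+ 2)).
    by apply: eq_lew; rewrite -/eta; field; rewrite gt_eqF.
  by rewrite ler_wpM2l// divr_ge0// ltW.
have den0 s : 0 < (1 - r) ^+ 2 + 2 * r * (1 - cos (s - t)).
  by apply: lt_le_trans (den s); rewrite exprn_gt0.
have Hp2 s : ball t dl s -> p s * (s - t) ^+ 2 <= 16 * eta.
  rewrite /ball/= distrC => bs; have := Hc (s - t) (lt_trans bs dlc) => h1.
  rewrite pE mulrAC ler_pdivrMr//.
  have h2 : (s - t) ^+ 2 <= 8 * ((1 - r) ^+ 2 + 2 * r * (1 - cos (s - t))).
    by have := den2 s; move: h1; clear => *; lra.
  case/andP: num => num1 num2; apply: (le_trans (ler_wpM2l num1 h2)).
  have := ltW (den0 s); move: (_ + _ * (1 - cos (s - t))) => y y0.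
  have : (1 - r ^+ 2) * y <= 2 * eta * y by rewrite ler_wpM2r.
  clear => ?; lra.
have [K /andP[K1 K2]] := dyadic_scale eta0 (ltW etad).
have near := dyadic_bound mD mp D0 p0 eta0 (ltW (divr_gt0 e0 (ltr0Sn _ 99))) HD Hp1 Hp2 K1.
set B := ball t (2 ^+ K * eta) in near.
have BI : B `<=` `[0, 2 * pi].
  move=> s; rewrite /B /ball/= in_itv/= => bs.
  have := ler_norm (t - s); have := ler_norm (s - t); rewrite (distrC s t) => b1 b2.
  by clear - bs K1 dlt dl2 b1 b2; apply/andP; split; lra.
have mB : measurable (B : set (measurableTypeR R)) by exact: measurable_ball.
have mpD : measurable_fun setT (fun s => (p s * D s)%:E).
  by apply/measurable_EFinP; exact: measurable_funM.
have far : (\int[leb]_(s in `[0%R, (2 * pi : R)%R] `\` B) (p s * D s)%:E <= (2 * eta / kap * A)%:E)%E.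
  apply: (@le_trans _ _ (\int[leb]_(s in `[0%R, (2 * pi : R)%R] `\` B) ((2 * eta / kap)%:E * (D s)%:E))%E).
    apply: ge0_le_integral => //.
    - exact: measurableD.
    - by move=> s _; rewrite lee_fin mulr_ge0.
    - exact: measurable_funTS.
    - by apply: measurable_funTS; apply: measurable_funeM; exact/measurable_EFinP.
    - move=> s [sI nB]; rewrite -EFinM lee_fin ler_wpM2r//.
      have sd : dl / 2 < `|s - t|.
        move/negP : nB; rewrite /B /ball/= -leNgt distrC => nB.
        by move: K2 nB; rewrite exprS; clear => *; lra.
      have kc : kap <= 1 - cos (s - t).
        move: sI; rewrite /= in_itv/= => /andP[s0 s2].
        apply: one_sub_cos_far; apply/andP; split; rewrite ?(ltW sd)//.
        - by rewrite divr_ge0// ltW.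
        - clear - dlt dl2 dl0 t0; lra.
        - by rewrite ler_norml; clear - s0 s2 dlt dl2 dl0; apply/andP; split; lra.
      rewrite pE ler_pdivrMr//; case/andP: num => num1 num2; apply: (le_trans num2).
      apply: (@le_trans _ _ (2 * eta / kap * kap)); first by apply: eq_lew; field; rewrite gt_eqF.
      apply: ler_wpM2l; first by rewrite divr_ge0 ?mulr_ge0// ltW.
      exact: le_trans (den2 s).
  rewrite ge0_integralZl_EFin//.
  - rewrite (EFinM (2 * eta / kap) A) lee_wpmul2l ?lee_fin//; first by rewrite divr_ge0 ?mulr_ge0// ltW.
    apply: le_trans HA; apply: ge0_subset_integral => //.
    + exact: measurableD.
    + by apply: measurable_funTS; exact/measurable_EFinP.
    + by move=> s _; rewrite lee_fin.
  - exact: measurableD.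
  - by move=> s _; rewrite lee_fin.
  - by apply: measurable_funTS; exact/measurable_EFinP.
  - by rewrite divr_ge0 ?mulr_ge0// ltW.
have total : (\int[leb]_(s in `[0%R, (2 * pi : R)%R]) (p s * D s)%:E <= (66 * (e / 100) + 2 * eta / kap * A)%:E)%E.
  rewrite -(setDUK BI) ge0_integral_setU//; last 4 first.
  - exact: measurableD.
  - exact: measurable_funTS.
  - by move=> s _; rewrite lee_fin mulr_ge0.
  - by apply/disj_setPS => s [bs [_ nbs]].
  rewrite EFinD; apply: leeD far; apply: (le_trans near).
  rewrite lee_fin ler_wpM2r//; first by rewrite divr_ge0// ltW.
  have : 0 <= 2^-1 ^+ K :> R by rewrite exprn_ge0.
  clear => ?; lra.
have pi2 : (2 * pi : R)^-1 <= 1.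
  by rewrite invf_le1 ?two_pi_gt0//; have := @pi_ge2 R; clear => ?; lra.
apply: (le_lt_trans (normc_poisson_sub_le c w1 ih)).
have S0 : 0 <= 66 * (e / 100) + 2 * eta / kap * A.
  by rewrite addr_ge0 ?mulr_ge0 ?invr_ge0// ?ltW// divr_gt0.
apply: (@le_lt_trans _ _ (66 * (e / 100) + 2 * eta / kap * A)).
  apply: Rintegral_le_ereal.
    by move=> y _; rewrite mulr_ge0 ?normc_ge0 ?poisson_kernel_ge0.
  rewrite arc_integral_ge0; last 2 first.
  - apply/measurable_EFinP; apply: measurable_funM; first exact: measurable_poisson_kernel.
    apply: cmeas_normc; apply: cmeasB; last exact: cmeas_cst.
    exact: cintegrable_cmeas ih.
  - by move=> y; rewrite lee_fin mulr_ge0 ?normc_ge0 ?poisson_kernel_ge0.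
  rewrite (eq_integral (fun s => (p s * D s)%:E)); last first.
    by move=> s /[!inE] sI; rewrite DI.
  apply: (@le_trans _ _ (((2 * pi : R)^-1)%:E * (66 * (e / 100) + 2 * eta / kap * A)%:E)%E).
    by rewrite lee_wpmul2l// lee_fin invr_ge0 ltW// two_pi_gt0.
  by rewrite -EFinM lee_fin ler_piMl.
have : 2 * eta / kap * A <= e / 4.
  rewrite mulrAC ler_pdivrMr//.
  have h1 : eta * (8 * (A + 1)) <= kap * e by rewrite -ler_pdivlMr ?ltW//; clear - A0; lra.
  have h2 : 0 <= eta * A by rewrite mulr_ge0// ltW.
  move: h1 h2 eta0; clear => *; lra.
clear - e0 => *; lra.
Qed.

End fatou.

(** * Fourier analysis on the circle *)

Local Arguments conjc : simpl never.
Local Arguments cint : simpl never.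
Local Arguments coef : simpl never.
Local Arguments cauchy_int : simpl never.
Local Arguments poisson_int : simpl never.
Local Arguments poisson_kernel : simpl never.

Section fourier.
Variable R : realType.
Local Notation m := (arc_measure R).
Local Notation zc := (@zcoord R).
Local Notation mT := (@measurableT _ (circle R)).
Implicit Types (f h : circle R -> R[i]) (w : R[i]).
Local Notation intg := (cintegrable m setT).

(** The space [H1], described by the vanishing of the Fourier coefficients of negative
   index. *)
Definition analytic h : Prop :=
  intg h /\ forall n, cint m setT (fun y => h y * zc y ^+ n.+1) = 0.

Lemma coef_conj h n : intg h ->
  coef (fun y => conjc (h y)) n = conjc (cint m setT (fun y => h y * zc y ^+ n)).
Proof.
move=> ih; rewrite -cint_conj//; last exact: cintegrableMzX.
by apply: eq_cint => y _; rewrite conjcM conjcX.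
Qed.

Lemma coef0E h : coef h 0 = cint m setT h.
Proof. by apply: eq_cint => y _; rewrite expr0 mulr1. Qed.

Lemma analytic_cauchy_conj h w : normc w < 1 -> analytic h ->
  cauchy_int (fun y => conjc (h y)) w = conjc (cint m setT h).
Proof.
move=> w1 [ih h0]; have ich := cintegrable_conj mT ih.
have c0 n : coef (fun y => conjc (h y)) n.+1 = 0 by rewrite coef_conj// h0 conjc0.
by rewrite (cauchy_int_coef0 w1 ich c0) coef0E cint_conj.
Qed.

Lemma analytic_poisson h w : normc w < 1 -> analytic h -> poisson_int h w = cauchy_int h w.
Proof.
move=> w1 ah; have [ih _] := ah.
by rewrite poisson_intE// analytic_cauchy_conj// conjcK coef0E; ring.
Qed.

Lemma radius_near1 (d : R) : 0 < d -> exists2 r : R, 0 < r < 1 & 1 - d < r < 1.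
Proof.
move=> d0; pose d' := Num.min d 1.
have d'0 : 0 < d' by rewrite lt_min d0 ltr01.
have d'1 : d' <= 1 by rewrite ge_min lexx orbT.
have d'd : d' <= d by rewrite ge_min lexx.
exists (1 - d' / 2); first by apply/andP; split; lra.
by apply/andP; split; lra.
Qed.

(** The Poisson integral of such a function is zero, and converges to it radially. *)
Theorem fourier_uniqueness h : intg h -> (forall n, coef h n = 0) ->
  (forall n, cint m setT (fun y => h y * zc y ^+ n.+1) = 0) ->
  {ae m, forall x, h x = 0}.
Proof.
move=> ih h1 h2.
have P0 w : normc w < 1 -> poisson_int h w = 0.
  move=> w1; rewrite (analytic_poisson w1 (conj ih h2)).
  by rewrite (cauchy_int_coef0 w1 ih (fun n => h1 n.+1)).
apply: filterS (poisson_fatou ih) => x H; apply: normc_eq0.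
apply/eqP; rewrite eq_le normc_ge0 andbT; apply/ler_addgt0Pr => e e0; rewrite add0r.
have [d d0 Hd] := H e e0; have [r r01 rd] := radius_near1 d0.
have := Hd r rd; rewrite P0; first by rewrite sub0r normcN => /ltW.
by case/andP: r01 => r0 r1; rewrite normc_radius// ltW.
Qed.

Lemma bounded_cvg_small d (T : measurableType d) (P : probability T R)
    (u : nat -> T -> R) (C : R) : (forall k, measurable_fun setT (u k)) ->
  {ae P, forall x, forall k, `|u k x| <= C} ->
  {ae P, forall x, u^~ x @ \oo --> 0} -> forall dl : R, 0 < dl ->
  exists K, forall k, (K <= k)%N -> \int[P]_x `|u k x| < dl.
Proof.
move=> mu uC u0 dl dl0.
have [] := @dominated_convergence _ _ _ P setT measurableT (fun k => EFin \o u k) (cst 0%E) (cst C%:E).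
- by move=> k; exact/measurable_EFinP.
- exact: measurable_cst.
- by apply: filterS u0 => x u0 _; apply: cvg_EFin => //; exact: nearW.
- exact: finite_measure_integrable_cst.
- by apply: filterS uC => x uC k _; rewrite /= lee_fin.
move=> _ + _; rewrite /= => cv.
have dE : (0 < dl%:E)%E by rewrite lte_fin.
have [K _ HK] := cv _ (open_ereal_lt' dE).
exists K => k Kk; have /= := HK k Kk.
have iu : P.-integrable setT (EFin \o (fun x => `|u k x|)).
  apply: (@ae_rintegrable_le _ _ _ _ _ measurableT _ (cst C)).
  - by apply: measurableT_comp.
  - by apply: filterS uC => x uC _; rewrite normr_id.
  - exact: finite_measure_integrable_cst.
under eq_integral do rewrite subr0.
by rewrite -[X in (X < _)%E]fineK ?lte_fin//; exact: integrable_fin_num iu.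
Qed.

Definition trigpoly N (c d : nat -> R[i]) (x : circle R) : R[i] :=
  \sum_(i < N) c i * zc x ^+ i + \sum_(i < N) d i * conjc (zc x) ^+ i.

Lemma cmeas_sum I (s : seq I) (g : I -> circle R -> R[i]) :
  (forall i, cmeas setT (g i)) -> cmeas setT (fun x => \sum_(i <- s) g i x).
Proof.
move=> mg; elim: s => [|i s ih]; first by under eq_fun do rewrite big_nil; exact: cmeas_cst.
by under eq_fun do rewrite big_cons; exact: cmeasD.
Qed.

Lemma cmeas_trigpoly N c d : cmeas setT (trigpoly N c d).
Proof.
apply: cmeasD; apply: cmeas_sum => i; apply: cmeasM; try exact: cmeas_cst.
  exact: cmeas_zcX.
by under eq_fun do rewrite -conjcX; exact/cmeas_conj/cmeas_zcX.
Qed.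

(** Partial sums of the Poisson integral on the circle of radius [r]. Both halves contain
   the constant term, whence the correction at index zero. *)
Definition abel_sum N (r : R) h : circle R -> R[i] :=
  trigpoly N (fun i => r%:C ^+ i * coef h i)
    (fun i => r%:C ^+ i * conjc (coef (fun y => conjc (h y)) i) - (i == 0%N)%:R * coef h 0).

Lemma abel_sum_approx N (r : R) h x : 0 <= r < 1 -> intg h -> (0 < N)%N ->
  normc (poisson_int h (r%:C * zc x) - abel_sum N r h x) <=
  r ^+ N * (2 / (1 - r) * \int[m]_y normc (h y)).
Proof.
move=> /andP[r0 r1] ih N0; have ich := cintegrable_conj mT ih.
have w1 : normc (r%:C * zc x) < 1 by rewrite normc_radius.
have H1 := cauchy_int_approx N w1 ih; have H2 := cauchy_int_approx N w1 ich.
rewrite !normc_radius// in H1 H2.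
have I2 : \int[m]_y normc (conjc (h y)) = \int[m]_y normc (h y).
  by apply: eq_Rintegral => y _; rewrite normc_conj.
rewrite I2 in H2; rewrite poisson_intE//.
have -> : abel_sum N r h x = \sum_(i < N) (r%:C * zc x) ^+ i * coef h i +
   conjc (\sum_(i < N) (r%:C * zc x) ^+ i * coef (fun y => conjc (h y)) i) - coef h 0.
  rewrite /abel_sum /trigpoly -addrA; congr (_ + _).
    by apply: eq_bigr => i _; rewrite exprMn; ring.
  rewrite raddf_sum/=; case: N N0 {H1 H2} => // N _.
  rewrite !big_ord_recl /= !expr0 !mul1r !mulr1 [RHS]addrAC; congr (_ + _).
  apply: eq_bigr => i _; rewrite mul0r subr0 !conjcM !conjcX conjcM conjc_real exprMn.
  by rewrite /bump/= add1n; ring.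
set s1 := \sum_(i < N) _ in H1 *; set s2 := \sum_(i < N) _ in H2 *.
set c1 := cauchy_int h _ in H1 *; set c2 := cauchy_int _ _ in H2 *.
have -> : c1 + conjc c2 - coef h 0 - (s1 + conjc s2 - coef h 0) = (c1 - s1) + conjc (c2 - s2).
  by rewrite conjcB; ring.
apply: (le_trans (normcD _ _)); rewrite normc_conj.
by apply: (le_trans (lerD H1 H2)); apply: eq_lew; field; lra.
Qed.

(** Poisson integrals keep the bound [M] and converge almost everywhere, hence in [L1] by
   dominated convergence; on each circle they are uniform limits of Abel sums. *)
Lemma abel_sum_bounded_approx h (M dl : R) : cmeas setT h ->
  {ae m, forall x, normc (h x) <= M} -> 0 < dl ->
  exists N r, let p := abel_sum N r h in [/\ (0 < N)%N, 0 <= r < 1,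
    forall x, normc (p x) <= M + 1 & \int[m]_x normc (p x - h x) < dl].
Proof.
move=> mh hM dl0; have ih := arc_cintegrable_bounded mh hM.
pose rk (k : nat) : R := 1 - k.+1%:R^-1.
have rk01 k : 0 <= rk k < 1.
  by rewrite subr_ge0 invf_le1// ler1n/= gtrBl invr_gt0 ltr0n.
have ex k : exists N, (0 < N)%N /\ forall x,
    normc (poisson_int h ((rk k)%:C * zc x) - abel_sum N (rk k) h x) <= k.+1%:R^-1.
  have k0 : 0 < k.+1%:R^-1 :> R by rewrite invr_gt0 ltr0n.
  have /cvgrPdist_lt/(_ _ k0)[N _ HN] :=
    cvg_geom (2 / (1 - rk k) * \int[m]_y normc (h y)) (rk01 k).
  exists N.+1; split => // x; apply: (le_trans (abel_sum_approx x (rk01 k) ih _)) => //.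
  have := HN N.+1 (leqnSn N); rewrite /= sub0r normrN => /ltW.
  by apply: le_trans; exact: ler_norm.
have [Nk /all_and2[Nk0 Nk1]] := choice ex.
pose p k := abel_sum (Nk k) (rk k) h.
have {}Nk1 k x : normc (poisson_int h ((rk k)%:C * zc x) - p k x) <= k.+1%:R^-1 := Nk1 k x.
have pM k x : normc (p k x) <= M + 1.
  have w1 : normc ((rk k)%:C * zc x) < 1.
    by have /andP[a b] := rk01 k; rewrite normc_radius.
  have := normcB (poisson_int h ((rk k)%:C * zc x)) (poisson_int h ((rk k)%:C * zc x) - p k x).
  rewrite subKr; have := normc_poisson_le w1 mh hM; have := Nk1 k x.
  have : k.+1%:R^-1 <= 1 :> R by rewrite invf_le1// ler1n.
  by move: (k.+1%:R^-1) => q; lra.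
have mp k : measurable_fun setT (fun x => normc (p k x - h x)).
  by apply: cmeas_normc; apply: cmeasB => //; exact: cmeas_trigpoly.
have pb : {ae m, forall x, forall k, `|normc (p k x - h x)| <= M + 1 + M}.
  apply: filterS hM => x hx k; rewrite ger0_norm ?normc_ge0//.
  by apply: (le_trans (normcB _ _)); apply: lerD.
have pc : {ae m, forall x, (fun k => normc (p k x - h x)) @ \oo --> 0}.
  apply: filterS (poisson_fatou ih) => x H; apply/cvgrPdist_lt => e e0.
  have e20 : 0 < e / 2 by rewrite divr_gt0.
  have [d d0 Hd] := H _ e20.
  have m0 : 0 < Num.min d (e / 2) by rewrite lt_min d0.
  have [K _ HK] := near_infty_natSinv_lt (PosNum m0).
  exists K => // k /= Kk; have := HK k Kk; rewrite /= lt_min => /andP[kd ke].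
  rewrite sub0r normrN ger0_norm ?normc_ge0//.
  have /andP[_ rk1] := rk01 k.
  have rkd : 1 - d < rk k < 1 by rewrite rk1 andbT /rk ltrD2l ltrN2.
  have := Hd _ rkd; have := Nk1 k x; rewrite normc_distC => a b.
  have := normcD (p k x - poisson_int h ((rk k)%:C * zc x)) (poisson_int h ((rk k)%:C * zc x) - h x).
  rewrite addrA subrK; move: (k.+1%:R^-1) ke a b {kd rkd} => q; lra.
have [K HK] := bounded_cvg_small mp pb pc dl0.
exists (Nk K), (rk K); split => //; first exact: pM.
have := HK K (leqnn K); rewrite (_ : \int[m]_x `|_| = \int[m]_x normc (p K x - h x))//.
by apply: eq_Rintegral => x _; rewrite ger0_norm// normc_ge0.
Qed.

Lemma analytic_abel_sum N (r : R) h x : analytic h -> (0 < N)%N ->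
  abel_sum N r h x = \sum_(i < N) r%:C ^+ i * coef h i * zc x ^+ i.
Proof.
move=> [ih h0] N0; rewrite /abel_sum /trigpoly [X in _ + X]big1 ?addr0// => -[[|i] iN] _ /=.
  by rewrite !expr0 coef_conj// !mul1r conjcK coef0E (_ : cint m setT (fun y => h y * zc y ^+ 0) = cint m setT h) ?subrr ?mul0r//;
    apply: eq_cint => y _; rewrite expr0 mulr1.
by rewrite coef_conj// h0 conjcK mulr0 mul0r subr0 mul0r.
Qed.

End fourier.

(** * Bounded analytic functions *)

Section hardy.
Variable R : realType.
Local Notation m := (arc_measure R).
Local Notation zc := (@zcoord R).
Local Notation mT := (@measurableT _ (circle R)).
Implicit Types (f g h : circle R -> R[i]) (w : R[i]).
Local Notation intg := (cintegrable m setT).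

Lemma Linfty_cmeas f : Linfty f -> cmeas setT f. Proof. by case. Qed.

Lemma Linfty_bounded f (M : R) : cmeas setT f -> (forall x, normc (f x) <= M) -> Linfty f.
Proof. by move=> mf fM; split => //; exists M; exact: aeW. Qed.

Lemma Linfty_cst (c : R[i]) : Linfty (fun _ : circle R => c).
Proof. by apply: (Linfty_bounded (M := normc c)) => //; exact: cmeas_cst. Qed.

Lemma LinftyD f g : Linfty f -> Linfty g -> Linfty (fun x => f x + g x).
Proof.
move=> [mf [M fM]] [mg [N gN]]; split; first exact: cmeasD.
exists (M + N); apply: filterS2 fM gN => x a b.
by rewrite (le_trans (normcD _ _))// lerD.
Qed.

Lemma LinftyM f g : Linfty f -> Linfty g -> Linfty (fun x => f x * g x).
Proof.
move=> [mf [M fM]] [mg [N gN]]; split; first exact: cmeasM.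
exists (M * N); apply: filterS2 fM gN => x a b.
by rewrite normcM ler_pM ?normc_ge0.
Qed.

Lemma Linfty_conj f : Linfty f -> Linfty (fun x => conjc (f x)).
Proof.
move=> [mf [M fM]]; split; first exact: cmeas_conj.
by exists M; apply: filterS fM => x; rewrite normc_conj.
Qed.

Lemma Linfty_zcX n : Linfty (fun x => zc x ^+ n).
Proof.
by apply: (Linfty_bounded (M := 1)) => [|x]; [exact: cmeas_zcX|rewrite normc_zcX].
Qed.

Lemma Linfty_intg f : Linfty f -> intg f.
Proof. by move=> [mf [M fM]]; exact: arc_cintegrable_bounded mf fM. Qed.

Lemma Linfty_L2 f : Linfty f -> L2 m f.
Proof.
move=> [mf [M fM]]; split => //.
apply: (@ae_rintegrable_le _ _ _ _ _ mT _ (cst (M ^+ 2))).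
- exact: cmeas_sqnormc.
- apply: filterS fM => x fx _; rewrite ger0_norm ?sqr_ge0//=.
  by rewrite lerXn2r ?nnegrE ?normc_ge0// (le_trans (normc_ge0 _) fx).
- exact: finite_measure_integrable_cst.
Qed.

Lemma radial_limP (g : R -> R[i]^o) (l : R[i]) :
  g r @[r --> (1 : R)^'-] --> (l : R[i]^o) <->
  forall e : R, 0 < e -> exists2 d : R, 0 < d & forall r, 1 - d < r < 1 -> normc (g r - l) < e.
Proof.
split.
- move=> /cvgrPdist_lt gl e e0.
  have [|d /= d0 H] := gl e%:C; first by rewrite ltcR.
  exists d => // r /andP[dr r1].
  have := H r; rewrite /ball_/= ger0_norm ?subr_ge0 ?ltW// => /(_ _ r1).
  by rewrite normrE ltcR normc_distC; apply; lra.
- move=> H; apply/cvgrPdist_lt => e; rewrite ltcE => /andP[/eqP eI eR].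
  have eE : e = (Re e)%:C by exact: complex_ext.
  have [d d0 Hd] := H _ eR; exists d => //= r; rewrite /ball_/= => rd r1.
  rewrite eE normrE ltcR normc_distC; apply: Hd; rewrite r1 andbT.
  by move: rd; rewrite ger0_norm ?subr_ge0 ?ltW//; lra.
Qed.

(** On a circle of radius [r < 1] the coefficients of negative index are circle means of
   the holomorphic functions [w ^ n.+1 * F w], which vanish at the origin; dominated
   convergence carries this to the boundary. *)
Lemma Hinfty_analytic f : Hinfty f -> analytic f.
Proof.
move=> [Lf [F [hF [M FM] Ff]]]; have intf := Linfty_intg Lf; split => // n.
have [mf [N fN]] := Lf.
pose rk (k : nat) : R := 1 - k.+2%:R^-1.
have rk01 k : 0 < rk k < 1.
  by rewrite subr_gt0 invf_lt1 ?ltr0n// ltr1n/= gtrBl invr_gt0 ltr0n.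
have FMk k x : normc (F ((rk k)%:C * zc x)) <= M.
  by have /andP[a b] := rk01 k; apply: FM; rewrite normrE normc_radius ?ltW// ltcR.
have mF k : cmeas setT (fun x : circle R => F ((rk k)%:C * zc x)) by exact: cmeas_dilate.
have iF k : intg (fun x => F ((rk k)%:C * zc x)).
  by apply: (arc_cintegrable_bounded (M := M)) => //; apply: aeW => x; exact: FMk.
have mu k : measurable_fun setT (fun x => normc (f x - F ((rk k)%:C * zc x))).
  by apply: cmeas_normc; exact: cmeasB.
have ub : {ae m, forall x, forall k, `|normc (f x - F ((rk k)%:C * zc x))| <= N + M}.
  apply: filterS fN => x fx k; rewrite ger0_norm ?normc_ge0//.
  by apply: (le_trans (normcB _ _)); apply: lerD.
have uc : {ae m, forall x, (fun k => normc (f x - F ((rk k)%:C * zc x))) @ \oo --> 0}.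
  apply: filterS Ff => x /radial_limP H; apply/cvgrPdist_lt => e e0.
  have [d d0 Hd] := H _ e0.
  have [K _ HK] := near_infty_natSinv_lt (PosNum d0).
  exists K => // k /= Kk; have /= kd := HK k Kk.
  rewrite sub0r normrN ger0_norm ?normc_ge0// normc_distC; apply: Hd.
  have /andP[_ ->] := rk01 k; rewrite andbT /rk ltrD2l ltrN2; apply: le_lt_trans kd.
  by rewrite lef_pV2 ?posrE ?ltr0n// ler_nat.
apply: normc_eq0; apply/eqP; rewrite eq_le normc_ge0 andbT; apply/ler_addgt0Pr => e e0; rewrite add0r.
have [K HK] := bounded_cvg_small mu ub uc e0.
have iB : intg (fun x => f x - F ((rk K)%:C * zc x)) by exact: cintegrableB.
have -> : cint m setT (fun y => f y * zc y ^+ n.+1) =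
    cint m setT (fun y => (f y - F ((rk K)%:C * zc y)) * zc y ^+ n.+1).
  have z0 := cint_dilate_zX n hF (rk01 K) (iF K).
  rewrite -[LHS]subr0 -{1}z0 -cintB//; [|exact: cintegrableMzX|exact: cintegrableMzX].
  by apply: eq_cint => y _; rewrite mulrBl.
apply: (le_trans (normc_cint_le mT (cintegrableMzX _ iB))).
apply: ltW; apply: le_lt_trans (HK K (leqnn K)); apply: eq_lew; apply: eq_Rintegral => x _.
by rewrite normcM normc_zcX mulr1 ger0_norm// normc_ge0.
Qed.

(** The Taylor expansion of the Cauchy kernel to first order is uniform on the circle. *)
Lemma cauchy_int_holomorphic h : intg h -> @holomorphic_disk R (cauchy_int h).
Proof.
move=> ih w0; rewrite normrE ltcR => w01.
pose dl := (1 - normc w0) / 2; have dl0 : 0 < dl by rewrite divr_gt0// subr_gt0.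
pose C := \int[m]_y normc (h y); have C0 : 0 <= C by apply: Rintegral_ge0 => y _; exact: normc_ge0.
pose k0 y := (1 - w0 * conjc (zc y))^-1.
pose A := cint m setT (fun y => (conjc (zc y) * k0 y ^+ 2) * h y).
have k0b y : normc (k0 y) <= (dl + dl)^-1.
  by rewrite (_ : dl + dl = 1 - normc w0) ?normc_cauchy_le// /dl; field.
have mk0 : cmeas setT k0 by exact: cmeas_cauchy.
have mzb : cmeas setT (fun y => conjc (zc y)) by exact/cmeas_conj/cmeas_zcoord.
have iA : intg (fun y => (conjc (zc y) * k0 y ^+ 2) * h y).
  apply: (cintegrableMbd mT (M := (dl + dl)^-1 ^+ 2)) ih.
    by apply: (cmeasM mzb); exact: cmeasX.
  move=> y _; rewrite normcM normc_conj normc_zcoord mul1r normcX.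
  have dd : 0 <= (dl + dl)^-1 by rewrite invr_ge0; lra.
  by rewrite lerXn2r ?nnegrE ?normc_ge0.
apply: (@expansion_derivable _ _ _ A) => e e0.
have C1 : 0 < C + 1 by rewrite ltr_wpDl.
have D0 : 0 < e * dl ^+ 3 / (C + 1).
  by rewrite divr_gt0// mulr_gt0// exprn_gt0.
exists (Num.min dl (e * dl ^+ 3 / (C + 1))); first by rewrite lt_min dl0.
move=> w; rewrite lt_min => /andP[wd wD].
have ww : normc w <= 1 - dl.
  by have := normcD (w - w0) w0; rewrite subrK => ?; move: wd; rewrite /dl; lra.
have w1 : normc w < 1 by lra.
pose k y := (1 - w * conjc (zc y))^-1.
have kb y : normc (k y) <= dl^-1.
  apply: (le_trans (normc_cauchy_le y w1)).
  by rewrite lef_pV2 ?posrE//; lra.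
have ik : intg (fun y => k y * h y) by exact: cauchy_cintegrable.
have ik0 : intg (fun y => k0 y * h y) by exact: cauchy_cintegrable.
have E : cauchy_int h w - cauchy_int h w0 - A * (w - w0) =
    cint m setT (fun y => (conjc (zc y) ^+ 2 * (w - w0) ^+ 2 * (k y * k0 y ^+ 2)) * h y).
  rewrite (mulrC A) /A -cintZ// /cauchy_int -cintB// -cintB//; last 2 first.
  - exact: cintegrableB.
  - exact: cintegrableZ.
  apply: eq_cint => y _; rewrite /k /k0.
  have n1 := one_sub_neq0 y w1; have n2 := one_sub_neq0 y w01.
  by field; rewrite n1 n2.
have iE : intg (fun y => (conjc (zc y) ^+ 2 * (w - w0) ^+ 2 * (k y * k0 y ^+ 2)) * h y).
  have := cintegrableB mT (cintegrableB mT ik ik0) (cintegrableZ mT (w - w0) iA).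
  apply: (ae_cintegrable mT).
  - apply: cmeasB; last by apply: cmeasM; [exact: cmeas_cst|exact: cintegrable_cmeas iA].
    by apply: cmeasB; [exact: cintegrable_cmeas ik|exact: cintegrable_cmeas ik0].
  - apply: cmeasM; last exact: cintegrable_cmeas ih.
    apply: cmeasM; first by apply: cmeasM; [exact: cmeasX|exact: cmeas_cst].
    by apply: cmeasM; [exact: cmeas_cauchy|exact: cmeasX].
  - apply: aeW => y _; rewrite /k /k0.
    have n1 := one_sub_neq0 y w1; have n2 := one_sub_neq0 y w01.
    by field; rewrite n1 n2.
rewrite E; apply: (le_trans (normc_cint_le mT iE)).
set n := normc (w - w0) in wd wD *; have n0 : 0 <= n by exact: normc_ge0.
apply: (@le_trans _ _ (n ^+ 2 * dl^-1 ^+ 3 * C)).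
  have ihn := cintegrable_normc mT ih.
  rewrite -RintegralZl//; apply: le_Rintegral => //.
  - exact: cintegrable_normc.
  - exact: rintegrableZ.
  move=> y _; rewrite normcM ler_wpM2r ?normc_ge0//.
  rewrite (normcM (conjc (zc y) ^+ 2 * (w - w0) ^+ 2)) (normcM (conjc (zc y) ^+ 2)) (normcM (k y)) !normcX normc_conj normc_zcoord expr1n mul1r -/n.
  rewrite ler_wpM2l ?sqr_ge0// [dl^-1 ^+ 3]exprS ler_pM ?normc_ge0 ?sqr_ge0//.
  rewrite lerXn2r ?nnegrE ?normc_ge0 ?invr_ge0 ?(ltW dl0)//.
  apply: (le_trans (k0b y)); rewrite lef_pV2 ?posrE ?addr_gt0//.
  by rewrite lerDl ltW.
rewrite expr2 -2!mulrA [leRHS]mulrC ler_wpM2l//.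
apply: (@le_trans _ _ (e * dl ^+ 3 / (C + 1) * (dl^-1 ^+ 3 * C))).
  apply: ler_wpM2r; last exact: ltW.
  by rewrite mulr_ge0// exprn_ge0// invr_ge0 ltW.
rewrite (_ : _ * _ = e * (C / (C + 1))); last by field; rewrite !gt_eqF.
by apply: ler_piMr; [exact: ltW|rewrite ler_pdivrMr// mul1r lerDl].
Qed.

(** The extension is the Cauchy integral; as it agrees with the Poisson integral, it is
   bounded and has [f] for radial limits. *)
Lemma analytic_Hinfty f : Linfty f -> analytic f -> Hinfty f.
Proof.
move=> Lf af; split => //; have intf := Linfty_intg Lf.
have [mf [M fM]] := Lf.
exists (cauchy_int f); split.
- exact: cauchy_int_holomorphic.
- exists M => w; rewrite normrE ltcR => w1.
  by rewrite -analytic_poisson//; exact: normc_poisson_le.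
- apply: filterS (poisson_fatou intf) => x H; apply/radial_limP => e e0.
  have [d d0 Hd] := H e e0.
  exists (Num.min d 1); first by rewrite lt_min d0 ltr01.
  move=> r /andP[rd r1].
  have m1 : Num.min d 1 <= d by rewrite ge_min lexx.
  have m2 : Num.min d 1 <= 1 by rewrite ge_min lexx orbT.
  rewrite -analytic_poisson//; last by rewrite normc_radius//; lra.
  by apply: Hd; rewrite r1 andbT; lra.
Qed.

Lemma HinftyE f : Hinfty f <-> Linfty f /\ analytic f.
Proof.
split=> [Hf|[Lf af]]; last exact: analytic_Hinfty.
by split; [case: Hf|exact: Hinfty_analytic].
Qed.

Lemma analyticD f g : analytic f -> analytic g -> analytic (fun x => f x + g x).
Proof.
move=> [fi f0] [gi g0]; split; first exact: cintegrableD.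
move=> n; under eq_cint do rewrite mulrDl.
by rewrite cintD ?f0 ?g0 ?addr0//; exact: cintegrableMzX.
Qed.

Lemma analyticZ c f : analytic f -> analytic (fun x => c * f x).
Proof.
move=> [fi f0]; split; first exact: cintegrableZ.
move=> n; under eq_cint do rewrite -mulrA.
by rewrite cintZ ?f0 ?mulr0//; exact: cintegrableMzX.
Qed.

Lemma analyticMzX f k : analytic f -> analytic (fun x => f x * zc x ^+ k).
Proof.
move=> [fi f0]; split; first exact: cintegrableMzX.
by move=> n; under eq_cint do rewrite -mulrA -exprD addnS; rewrite f0.
Qed.

Lemma analytic1 : analytic (fun _ : circle R => 1).
Proof.
split; first exact: cintegrable_cst.
by move=> n; under eq_cint do rewrite mul1r; exact: cint_zX.
Qed.

Definition zpoly N (c : nat -> R[i]) (x : circle R) : R[i] := \sum_(i < N) c i * zc x ^+ i.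

(** The Abel sums of an analytic function are polynomials in [z]. *)
Lemma analytic_approx f (M dl : R) : analytic f ->
  {ae m, forall x, normc (f x) <= M} -> 0 < dl ->
  exists N c, (forall x, normc (zpoly N c x) <= M + 1) /\
    \int[m]_x normc (zpoly N c x - f x) < dl.
Proof.
move=> af fM dl0; have mf := cintegrable_cmeas af.1.
have [N [r /= [N0 r01 pM pf]]] := abel_sum_bounded_approx mf fM dl0.
exists N, (fun i => r%:C ^+ i * coef f i).
have E x : zpoly N (fun i => r%:C ^+ i * coef f i) x = abel_sum N r f x.
  by rewrite analytic_abel_sum.
split=> [x|]; first by rewrite E.
by rewrite (_ : (\int[m]_x _) = \int[m]_x normc (abel_sum N r f x - f x))//;
  apply: eq_Rintegral => x _; rewrite E.
Qed.

End hardy.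

(** * Outer functions with prescribed modulus *)

Section outer.
Variable R : realType.
Local Notation m := (arc_measure R).
Local Notation zc := (@zcoord R).
Local Notation mT := (@measurableT _ (circle R)).
Implicit Types (f g h : circle R -> R[i]).
Local Notation intg := (cintegrable m setT).
Local Notation L2 := (L2 m).
Local Notation nsq := (nsq m).
Local Notation L2cl := (L2cl m).
Local Notation ip := (ip m).

Lemma L2_intg f : L2 f -> intg f.
Proof.
move=> Lf; have := L2M_cintegrable Lf (Linfty_L2 (Linfty_cst 1)).
by under eq_fun do rewrite mulr1.
Qed.

Lemma cintegrable_zX n : intg (fun x => zc x ^+ n).
Proof. exact: Linfty_intg (Linfty_zcX R n). Qed.

Lemma ae_L2M g f (M : R) : cmeas setT g -> {ae m, forall x, normc (g x) <= M} -> L2 f ->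
  L2 (fun x => g x * f x).
Proof.
move=> mg gM [mf fi]; split; first exact: cmeasM.
apply: (@ae_rintegrable_le _ _ _ _ _ mT _ (fun x => M ^+ 2 * normc (f x) ^+ 2)).
- by apply: cmeas_sqnormc; exact: cmeasM.
- apply: filterS gM => x gx _; rewrite ger0_norm ?sqr_ge0//= normcM exprMn.
  by rewrite ler_wpM2r ?sqr_ge0// lerXn2r ?nnegrE ?normc_ge0// (le_trans (normc_ge0 _) gx).
- exact: rintegrableZ.
Qed.

Lemma nsq_zX f n : nsq (fun x => f x * zc x ^+ n) = nsq f.
Proof. by apply: eq_Rintegral => x _; rewrite normcM normc_zcX mulr1. Qed.

Lemma nsq1 : nsq (fun=> 1) = 1.
Proof.
rewrite (_ : nsq _ = \int[m]_x 1).
  rewrite Rintegral_cst// mul1r; exact: (congr1 fine (@probability_setT _ _ _ m)).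
by apply: eq_Rintegral => x _; rewrite normc1 expr1n.
Qed.

Lemma norm1_sq_le_nsq f : L2 f -> (\int[m]_x normc (f x)) ^+ 2 <= nsq f.
Proof.
move=> Lf; have := cauchy_schwarz Lf (Linfty_L2 (Linfty_cst 1)).
rewrite nsq1.
rewrite mulr1 (_ : \int[m]_x _ = \int[m]_x normc (f x))//.
by apply: eq_Rintegral => x _; rewrite normc1 mulr1.
Qed.

(** The coefficients of opposite indices of a real function are conjugate, so uniqueness
   applies to [u] minus its mean. *)
Lemma real_coef0_cst (u : circle R -> R) : m.-integrable setT (EFin \o u) ->
  (forall n, cint m setT (fun y => (u y)%:C * zc y ^+ n.+1) = 0) ->
  {ae m, forall x, u x = \int[m]_y u y}.
Proof.
move=> ui u0; set c := \int[m]_y u y.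
have iu := cintegrable_real mT ui.
have iuc : intg (fun x => (u x - c)%:C).
  have ci : m.-integrable setT (EFin \o (fun=> c)) by exact: finite_measure_integrable_cst.
  exact: (cintegrable_real mT (rintegrableB mT ui ci)).
have K n : cint m setT (fun y => (u y - c)%:C * zc y ^+ n.+1) = 0.
  rewrite (_ : cint _ _ _ = cint m setT (fun y => (u y)%:C * zc y ^+ n.+1 - c%:C * zc y ^+ n.+1)).
    rewrite cintB// ?u0 ?sub0r.
    - by rewrite (cintZ mT _ (cintegrable_zX _)) cint_zX mulr0 oppr0.
    - exact: cintegrableMzX.
    - exact: (cintegrableZ mT _ (cintegrable_zX _)).
  by apply: eq_cint => y _; rewrite rmorphB/= mulrBl.
have C n : coef (fun y => (u y - c)%:C) n = 0.
  case: n => [|n].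
    rewrite coef0E cint_real RintegralB//; last exact: finite_measure_integrable_cst.
    rewrite Rintegral_cst// (_ : fine _ = 1) ?mulr1 ?subrr//.
    exact: (congr1 fine (@probability_setT _ _ _ m)).
  have := K n; rewrite -[X in _ = X -> _]conjc0 => /(congr1 conjc).
  rewrite -cint_conj//; last exact: cintegrableMzX.
  rewrite conjcK => <-; apply: eq_cint => y _.
  by rewrite conjcM conjc_real conjcX.
apply: filterS (fourier_uniqueness iuc C K) => x /(congr1 (@complex.Re R))/= /eqP.
by rewrite subr_eq0 => /eqP.
Qed.

Lemma zpoly_analytic N (c : nat -> R[i]) : Linfty (zpoly N c) /\ analytic (zpoly N c).
Proof.
elim: N => [|N [ihL iha]].
  have E : zpoly 0 c = fun=> 0 by apply/funext => x; rewrite /zpoly big_ord0.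
  rewrite E; split; first exact: Linfty_cst.
  have := analyticZ 0 (analytic1 R); by under eq_fun do rewrite mul0r.
have E : zpoly N.+1 c = fun x => zpoly N c x + c N * zc x ^+ N.
  by apply/funext => x; rewrite /zpoly big_ord_recr.
rewrite E; split.
- by apply: LinftyD => //; apply: LinftyM; [exact: Linfty_cst|exact: Linfty_zcX].
- apply: analyticD => //; apply: analyticZ.
  by have := analyticMzX N (analytic1 R); under eq_fun do rewrite mul1r.
Qed.

Definition zpolys : set (circle R -> R[i]) := [set p | exists N c, p = zpoly N c].

Lemma zpolysD p q : zpolys p -> zpolys q -> zpolys (fun x => p x + q x).
Proof.
move=> [N [c ->]] [N' [c' ->]].
exists (maxn N N'), (fun i => (if (i < N)%N then c i else 0) + (if (i < N')%N then c' i else 0)).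
have ext (K K' : nat) (b : nat -> R[i]) x : (K <= K')%N ->
    zpoly K b x = \sum_(i < K') (if (i < K)%N then b i else 0) * zc x ^+ i.
  move=> KK; rewrite /zpoly (big_ord_widen K' (fun i => b i * zc x ^+ i)) //.
  by rewrite big_mkcond; apply: eq_bigr => i _; case: ifP => //; rewrite mul0r.
apply/funext => x; rewrite (ext N (maxn N N')) ?leq_maxl// (ext N' (maxn N N')) ?leq_maxr//.
by rewrite -big_split; apply: eq_bigr => i _; rewrite /= mulrDl.
Qed.

Lemma zpolysZ (a : R[i]) p : zpolys p -> zpolys (fun x => a * p x).
Proof.
move=> [N [c ->]]; exists N, (fun i => a * c i); apply/funext => x.
by rewrite /zpoly mulr_sumr; apply: eq_bigr => i _; rewrite mulrA.
Qed.

Lemma zpolysMz p : zpolys p -> zpolys (fun x => p x * zc x).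
Proof.
move=> [N [c ->]]; exists N.+1, (fun i => if i is j.+1 then c j else 0); apply/funext => x.
rewrite /zpoly big_ord_recl mul0r add0r mulr_suml; apply: eq_bigr => i _.
by rewrite /= exprSr mulrA.
Qed.

Lemma zpolysMzX p n : zpolys p -> zpolys (fun x => p x * zc x ^+ n).
Proof.
elim: n => [|n ih] zp; first by under eq_fun do rewrite expr0 mulr1.
by under eq_fun do rewrite exprSr mulrA; apply: zpolysMz; exact: ih.
Qed.

Lemma zpolys1 : zpolys (fun=> 1).
Proof. by exists 1%N, (fun=> 1); apply/funext => x; rewrite /zpoly big_ord1 expr0 mulr1. Qed.

(** Given [w >= 1] integrable, project [sqrt w] onto the closure of
   [{sqrt w * z * p | p polynomial}] and divide the residue by [sqrt w]: the quotient
   [k] is orthogonal to its own translates in [L2 (w dm)], so [|k| ^ 2 * w] is constant,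
   and [k] has mean one, being one minus a limit of polynomials vanishing at zero. *)
Lemma outer_function (w : circle R -> R) : m.-integrable setT (EFin \o w) ->
  (forall x, 1 <= w x) ->
  exists k c, [/\ Linfty k, analytic k, 1 <= c <= \int[m]_x w x,
    {ae m, forall x, normc (k x) ^+ 2 * w x = c} &
    nsq (fun x => k x - 1) <= \int[m]_x w x - 1].
Proof.
move=> iw w1.
have w0 x : 0 < w x by exact: lt_le_trans (w1 x).
pose s x := Num.sqrt (w x).
have s0 x : 0 < s x by rewrite sqrtr_gt0.
have s2 x : s x ^+ 2 = w x by rewrite sqr_sqrtr// ltW.
have s1 x : 1 <= s x by rewrite -sqrtr1 ler_wsqrtr.
have mw := rintegrable_meas iw.
have ms : measurable_fun setT s.
  exact: (measurableT_comp (continuous_measurable_fun (@sqrt_continuous R)) mw).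
pose S x := (s x)%:C.
have LS : L2 S.
  split; first exact: cmeas_real.
  by under eq_fun do rewrite /S normc_real real_normK ?num_real// s2.
pose M : set (circle R -> R[i]) := [set f | exists2 p, zpolys p & f = fun x => S x * (p x * zc x)].
have LSp p : zpolys p -> L2 (fun x => S x * p x).
  move=> [N [c ->]]; have [mp [B pB]] := (zpoly_analytic N c).1.
  under eq_fun do rewrite mulrC; exact: (ae_L2M mp pB).
have ML : M `<=` L2 by move=> _ [p zp ->]; apply: LSp; exact: zpolysMz.
have M0 : M !=set0 by exists (fun x => S x * (1 * zc x)), (fun=> 1) => //; exact: zpolys1.
have MD f h : M f -> M h -> M (fun x => f x + h x).
  move=> [p zp ->] [q zq ->]; exists (fun x => p x + q x); first exact: zpolysD.
  by apply/funext => x; ring.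
have MZ (c : R[i]) f : M f -> M (fun x => c * f x).
  move=> [p zp ->]; exists (fun x => c * p x); first exact: zpolysZ.
  by apply/funext => x; ring.
have [q [Lq qM] qperp] := L2_projection ML LS M0 MD MZ.
pose Si x := ((s x)^-1)%:C.
have SiS x : Si x * S x = 1 by rewrite /Si /S -rmorphM/= mulVf// gt_eqF.
have mSi : cmeas setT Si.
  by apply: cmeas_real; apply: measurable_inv => // x; rewrite ltW.
have Si1 x : normc (Si x) <= 1.
  by rewrite normc_real ger0_norm ?invr_ge0 ?(ltW (s0 x))// invf_le1.
pose r x := S x - q x.
have Lr : L2 r by exact: L2B.
pose k x := Si x * r x.
have rE x : r x = S x * k x by rewrite /k mulrA (mulrC (S x)) SiS mul1r.
have Lk : L2 k by apply: (ae_L2M mSi (M := 1)) => //; exact: aeW.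
have Mr n : M (fun x => S x * (zc x ^+ n * zc x)).
  exists (fun x => zc x ^+ n) => //; have := zpolysMzX n zpolys1.
  by under eq_fun do rewrite mul1r.
have rperp f : M f -> ip r f = 0 by exact: qperp.
have MzX f n : M f -> M (fun x => f x * zc x ^+ n).
  move=> [p zp ->]; exists (fun x => p x * zc x ^+ n); first exact: zpolysMzX.
  by apply/funext => x; ring.
have L2zX f n : L2 f -> L2 (fun x => f x * zc x ^+ n).
  move=> Lf; under eq_fun do rewrite mulrC.
  by apply: (ae_L2M (M := 1)) => //; [exact: cmeas_zcX|apply: aeW => x; rewrite normc_zcX].
have qzX n : L2cl M (fun x => q x * zc x ^+ n).
  split; first exact: L2zX.
  move=> e e0; have [f Mf fe] := qM _ e0; exists (fun x => f x * zc x ^+ n); first exact: MzX.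
  by under eq_fun do rewrite -mulrBl; rewrite nsq_zX.
have rrz n : ip r (fun x => r x * zc x ^+ n.+1) = 0.
  have h1 : ip r (fun x => S x * zc x ^+ n.+1) = 0.
    apply: rperp; have := Mr n.
    by under eq_fun do rewrite -exprSr.
  have h2 := ip_L2cl0 ML Lr rperp (qzX n.+1).
  rewrite -[LHS]conjcK (ip_conj Lr (L2zX _ _ Lr)).
  rewrite (_ : (fun x => r x * zc x ^+ n.+1) = fun x => S x * zc x ^+ n.+1 - q x * zc x ^+ n.+1); last first.
    by apply/funext => x; rewrite /r; ring.
  rewrite (ipBl (L2zX S n.+1 LS) (L2zX q n.+1 Lq) Lr).
  by rewrite conjcB (ip_conj (L2zX S n.+1 LS) Lr) (ip_conj (L2zX q n.+1 Lq) Lr) h1 h2 subr0.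
have Siq n : cint m setT (fun x => Si x * q x * zc x ^+ n) = 0.
  apply: normc_eq0; apply/eqP; rewrite eq_le normc_ge0 andbT.
  apply/ler_addgt0Pr => e e0; rewrite add0r.
  have [f Mf fe] := qM _ (exprn_gt0 2 e0).
  have [p zp Ef] := Mf.
  have Lqf : L2 (fun x => q x - f x) by apply: L2B => //; exact: ML.
  have ap : analytic p by case: zp => [N [c ->]]; case: (zpoly_analytic N c).
  have LSif g : L2 g -> L2 (fun x => Si x * g x).
    by move=> Lg; apply: (ae_L2M mSi (M := 1)) => //; exact: aeW.
  have E0 : cint m setT (fun x => Si x * f x * zc x ^+ n) = 0.
    rewrite -(ap.2 n); apply: eq_cint => x _.
    by rewrite Ef exprS !mulrA SiS; ring.
  have -> : cint m setT (fun x => Si x * q x * zc x ^+ n) =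
      cint m setT (fun x => Si x * (q x - f x) * zc x ^+ n).
    rewrite -[LHS]subr0 -{1}E0 -cintB//.
    - by apply: eq_cint => x _; ring.
    - by apply/cintegrableMzX/L2_intg/LSif.
    - by apply/cintegrableMzX/L2_intg/LSif; exact: ML.
  apply: (le_trans (normc_cint_le mT _)).
    by apply/cintegrableMzX/L2_intg/LSif.
  apply: (@le_trans _ _ (\int[m]_x normc (q x - f x))).
    apply: le_Rintegral => //.
    - by apply: cintegrable_normc => //; apply/cintegrableMzX/L2_intg/LSif.
    - by apply: cintegrable_normc => //; exact: L2_intg.
    - move=> x _; rewrite normcM normc_zcX mulr1 normcM.
      by rewrite ler_piMl ?normc_ge0.
  rewrite -(@ler_pXn2r _ 2) ?nnegrE ?(ltW e0)//; last first.
    by apply: Rintegral_ge0 => x _; exact: normc_ge0.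
  by rewrite (le_trans (norm1_sq_le_nsq Lqf))// ltW.
have kE x : k x = 1 - Si x * q x by rewrite /k /r mulrBr SiS.
have iSq : intg (fun x => Si x * q x).
  by apply: L2_intg; apply: (ae_L2M mSi (M := 1)) => //; exact: aeW.
have Er x : normc (r x) ^+ 2 = normc (k x) ^+ 2 * w x.
  by rewrite rE normcM normc_real exprMn real_normK ?num_real// s2 mulrC.
have ir2 : m.-integrable setT (EFin \o (fun x => normc (r x) ^+ 2)) by case: Lr.
have cst : {ae m, forall x, normc (r x) ^+ 2 = nsq r}.
  apply: real_coef0_cst => // n.
  have := rrz n => /(congr1 conjc); rewrite conjc0 => <-.
  rewrite -(cint_conj mT (ip_cintegrable Lr (L2zX _ _ Lr))).
  apply: eq_cint => x _; rewrite conjcM conjcK -mul_conjc.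
  by ring.
exists k, (nsq r).
have mk1 : cint m setT k = 1.
  rewrite (_ : k = fun x => 1 - Si x * q x); last by apply/funext => x; exact: kE.
  rewrite cintB//; last exact: cintegrable_cst.
  rewrite cint_cst -[RHS]subr0; congr (_ - _).
  by rewrite -(Siq 0%N); apply: eq_cint => x _; rewrite expr0 mulr1.
have kc : {ae m, forall x, normc (k x) ^+ 2 * w x = nsq r}.
  by apply: filterS cst => x <-; rewrite Er.
have kb : {ae m, forall x, normc (k x) <= Num.sqrt (nsq r)}.
  apply: filterS kc => x kx.
  rewrite -(@ler_pXn2r _ 2) ?nnegrE ?normc_ge0 ?sqrtr_ge0// sqr_sqrtr ?nsq_ge0// -kx.
  by rewrite ler_peMr ?sqr_ge0.
have nrk : nsq k <= nsq r.
  apply: le_Rintegral => //; first by case: Lk.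
  by move=> x _; rewrite Er ler_peMr ?sqr_ge0.
have L1 : L2 (fun=> 1) by exact/Linfty_L2/Linfty_cst.
have nk1 : nsq (fun x => k x - 1) = nsq k - 1.
  have := nsqBZ 1 Lk L1; under eq_fun do rewrite mulr1.
  rewrite nsq1 (_ : ip k (fun=> 1) = 1); last first.
    by rewrite -[RHS]mk1; apply: eq_cint => x _; rewrite conjc1 mulr1.
  by move=> ->; rewrite conjc1 mulr1 normc1 expr1n mulr1 /=; lra.
have nrw : nsq r <= \int[m]_x w x.
  have <- : nsq S = \int[m]_x w x.
    by apply: eq_Rintegral => x _; rewrite /S normc_real real_normK ?num_real// s2.
  have := nsqBZ (-1) Lr Lq.
  rewrite (ip_L2cl0 ML Lr rperp (conj Lq qM)) mulr0 /= mulr0 subr0 normcN normc1 expr1n mul1r.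
  rewrite (_ : (fun x => r x - -1 * q x) = S); last by apply/funext => x; rewrite /r; ring.
  by move=> ->; rewrite lerDl nsq_ge0.
split => //.
- by split; [exact: L2_cmeas Lk|exists (Num.sqrt (nsq r))].
- split; first exact: L2_intg.
  move=> n.
  rewrite (_ : (fun x => _) = fun x => 1 * zc x ^+ n.+1 - Si x * q x * zc x ^+ n.+1); last first.
    by apply/funext => x; rewrite kE; ring.
  rewrite cintB//; [|exact/cintegrableMzX/cintegrable_cst|exact: cintegrableMzX].
  by rewrite Siq subr0 (analytic1 R).2.
- by rewrite nrw andbT (le_trans _ nrk)// -subr_ge0 -nk1 nsq_ge0.
- by rewrite nk1 lerD2r (le_trans nrk).
Qed.

End outer.

(** * Gauge norms *)

(** Rounding a bounded function down to multiples of [e]. *)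
Lemma nnsfun_uniform_approx d (T : measurableType d) (R : realType) (h : T -> R) (M e : R) :
  measurable_fun setT h -> (forall x, 0 <= h x <= M) -> 0 < e ->
  exists s : {nnsfun T >-> R}, forall x, s x <= h x <= s x + e.
Proof.
move=> mh hM e0.
have mA n : measurable [set x | n.+1%:R * e <= h x].
  have := mh measurableT _ (measurable_itv `[n.+1%:R * e, +oo[).
  rewrite setTI; congr measurable.
  by apply/seteqP; split=> x /=; rewrite in_itv/= andbT.
pose s N := sum_nnsfun (fun i => scale_nnsfun (indic_nnsfun R (mA i)) (ltW e0)) N.
have sE N x : s N.+1 x = s N x + e * (N.+1%:R * e <= h x)%R%:R.
  rewrite /s !sum_nnsfunE big_ord_recr /=; congr (_ + e * _).
  by rewrite mindicE; congr (_%:R); congr nat_of_bool; apply/idP/idP; rewrite inE.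
have H N x : if N%:R * e <= h x then s N x = N%:R * e else s N x <= h x <= s N x + e.
  elim: N => [|N]; rewrite ?sE.
    by rewrite mul0r; have /andP[-> _] := hM x; rewrite /s sum_nnsfunE big_ord0.
  have NS : N.+1%:R * e = N%:R * e + e by rewrite -natr1 mulrDl mul1r.
  have [le|gt] := leP (N.+1%:R * e) (h x).
    have -> : N%:R * e <= h x by apply: le_trans le; rewrite NS lerDl ltW.
    by move=> ->; rewrite mulr1 NS.
  rewrite mulr0 addr0; case: ifP => // le -> //.
  by rewrite le/= -NS ltW.
have [N NM] : exists N : nat, M < N%:R * e.
  have [N _ HN] := near_infty_natSinv_lt (PosNum (divr_gt0 e0 (ltr_wpDl (normr_ge0 M) (@ltr01 R)))).
  exists N.+1; have /= := HN N (leqnn N).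
  rewrite ltr_pdivlMr ?(ltr_wpDl (normr_ge0 M) (@ltr01 R))// mulrC ltr_pdivrMr ?ltr0n//.
  rewrite mulrC => lt; apply: le_lt_trans lt.
  by have := ler_norm M; lra.
exists (s N) => x; have := H N x; case: ifP => // le.
by have /andP[_ /(le_trans le)] := hM x; rewrite leNgt NM.
Qed.

Section gauge.
Variables (R : realType) (alpha : (circle R -> R[i]) -> R).
Hypothesis halpha : dominating_gauge_norm alpha.
Local Notation m := (arc_measure R).
Local Notation zc := (@zcoord R).
Local Notation mT := (@measurableT _ (circle R)).
Implicit Types (f g h u : circle R -> R[i]).
Local Notation intg := (cintegrable m setT).
Local Notation ext := (gauge_ext alpha).

Lemma gauge_rotate f u : Linfty f -> Linfty u -> (forall x, normc (u x) = 1) ->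
  alpha (fun x => u x * f x) = alpha f.
Proof.
move=> Lf Lu u1; rewrite -(gauge_abs halpha (LinftyM Lu Lf)) -(gauge_abs halpha Lf).
by congr alpha; apply/funext => x; rewrite !normrE normcM u1 mul1r.
Qed.

(** A real factor [t] in [[0, 1]] is the mean of the unimodular functions
   [t +- i * sqrt (1 - t ^ 2)]. *)
Lemma gauge_contract f (t : circle R -> R) : Linfty f -> measurable_fun setT t ->
  (forall x, 0 <= t x <= 1) -> alpha (fun x => (t x)%:C * f x) <= alpha f.
Proof.
move=> Lf mt t01.
pose s x := Num.sqrt (1 - t x ^+ 2).
have ms : measurable_fun setT s.
  apply: (measurableT_comp (continuous_measurable_fun (@sqrt_continuous R))).
  by apply: measurable_funB => //; exact: measurable_funX.
pose u x : R[i] := t x +i* s x.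
have mu : cmeas setT u by split.
have u1 x : normc (u x) = 1.
  have /andP[t0 t1] := t01 x.
  rewrite /u /normc /s sqr_sqrtr ?subr_ge0 ?expr_le1//.
  by rewrite addrC subrK sqrtr1.
have Lu : Linfty u by apply: (Linfty_bounded mu (M := 1)) => x; rewrite u1.
have Luc := Linfty_conj Lu.
have E : (fun x => (t x)%:C * f x) = fun x => 2^-1 * (u x * f x + conjc (u x) * f x).
  apply/funext => x; rewrite -mulrDl mulrA; congr (_ * _).
  have -> : u x + conjc (u x) = 2 * (t x)%:C.
    rewrite mulr_natl mulr2n; apply: complex_ext; rewrite ?ReD ?ImD /=; ring.
  by rewrite mulKf// pnatr_eq0.
have LD := LinftyD (LinftyM Lu Lf) (LinftyM Luc Lf).
rewrite E (gauge_scale halpha _ LD).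
have -> : normc (2^-1 : R[i]) = 2^-1.
  rewrite normcV -[X in normc X](rmorph_nat (real_complex R) 2).
  by rewrite normc_real ger0_norm.
have := gauge_triangle halpha (LinftyM Lu Lf) (LinftyM Luc Lf).
rewrite !gauge_rotate//; last by move=> x; rewrite normc_conj.
by rewrite /GRing.add_fun; move: (alpha _) (alpha f); clear => a b; lra.
Qed.

(** Up to null sets, [|f|] is [t * |g|] for some [t] with values in [0, 1]. *)
Lemma gauge_mono f g : Linfty f -> Linfty g ->
  {ae m, forall x, normc (f x) <= normc (g x)} -> alpha f <= alpha g.
Proof.
move=> Lf Lg fg.
pose t x := Num.min 1 (normc (f x) * (normc (g x))^-1).
have mnf := cmeas_normc (Linfty_cmeas Lf); have mng := cmeas_normc (Linfty_cmeas Lg).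
have mt : measurable_fun setT t.
  apply: measurable_minr => //; apply: measurable_funM => //.
  by apply: measurable_inv => // x; exact: normc_ge0.
have t01 x : 0 <= t x <= 1.
  by rewrite /t le_min ler01 mulr_ge0 ?invr_ge0 ?normc_ge0//= ge_min lexx.
have Ltg : Linfty (fun x => (t x)%:C * g x).
  apply: LinftyM => //; apply: (Linfty_bounded (M := 1)); first exact: cmeas_real.
  by move=> x; have /andP[t0 t1] := t01 x; rewrite normc_real ger0_norm.
have Labs h : Linfty h -> Linfty (fun x => (normc (h x))%:C).
  move=> [mh [M hM]]; split; first exact/cmeas_real/cmeas_normc.
  by exists M; apply: filterS hM => x; rewrite normc_real ger0_norm ?normc_ge0.
have absE h : Linfty h -> alpha (fun x => (normc (h x))%:C) = alpha h.
  by move=> Lh; rewrite -(gauge_abs halpha Lh); congr alpha; apply/funext => x; rewrite normrE.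
apply: le_trans (gauge_contract Lg mt t01).
rewrite -(absE f)// -(absE _ Ltg).
rewrite (gauge_ae halpha (Labs _ Lf) (Labs _ Ltg))//.
apply: filterS fg => x fgx; congr (_%:C).
have /andP[t0 t1] := t01 x.
rewrite normcM normc_real ger0_norm// /t.
have [g0|gn0] := eqVneq (normc (g x)) 0.
  by rewrite g0 mulr0; apply/eqP; rewrite eq_le normc_ge0 andbT -g0.
have gp : 0 < normc (g x) by rewrite lt_def gn0 normc_ge0.
by rewrite min_r ?divfK// ler_pdivrMr// mul1r.
Qed.

Lemma Linfty_nnsfun (s : {nnsfun circle R >-> R}) : Linfty (fun x => (s x)%:C).
Proof.
have [M [_ HM]] := simple_bounded s.
split; first exact: cmeas_real.
exists (M + 1); apply: aeW => x; rewrite normc_real.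
by apply: HM => //; rewrite ltrDl.
Qed.

Lemma gauge_ext_le f : Linfty f -> (ext f <= (alpha f)%:E)%E.
Proof.
move=> Lf; apply: ge_ereal_sup => _ [s sf <-]; rewrite lee_fin.
apply: gauge_mono => //; first exact: Linfty_nnsfun.
by apply: aeW => x; rewrite normc_real ger0_norm.
Qed.

(** A bounded function is within [e] of a simple function below it, and constants have
   their modulus for norm. *)
Lemma gauge_le_ext f : Linfty f -> ((alpha f)%:E <= ext f)%E.
Proof.
move=> Lf; have [mf [M fM]] := Lf; have mnf := cmeas_normc mf.
apply/lee_addgt0Pr => e e0.
pose h x := Num.min (normc (f x)) M.
have mh : measurable_fun setT h by exact: measurable_minr.
pose h' x := Num.max 0 (h x).
have mh' : measurable_fun setT h' by exact: measurable_maxr.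
have hM x : 0 <= h' x <= Num.max 0 M.
  rewrite /h' le_max lexx/= ge_max le_max lexx/= le_max; apply/orP; right.
  by rewrite /h ge_min lexx orbT.
have hf x : h' x <= normc (f x) by rewrite /h' ge_max normc_ge0 /h ge_min lexx.
have [s sh] := nnsfun_uniform_approx mh' hM e0.
have Lse : Linfty (fun x => (s x)%:C + e%:C).
  by apply: LinftyD; [exact: Linfty_nnsfun|exact: Linfty_cst].
apply: (@le_trans _ _ (alpha (fun x => (s x)%:C + e%:C))%:E).
  rewrite lee_fin; apply: gauge_mono => //.
  apply: filterS fM => x fx; have /andP[_ +] := sh x.
  have -> : h' x = normc (f x) by rewrite /h' /h min_l// max_r// normc_ge0.
  rewrite -rmorphD /= normc_real; move=> H; apply: (le_trans H); exact: ler_norm.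
apply: (@le_trans _ _ ((alpha (fun x => (s x)%:C))%:E + e%:E)%E).
  rewrite -EFinD lee_fin.
  apply: (le_trans (gauge_triangle halpha (Linfty_nnsfun s) (Linfty_cst e%:C))).
  rewrite lerD2l.
  have := gauge_scale halpha e%:C (Linfty_cst 1); rewrite (gauge_one halpha).
  under [X in alpha X]eq_fun do rewrite mulr1.
  by move=> ->; rewrite mulr1 normc_real ger0_norm// ltW.
rewrite leeD2r//; apply: ereal_sup_ubound; exists s => // x.
by apply: le_trans (hf x); case/andP: (sh x).
Qed.

(** Cutting a simple function down to the set where [|f| <= |g|]. *)
Lemma gauge_ext_mono f g : cmeas setT f -> cmeas setT g ->
  {ae m, forall x, normc (f x) <= normc (g x)} -> (ext f <= ext g)%E.
Proof.
move=> mf mg fg; apply: ge_ereal_sup => _ [s sf <-].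
pose A := [set x | normc (f x) <= normc (g x)].
have mA : measurable A.
  by rewrite -[A]setTI; apply: measurable_fun_le => //; exact: cmeas_normc.
pose s' := proj_nnsfun s mA.
have s'E x : s' x = s x * (x \in A)%:R by rewrite /s' /proj_nnsfun/= mindicE.
rewrite (_ : alpha _ = alpha (fun x => (s' x)%:C)).
  apply: ereal_sup_ubound; exists s' => // x; rewrite s'E.
  case: (boolP (x \in A)) => [|_]; last by rewrite mulr0 normc_ge0.
  by rewrite inE mulr1 => fgx; exact: le_trans (sf x) fgx.
apply: (gauge_ae halpha); [exact: Linfty_nnsfun|exact: Linfty_nnsfun|].
by apply: filterS fg => x fgx; rewrite s'E mem_set// mulr1.
Qed.

(** A simple [s <= |f + g|] is split in proportion to [|f|] and [|g|]; the two pieces are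
   bounded but not simple any more, which is where [gauge_le_ext] is used. *)
Lemma gauge_extD f g : cmeas setT f -> cmeas setT g ->
  (ext (fun x => f x + g x)%R <= ext f + ext g)%E.
Proof.
move=> mf mg; apply: ge_ereal_sup => _ [s sf <-].
pose b x := normc (f x) + normc (g x).
have mnf := cmeas_normc mf; have mng := cmeas_normc mg.
have b0 x : 0 <= b x by rewrite addr_ge0 ?normc_ge0.
have mb : measurable_fun setT (fun x => (b x)^-1).
  by apply: measurable_inv => //; exact: measurable_funD.
pose p h x := s x * (normc (h x) * (b x)^-1).
have pE x : s x = p f x + p g x.
  rewrite /p -mulrDr -mulrDl -/(b x).
  have [bx0|bn0] := eqVneq (b x) 0; last by rewrite divff// mulr1.
  have : s x <= 0 by rewrite -bx0 (le_trans (sf x))// normcD.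
  by rewrite bx0 mul0r mulr0 => s0; apply/eqP; rewrite eq_le s0 fun_ge0.
have ple h : measurable_fun setT (fun x => normc (h x)) ->
    (forall x, normc (h x) <= b x) ->
    Linfty (fun x => (p h x)%:C) /\ (forall x, normc (p h x)%:C <= normc (h x)).
  move=> mh hb.
  have p0 x : 0 <= p h x by rewrite mulr_ge0// mulr_ge0 ?invr_ge0 ?normc_ge0.
  have sb x : s x <= b x by rewrite (le_trans (sf x))// normcD.
  split; last first.
    move=> x; rewrite normc_real ger0_norm// /p mulrCA.
    rewrite ler_piMr ?normc_ge0//.
    have [bx0|bn0] := eqVneq (b x) 0; first by rewrite bx0 invr0 mulr0.
    by rewrite ler_pdivrMr ?mul1r// lt_def bn0 b0.
  have [_ [M sM]] := Linfty_nnsfun s.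
  split; first by apply: cmeas_real; do 2 apply: measurable_funM => //.
  exists M; apply: filterS sM => x; rewrite !normc_real !ger0_norm// => /(le_trans _); apply.
  rewrite /p ler_piMr//.
  have [bx0|bn0] := eqVneq (b x) 0; first by rewrite bx0 invr0 mulr0.
  by rewrite ler_pdivrMr ?mul1r// lt_def bn0 b0.
have [Lpf pf] : Linfty _ /\ _ := ple f mnf (fun x => ler_wpDr (normc_ge0 (g x)) (lexx _)).
have [Lpg pg] : Linfty _ /\ _ := ple g mng (fun x => ler_wpDl (normc_ge0 (f x)) (lexx _)).
rewrite (_ : (fun x => (s x)%:C) = fun x => (p f x)%:C + (p g x)%:C); last first.
  by apply/funext => x; rewrite pE rmorphD.
apply: (@le_trans _ _ ((alpha (fun x => (p f x)%:C))%:E + (alpha (fun x => (p g x)%:C))%:E)%E).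
  by rewrite -EFinD lee_fin; exact: (gauge_triangle halpha).
apply: leeD.
- apply: (le_trans (gauge_le_ext Lpf)); apply: gauge_ext_mono => //; first exact: Linfty_cmeas.
  exact: aeW.
- apply: (le_trans (gauge_le_ext Lpg)); apply: gauge_ext_mono => //; first exact: Linfty_cmeas.
  exact: aeW.
Qed.

Lemma gauge_extM f u (C : R) : cmeas setT f -> cmeas setT u -> 0 < C ->
  {ae m, forall x, normc (u x) <= C} -> (ext (fun x => u x * f x)%R <= C%:E * ext f)%E.
Proof.
move=> mf mu C0 uC.
apply: (@le_trans _ _ (ext (fun x => C%:C * f x))).
  apply: gauge_ext_mono; [exact: cmeasM|by apply: cmeasM => //; exact: cmeas_cst|].
  apply: filterS uC => x ux; rewrite !normcM normc_real ger0_norm ?(ltW C0)//.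
  by rewrite ler_wpM2r ?normc_ge0.
apply: ge_ereal_sup => _ [s sf <-].
have Ci : 0 <= C^-1 by rewrite invr_ge0 ltW.
pose s' := scale_nnsfun s Ci.
have s'E x : s' x = C^-1 * s x by [].
have -> : (alpha (fun x => (s x)%:C))%:E = (C%:E * (alpha (fun x => (s' x)%:C))%:E)%E.
  have -> : (fun x => (s x)%:C) = fun x => C%:C * (s' x)%:C.
    by apply/funext => x; rewrite s'E -rmorphM/= mulrA divff ?gt_eqF// mul1r.
  by rewrite (gauge_scale halpha _ (Linfty_nnsfun s')) EFinM normc_real ger0_norm// ltW.
apply: lee_wpmul2l; first by rewrite lee_fin ltW.
apply: ereal_sup_ubound; exists s' => // x; rewrite s'E ler_pdivrMl//.
by have := sf x; rewrite normcM normc_real ger0_norm// ltW.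
Qed.

(** Both sides are suprema over the simple functions below [|f|]. *)
Lemma norm1_le_ext f : cmeas setT f -> (norm1 f <= ext f)%E.
Proof.
move=> mf; rewrite /norm1 ge0_integralTE; last by move=> x; rewrite lee_fin normc_ge0.
apply: ge_ereal_sup => _ [s sf <-].
apply: (@le_trans _ _ (alpha (fun x => (s x)%:C))%:E).
  apply: le_trans (gauge_dom halpha (Linfty_nnsfun s)).
  rewrite -integralT_nnsfun; apply: ge0_le_integral => //.
  - by move=> x _; rewrite lee_fin.
  - exact/measurable_EFinP.
  - by apply/measurable_EFinP; apply: cmeas_normc; exact: cmeas_real.
  - by move=> x _; rewrite lee_fin normc_real ler_norm.
apply: ereal_sup_ubound; exists s => // x; have := sf x; by rewrite lee_fin.
Qed.

Lemma scrL_intg f : scrL alpha f -> intg f.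
Proof.
move=> [mf ffin]; apply: (cintegrable_normcE mT mf); apply/integrableP; split.
  by apply/measurable_EFinP; exact: cmeas_normc.
apply: le_lt_trans ffin; apply: le_trans (norm1_le_ext mf).
apply: ge0_le_integral => //.
- by apply/measurable_EFinP; apply: measurableT_comp => //; exact: cmeas_normc.
- by apply/measurable_EFinP; exact: cmeas_normc.
- by move=> x _; rewrite lee_fin ger0_norm// normc_ge0.
Qed.

Lemma Linfty_scrL f : Linfty f -> scrL alpha f.
Proof.
move=> Lf; split; first exact: Linfty_cmeas.
by apply: (le_lt_trans (gauge_ext_le Lf)); rewrite ltry.
Qed.

Lemma scrLM f u : scrL alpha f -> Linfty u -> scrL alpha (fun x => u x * f x).
Proof.
move=> [mf ffin] [mu [M uM]]; split; first exact: cmeasM.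
have C0 : 0 < `|M| + 1 by rewrite ltr_wpDl.
have uC : {ae m, forall x, normc (u x) <= `|M| + 1}.
  by apply: filterS uM => x ux; have := ler_norm M; lra.
apply: (le_lt_trans (gauge_extM mf mu C0 uC)).
by rewrite lte_mul_pinfty ?lee_fin ?ltW.
Qed.

Lemma gauge_ext_eq0 f : cmeas setT f -> (forall e : R, 0 < e -> (ext f < e%:E)%E) ->
  {ae m, forall x, f x = 0}.
Proof.
move=> mf fe.
have h : norm1 f = 0%E.
  apply/eqP; rewrite eq_le integral_ge0 ?andbT => [|x _]; last by rewrite lee_fin normc_ge0.
  apply/lee_addgt0Pr => e e0; rewrite add0e.
  by apply: (le_trans (norm1_le_ext mf)); exact/ltW/fe.
have mn : measurable_fun setT (fun x => (normc (f x))%:E) by apply/measurable_EFinP; exact: cmeas_normc.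
have /(ae_eq_integral_abs m mT mn) : (\int[m]_x `|(normc (f x))%:E| = 0)%E.
  by rewrite -[RHS]h; apply: eq_integral => x _; rewrite gee0_abs// lee_fin normc_ge0.
by apply: filterS => x /(_ I)[] /normc_eq0.
Qed.

Section closure.
Variable S : set (circle R -> R[i]).
Local Notation cl := (gauge_closure alpha).

Lemma sub_gauge_closure : S `<=` scrL alpha -> S `<=` cl S.
Proof.
move=> SL f Sf; split; first exact: SL.
move=> e e0; exists f => //.
apply: (le_lt_trans (y := 0)%E); last by rewrite lte_fin.
apply: (@le_trans _ _ (ext (fun=> 0))).
  apply: gauge_ext_mono; [|exact: cmeas_cst|].
    by have [mf _] := SL f Sf; exact: cmeasB.
  by apply: aeW => x; rewrite /= subrr.
apply: (le_trans (gauge_ext_le (Linfty_cst 0))); rewrite lee_fin.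
have := gauge_scale halpha 0 (Linfty_cst 0).
by under [X in alpha X]eq_fun do rewrite mul0r; move=> ->; rewrite normc0 mul0r.
Qed.

Lemma gauge_closureM (S' : set (circle R -> R[i])) u f : S `<=` cmeas setT -> Linfty u ->
  (forall g, S g -> S' (fun x => u x * g x)) -> cl S f -> cl S' (fun x => u x * f x).
Proof.
move=> Sm Lu uS [Lf fS]; split; first exact: scrLM.
have [mu [M uM]] := Lu; have [mf _] := Lf.
have C0 : 0 < `|M| + 1 by rewrite ltr_wpDl.
have uC : {ae m, forall x, normc (u x) <= `|M| + 1}.
  by apply: filterS uM => x ux; have := ler_norm M; lra.
move=> e e0; have [g Sg fg] := fS _ (divr_gt0 e0 C0).
exists (fun x => u x * g x); first exact: uS.
have mg := Sm _ Sg.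
have -> : ((fun x => u x * f x) \- (fun x => u x * g x))%R = fun x => u x * (f x - g x).
  by apply/funext => x; rewrite /= mulrBr.
apply: (le_lt_trans (gauge_extM (cmeasB mf mg) mu C0 uC)).
have -> : e%:E = ((`|M| + 1)%:E * (e / (`|M| + 1))%:E)%E.
  by rewrite -EFinM mulrC divfK// gt_eqF.
by rewrite lte_pmul2l// lte_fin.
Qed.

End closure.

End gauge.

(** * Absolute continuity of a continuous gauge norm *)

Section absolute_continuity.
Variables (R : realType) (alpha : (circle R -> R[i]) -> R).
Hypothesis halpha : dominating_gauge_norm alpha.
Hypothesis hcont : continuous_gauge alpha.
Local Notation m := (arc_measure R).
Local Notation zc := (@zcoord R).
Local Notation mT := (@measurableT _ (circle R)).
Implicit Types (f g h u : circle R -> R[i]).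
Local Notation intg := (cintegrable m setT).
Local Notation ext := (gauge_ext alpha).

Lemma char_funE (E : set (circle R)) x : char_fun E x = (\1_E x : R)%:C.
Proof. by rewrite /char_fun !indicE; case: (x \in E). Qed.

Lemma normc_char_fun (E : set (circle R)) x : normc (char_fun E x) = \1_E x.
Proof. by rewrite char_funE normc_real ger0_norm ?indicE. Qed.

Lemma char_fun_Linfty (E : set (circle R)) : measurable E -> Linfty (char_fun E).
Proof.
move=> mE; apply: (Linfty_bounded (M := 1)).
  rewrite (_ : char_fun E = fun x => (\1_E x : R)%:C); last by apply/funext => x; exact: char_funE.
  exact/cmeas_real/measurable_indic.
by move=> x; rewrite normc_char_fun indicE; case: (x \in E).
Qed.

Lemma gauge_cst (c : R) : 0 <= c -> alpha (fun=> c%:C) = c.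
Proof.
move=> c0; have := gauge_scale halpha c%:C (Linfty_cst 1); rewrite (gauge_one halpha).
under [X in alpha X]eq_fun do rewrite mulr1.
by move=> ->; rewrite mulr1 normc_real ger0_norm.
Qed.

Lemma gauge_char_small (e : R) : 0 < e -> exists2 d : R, 0 < d &
  forall E, measurable E -> (m E < d%:E)%E -> alpha (char_fun E) < e.
Proof.
move=> e0; have [d d0 Hd] := hcont e0; exists d => // E mE Ed.
have [E0|E0] := eqVneq (m E) 0%E; last by apply: Hd => //; rewrite lt0e E0 measure_ge0.
rewrite (gauge_ae halpha (char_fun_Linfty mE) (Linfty_cst 0)) ?gauge_cst//.
exists E; split => // x /= nx.
by apply: contrapT => xE; apply: nx; rewrite char_funE indicE memNset.
Qed.

(** Chebyshev: [|u| <= e / 2] off the set where [|u| > e / 2], which has small measure. *)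
Lemma gauge_ext_small (C e : R) : 0 < C -> 0 < e -> exists2 d : R, 0 < d &
  forall u, cmeas setT u -> {ae m, forall x, normc (u x) <= C} ->
    \int[m]_x normc (u x) < d -> (ext u < e%:E)%E.
Proof.
move=> C0 e0.
have e20 : 0 < e / 2 by rewrite divr_gt0.
have [d d0 Hd] := gauge_char_small (divr_gt0 e20 C0).
exists (e / 2 * d); first by rewrite mulr_gt0.
move=> u mu uC ud; have mn := cmeas_normc mu.
pose E := [set x | e / 2 <= normc (u x)].
have mE : measurable E.
  by rewrite -[E]setTI; apply: measurable_fun_le => //; exact: measurable_cst.
have iu : intg u by exact: arc_cintegrable_bounded uC.
have Lu : Linfty u by split => //; exists C.
have LE := char_fun_Linfty mE.
have mEd : (m E < d%:E)%E.
  have fE : m E \is a fin_num by exact: fin_num_measure.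
  rewrite -(fineK fE) lte_fin -(ltr_pM2l e20).
  apply: le_lt_trans ud.
  have -> : e / 2 * fine (m E) = \int[m]_x (e / 2 * \1_E x).
    rewrite RintegralZl//; last first.
      by apply: (integrable_indic _ mE) => //; rewrite ltey_eq fE.
    by rewrite /Rintegral integral_indic// setIT.
  apply: le_Rintegral => //.
  - apply: (rintegrableZ mT); apply: (integrable_indic _ mE) => //; by rewrite ltey_eq fE.
  - exact: (cintegrable_normc mT).
  - move=> x _; rewrite indicE; case: (boolP (x \in E)) => [|_]; last by rewrite mulr0 normc_ge0.
    by rewrite inE mulr1.
have LC : Linfty (fun x => C%:C * char_fun E x) by apply: LinftyM => //; exact: Linfty_cst.
have LD : Linfty (fun x => (e / 2)%:C + C%:C * char_fun E x).
  by apply: LinftyD => //; exact: Linfty_cst.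
apply: (le_lt_trans (gauge_ext_le halpha Lu)); rewrite lte_fin.
apply: (@le_lt_trans _ _ (alpha (fun x => (e / 2)%:C + C%:C * char_fun E x))).
  apply: (gauge_mono halpha) => //; apply: filterS uC => x uC.
  rewrite char_funE -rmorphM -rmorphD /= normc_real; apply: le_trans (ler_norm _).
  rewrite indicE; case: (boolP (x \in E)) => xE.
    by rewrite mulr1 (le_trans uC)// lerDr ltW.
  by rewrite mulr0 addr0 leNgt; apply: contra xE => /ltW; rewrite inE.
apply: (le_lt_trans (gauge_triangle halpha (Linfty_cst _) LC)).
rewrite (gauge_cst (ltW e20)) (gauge_scale halpha _ LE) normc_real (ger0_norm (ltW C0)).
have := Hd E mE mEd; rewrite ltr_pdivlMr// mulrC.
by move: (C * _) => a; lra.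
Qed.

Lemma gauge_closure_cmeas S f : gauge_closure alpha S f -> cmeas setT f.
Proof. by case=> -[]. Qed.

(** Approximate [f] by a bounded [g]: the multiplier [u] is bounded on [f - g] and small
   on [g]. *)
Lemma Lgauge_small f (C e : R) : Lgauge alpha f -> 0 < C -> 0 < e ->
  exists2 d : R, 0 < d & forall u, cmeas setT u -> {ae m, forall x, normc (u x) <= C} ->
    \int[m]_x normc (u x) < d -> (ext (fun x => u x * f x)%R < e%:E)%E.
Proof.
move=> Lf C0 e0; have mf := gauge_closure_cmeas Lf; case: Lf => _ fL.
have e20 : 0 < e / 2 by rewrite divr_gt0.
have [g Lg fg] := fL _ (divr_gt0 e20 C0).
have [mg [M gM]] := Lg.
pose N := `|M| + 1; have N0 : 0 < N by rewrite ltr_wpDl.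
have gN : {ae m, forall x, normc (g x) <= N}.
  by apply: filterS gM => x gx; rewrite /N; have := ler_norm M; lra.
have [d d0 Hd] := gauge_ext_small (mulr_gt0 C0 N0) e20.
exists (d / N); first by rewrite divr_gt0.
move=> u mu uC ud.
have mug : cmeas setT (fun x => u x * g x) by exact: cmeasM.
have ugC : {ae m, forall x, normc (u x * g x) <= C * N}.
  by apply: filterS2 uC gN => x ux gx; rewrite normcM ler_pM ?normc_ge0.
have iu : intg u by exact: arc_cintegrable_bounded uC.
have iug : intg (fun x => u x * g x) by exact: arc_cintegrable_bounded ugC.
have ugd : \int[m]_x normc (u x * g x) < d.
  apply: (@le_lt_trans _ _ (N * \int[m]_x normc (u x))); last by rewrite -ltr_pdivlMl// mulrC.
  have iun := cintegrable_normc mT iu.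
  rewrite -RintegralZl//; apply: (ae_le_Rintegral mT).
  - exact: (cintegrable_normc mT).
  - exact: (rintegrableZ mT).
  - by apply: filterS gN => x gx _; rewrite normcM mulrC ler_wpM2r ?normc_ge0.
have -> : (fun x => u x * f x) = fun x => u x * (f x - g x) + u x * g x.
  by apply/funext => x; rewrite mulrBr subrK.
have mfg : cmeas setT (fun x => f x - g x) by exact: cmeasB.
apply: (le_lt_trans (gauge_extD halpha (cmeasM mu mfg) mug)).
have -> : e%:E = ((e / 2)%:E + (e / 2)%:E)%E by rewrite -EFinD -splitr.
apply: lteD; last exact: Hd.
apply: (le_lt_trans (gauge_extM halpha mfg mu C0 uC)).
have -> : (e / 2)%:E = (C%:E * (e / 2 / C)%:E)%E.
  by rewrite -EFinM mulrCA divff ?mulr1// gt_eqF.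
by rewrite lte_pmul2l// lte_fin.
Qed.

Lemma Linfty_Lgauge f : Linfty f -> Lgauge alpha f.
Proof. exact: (sub_gauge_closure halpha (@Linfty_scrL _ _ halpha)). Qed.

Lemma gauge_closure_intg S f : gauge_closure alpha S f -> intg f.
Proof. by move=> [Lf _]; exact: (scrL_intg halpha Lf). Qed.

Lemma LgaugeM u f : Linfty u -> Lgauge alpha f -> Lgauge alpha (fun x => u x * f x).
Proof.
move=> Lu; apply: (gauge_closureM halpha) => //; first by move=> g; exact: Linfty_cmeas.
by move=> g; exact: LinftyM.
Qed.

Lemma Hinfty_Linfty f : Hinfty f -> Linfty f. Proof. by case. Qed.

Lemma Hinfty_cmeas f : Hinfty f -> cmeas setT f.
Proof. by move=> /Hinfty_Linfty/Linfty_cmeas. Qed.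

Lemma Hgauge_Lgauge f : Hgauge alpha f -> Lgauge alpha f.
Proof.
move=> [Lf fH]; split => // e e0; have [g Hg fg] := fH e e0.
by exists g => //; exact: Hinfty_Linfty.
Qed.

(** The Fourier coefficients are continuous for the gauge norm, because it dominates
   the [L1] norm. *)
Lemma Hgauge_analytic f : Hgauge alpha f -> analytic f.
Proof.
move=> Hf; have intf := gauge_closure_intg Hf; have mf := cintegrable_cmeas intf.
split => // n; case: Hf => _ fH.
apply: normc_eq0; apply/eqP; rewrite eq_le normc_ge0 andbT; apply/ler_addgt0Pr => e e0.
rewrite add0r; have [g Hg fg] := fH e e0.
have [ig g0] := Hinfty_analytic Hg; have mg := Hinfty_cmeas Hg.
have ifg : intg (fun x => f x - g x) by exact: (cintegrableB mT).
have -> : cint m setT (fun y => f y * zc y ^+ n.+1) =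
    cint m setT (fun y => (f y - g y) * zc y ^+ n.+1).
  rewrite -[LHS]subr0 -(g0 n) -(cintB mT); [|exact: cintegrableMzX|exact: cintegrableMzX].
  by apply: eq_cint => y _; rewrite mulrBl.
apply: (le_trans (normc_cint_le mT (cintegrableMzX _ ifg))).
have -> : \int[m]_x normc ((f x - g x) * zc x ^+ n.+1) = \int[m]_x normc (f x - g x).
  by apply: eq_Rintegral => x _; rewrite normcM normc_zcX mulr1.
rewrite -lee_fin; apply: ltW; apply: le_lt_trans fg.
apply: le_trans (norm1_le_ext halpha (cmeasB mf mg)).
rewrite /Rintegral fineK//.
by apply: integrable_fin_num => //; exact: (cintegrable_normc mT ifg).
Qed.

End absolute_continuity.

(** * Invariant subspaces *)

Section invariant.
Variables (R : realType) (alpha : (circle R -> R[i]) -> R) (W : set (circle R -> R[i])).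
Hypothesis halpha : dominating_gauge_norm alpha.
Hypothesis hcont : continuous_gauge alpha.
Hypothesis hW : closed_subspace alpha W.
Hypothesis zW : mul_space (@zcoord R) W `<=` W.
Local Notation m := (arc_measure R).
Local Notation zc := (@zcoord R).
Local Notation mT := (@measurableT _ (circle R)).
Implicit Types (f g h u : circle R -> R[i]).
Local Notation intg := (cintegrable m setT).
Local Notation ext := (gauge_ext alpha).
Local Notation L2 := (L2 m).
Local Notation nsq := (nsq m).
Local Notation L2cl := (L2cl m).
Local Notation ip := (ip m).

Lemma W_Lgauge f : W f -> Lgauge alpha f. Proof. exact: subspace_sub hW _. Qed.

Lemma W_cmeas f : W f -> cmeas setT f.
Proof. by move=> /W_Lgauge/gauge_closure_cmeas. Qed.

Lemma W_mulz f : W f -> W (fun x => zc x * f x).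
Proof.
move=> Wf; apply: zW; split; first by apply: cmeasM; [exact: cmeas_zcoord|exact: W_cmeas].
by exists f => //; exact: aeW.
Qed.

Lemma W_mulzX f n : W f -> W (fun x => zc x ^+ n * f x).
Proof.
move=> Wf; elim: n => [|n ih]; first by under eq_fun do rewrite expr0 mul1r.
by under eq_fun do rewrite exprS -mulrA; exact: W_mulz.
Qed.

Lemma W_closed f : Lgauge alpha f ->
  (forall e : R, 0 < e -> exists2 g, W g & (ext (fun x => f x - g x)%R < e%:E)%E) -> W f.
Proof. by move=> Lf H; apply: (subspace_closed hW); split => //; split => //; case: Lf. Qed.

Lemma W_lincomb N (c : nat -> R[i]) (u : nat -> circle R -> R[i]) f :
  (forall i, W (fun x => u i x * f x)) -> W (fun x => (\sum_(i < N) c i * u i x) * f x).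
Proof.
move=> Wu; elim: N => [|N ih].
  under eq_fun do rewrite big_ord0 mul0r; exact: subspace_zero hW.
under eq_fun do rewrite big_ord_recr/= mulrDl -mulrA.
by apply: (subspace_add hW); [exact: ih|exact: (subspace_scale hW)].
Qed.

(** Polynomials converge boundedly and in [L1] to [h], hence [p * f] converges to [h * f]
   for the gauge norm. *)
Lemma W_mul_Hinfty h f : Hinfty h -> W f -> W (fun x => h x * f x).
Proof.
move=> /HinftyE[Lh ah] Wf; have Lf := W_Lgauge Wf.
have [mh [M hM]] := Lh.
apply: W_closed; first exact: LgaugeM.
move=> e e0.
pose C := `|M| + (`|M| + 1); have C0 : 0 < C by have := normr_ge0 M; rewrite /C; lra.
have hM' : {ae m, forall x, normc (h x) <= `|M|}.
  by apply: filterS hM => x /le_trans; apply; exact: ler_norm.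
have [d d0 Hd] := Lgauge_small halpha hcont Lf C0 e0.
have [N [c [pM ph]]] := analytic_approx ah hM' d0.
exists (fun x => zpoly N c x * f x); first exact: (@W_lincomb N c (fun i x => zc x ^+ i) f (fun i => W_mulzX i Wf)).
have mp : cmeas setT (zpoly N c) by exact/Linfty_cmeas/(zpoly_analytic N c).1.
under eq_fun do rewrite -mulrBl; apply: Hd; first exact: cmeasB.
- by apply: filterS hM' => x hx; rewrite (le_trans (normcB _ _))// lerD.
- apply: le_lt_trans ph; apply: eq_lew; apply: eq_Rintegral => x _.
  by rewrite normc_distC.
Qed.

(** Multiplying by [k ^ 2], with [k] outer and [|k| ^ 2 = c / (1 + s * |f|)], truncates
   [f] without leaving [W]. *)
Lemma W_bounded_dense f (e : R) : W f -> 0 < e ->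
  exists g, [/\ W g, Linfty g & (ext (fun x => f x - g x)%R < e%:E)%E].
Proof.
move=> Wf e0; have Lf := W_Lgauge Wf; have iF := gauge_closure_intg halpha Lf.
have mf := W_cmeas Wf; have inf := cintegrable_normc mT iF.
pose I := \int[m]_x normc (f x).
have I0 : 0 <= I by apply: Rintegral_ge0 => x _; exact: normc_ge0.
pose K := 2 + I; have K0 : 0 < K by rewrite /K; lra.
have C0 : 0 < 1 + K ^+ 2 by rewrite ltr_wpDr ?exprn_ge0// ltW.
have [d d0 Hd] := Lgauge_small halpha hcont Lf C0 e0.
pose dl := Num.min 1 ((d / (1 + K)) ^+ 2).
have K1 : 0 < 1 + K by lra.
have dl0 : 0 < dl by rewrite lt_min ltr01 exprn_gt0// divr_gt0.
pose s := dl / (I + 1); have s0 : 0 < s by rewrite divr_gt0//; lra.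
have sI : s * I < dl.
  by rewrite /s -mulrA gtr_pMr// mulrC ltr_pdivrMr ?mul1r ?ltrDl// ltr_wpDl.
pose w x := 1 + s * normc (f x).
have w1 x : 1 <= w x by rewrite lerDl mulr_ge0 ?normc_ge0// ltW.
have i1 : m.-integrable setT (EFin \o (fun=> 1)) by exact: finite_measure_integrable_cst.
have iw : m.-integrable setT (EFin \o w).
  by apply: (rintegrableD mT) => //; exact: (rintegrableZ mT).
have wI : \int[m]_x w x = 1 + s * I.
  rewrite RintegralD//; last exact: (rintegrableZ mT).
  rewrite RintegralZl// Rintegral_cst//; congr (_ + _).
  by rewrite mul1r; exact: (congr1 fine (@probability_setT _ _ _ m)).
have [k [c [Lk ak /andP[c1 cw] kc nk]]] := outer_function iw w1.
rewrite wI in cw nk.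
have dl1 : dl <= 1 by rewrite ge_min lexx.
have cK : c <= K.
  apply: (le_trans cw); rewrite /K -[2]/(1 + 1) -addrA lerD2l.
  by rewrite (le_trans (ltW sI))// (le_trans dl1)// lerDl.
have mk := Linfty_cmeas Lk.
have kK : {ae m, forall x, normc (k x) <= K}.
  apply: filterS kc => x kx.
  rewrite -(@ler_pXn2r _ 2) ?nnegrE ?normc_ge0 ?(ltW K0)//.
  apply: (@le_trans _ _ c).
    by rewrite -kx ler_peMr ?sqr_ge0.
  by rewrite (le_trans cK)// expr2 ler_peMr ?(ltW K0)// /K -[2]/(1 + 1) -addrA lerDl addr_ge0.
have Hk : Hinfty k by apply/HinftyE.
exists (fun x => k x * (k x * f x)); split.
- by do 2 apply: W_mul_Hinfty => //.
- split; first by do 2 apply: cmeasM => //.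
  exists (c / s); apply: filterS kc => x kx.
  rewrite mulrA normcM normcM -expr2 ler_pdivlMr// -mulrA (mulrC _ s).
  by rewrite -kx ler_wpM2l ?sqr_ge0// /w lerDr.
have -> : (fun x => f x - k x * (k x * f x)) = fun x => (1 - k x * k x) * f x.
  by apply/funext => x; ring.
have m1 : cmeas setT (fun _ : circle R => (1 : R[i])) by exact: cmeas_cst.
have L1k : L2 (fun x => k x - 1) by apply: L2B; [exact: Linfty_L2|exact/Linfty_L2/Linfty_cst].
have mu : cmeas setT (fun x => 1 - k x * k x) by apply: cmeasB => //; exact: cmeasM.
have uC : {ae m, forall x, normc (1 - k x * k x) <= 1 + K ^+ 2}.
  apply: filterS kK => x kx; rewrite (le_trans (normcB _ _))// normc1 lerD2l.
  by rewrite normcM -expr2 lerXn2r ?nnegrE ?normc_ge0 ?(ltW K0).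
apply: Hd => //.
have i1k := cintegrable_normc mT (L2_intg L1k).
apply: (@le_lt_trans _ _ ((1 + K) * \int[m]_x normc (k x - 1))).
  rewrite -RintegralZl//; apply: (ae_le_Rintegral mT).
  - by apply: (cintegrable_normc mT); exact: arc_cintegrable_bounded uC.
  - exact: (rintegrableZ mT).
  - apply: filterS kK => x kx _.
    rewrite (_ : 1 - k x * k x = - ((1 + k x) * (k x - 1))); last by ring.
    rewrite normcN normcM ler_wpM2r ?normc_ge0//.
    by rewrite (le_trans (normcD _ _))// normc1 lerD2l.
rewrite mulrC -ltr_pdivlMr//.
rewrite -(@ltr_pXn2r _ 2) ?nnegrE ?(ltW (divr_gt0 d0 K1))//; last first.
  by apply: Rintegral_ge0 => x _; exact: normc_ge0.
apply: (le_lt_trans (norm1_sq_le_nsq L1k)).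
apply: (le_lt_trans nk); rewrite addrC addKr.
by apply: (lt_le_trans sI); rewrite ge_min lexx orbT.
Qed.

(** Dense in [W] by [W_bounded_dense], and made of square-integrable functions. *)
Definition bddW := [set f | W f /\ Linfty f].

Lemma bddW_L2 : bddW `<=` L2. Proof. by move=> f [_ /Linfty_L2]. Qed.

Lemma bddW_set0 : bddW !=set0.
Proof. by exists (fun=> 0); split; [exact: subspace_zero hW|exact: Linfty_cst]. Qed.

Lemma bddW_add f g : bddW f -> bddW g -> bddW (fun x => f x + g x).
Proof. by move=> [Wf Lf] [Wg Lg]; split; [exact: (subspace_add hW)|exact: LinftyD]. Qed.

Lemma bddW_scale (c : R[i]) f : bddW f -> bddW (fun x => c * f x).
Proof.
move=> [Wf Lf]; split; first exact: (subspace_scale hW).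
by apply: LinftyM => //; exact: Linfty_cst.
Qed.

Lemma bddW_mulzX n f : bddW f -> bddW (fun x => zc x ^+ n * f x).
Proof.
move=> [Wf Lf]; split; first exact: W_mulzX.
by apply: LinftyM => //; exact: Linfty_zcX.
Qed.

(** If bounded [f] in [W] are [L2]-close to [g], then the products [k * f], with [k] outer
   and [|k| ^ 2 = c / (1 + |f - g| ^ 2)], are uniformly bounded and still close to [g]. *)
Lemma L2cl_bddW g : L2cl bddW g -> Linfty g -> W g.
Proof.
move=> [L2g gcl] Lg; have [mg [M gM]] := Lg.
apply: W_closed; first exact: Linfty_Lgauge.
move=> e e0.
pose G := `|M|; have G0 : 0 <= G by exact: normr_ge0.
have gG : {ae m, forall x, normc (g x) <= G}.
  by apply: filterS gM => x /le_trans; apply; exact: ler_norm.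
have C0 : 0 < G + 2 * (1 + G) by lra.
have [d d0 Hd] := gauge_ext_small halpha hcont C0 e0.
pose eta := Num.min 1 (d / (G + 3)).
have eta0 : 0 < eta by rewrite lt_min ltr01 divr_gt0//; lra.
have eta1 : eta <= 1 by rewrite ge_min lexx.
have etad : eta <= d / (G + 3) by rewrite ge_min lexx orbT.
have [f [Wf Lf] fe] := gcl _ (exprn_gt0 2 eta0).
have mf := Linfty_cmeas Lf.
have L2gf : L2 (fun x => g x - f x) by apply: L2B => //; exact: Linfty_L2.
pose w x := 1 + normc (g x - f x) ^+ 2.
have w1 x : 1 <= w x by rewrite lerDl sqr_ge0.
have i1 : m.-integrable setT (EFin \o (fun=> 1)) by exact: finite_measure_integrable_cst.
have igf : m.-integrable setT (EFin \o (fun x => normc (g x - f x) ^+ 2)) by case: L2gf.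
have iw : m.-integrable setT (EFin \o w) by exact: (rintegrableD mT).
have wI : \int[m]_x w x = 1 + nsq (fun x => g x - f x).
  rewrite RintegralD// Rintegral_cst//; congr (_ + _).
  by rewrite mul1r; exact: (congr1 fine (@probability_setT _ _ _ m)).
have [k [c [Lk ak /andP[c1 cw] kc nk]]] := outer_function iw w1.
rewrite wI in cw nk.
have eta2 : eta ^+ 2 <= 1 by rewrite expr_le1// ltW.
have c2 : c <= 2.
  by rewrite (le_trans cw)// -[2]/(1 + 1) lerD2l (le_trans (ltW fe)).
have mk := Linfty_cmeas Lk.
have k2 : {ae m, forall x, normc (k x) <= 2 /\ normc (k x) * normc (g x - f x) <= 2}.
  apply: filterS kc => x kx; have k0 := normc_ge0 (k x); have gf0 := normc_ge0 (g x - f x).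
  move: kx; rewrite /w; move: (normc (k x)) (normc (g x - f x)) k0 gf0 c2.
  by clear => a b a0 b0 c2 E; split; rewrite leNgt; apply/negP => ?; nra.
have Hk : Hinfty k by apply/HinftyE.
exists (fun x => k x * f x); first exact: W_mul_Hinfty.
have mgk : cmeas setT (fun x => g x - k x * f x) by apply: cmeasB => //; exact: cmeasM.
have gkE x : g x - k x * f x = (1 - k x) * g x + k x * (g x - f x) by ring.
have gkC : {ae m, forall x, normc (g x - k x * f x) <= G + 2 * (1 + G)}.
  apply: filterS2 k2 gG => x [ka kb] gx; rewrite gkE.
  apply: (le_trans (normcD _ _)); rewrite !normcM.
  have a1 : normc (1 - k x) <= 3 by rewrite (le_trans (normcB _ _))// normc1 -[3]/(1 + 2%:R) lerD2l.
  have : normc (1 - k x) * normc (g x) <= 3 * G by rewrite ler_pM ?normc_ge0.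
  by move: kb; clear; lra.
apply: Hd => //.
have L1k : L2 (fun x => k x - 1) by apply: L2B; [exact: Linfty_L2|exact/Linfty_L2/Linfty_cst].
have i1k := cintegrable_normc mT (L2_intg L1k).
have igfn := cintegrable_normc mT (L2_intg L2gf).
apply: (@le_lt_trans _ _ (\int[m]_x (G * normc (k x - 1) + 2 * normc (g x - f x)))).
  apply: (ae_le_Rintegral mT).
  - by apply: (cintegrable_normc mT); exact: arc_cintegrable_bounded gkC.
  - by apply: (rintegrableD mT); exact: (rintegrableZ mT).
  - apply: filterS2 k2 gG => x [ka kb] gx _; rewrite gkE.
    apply: (le_trans (normcD _ _)); rewrite !normcM (normc_distC 1) mulrC.
    by apply: lerD; apply: ler_wpM2r => //; exact: normc_ge0.
rewrite RintegralD//; [|exact: (rintegrableZ mT)|exact: (rintegrableZ mT)].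
rewrite !RintegralZl//.
have le1 : \int[m]_x normc (k x - 1) < eta.
  rewrite -(@ltr_pXn2r _ 2) ?nnegrE ?(ltW eta0)//; last first.
    by apply: Rintegral_ge0 => x _; exact: normc_ge0.
  apply: (le_lt_trans (norm1_sq_le_nsq L1k)).
  by apply: (le_lt_trans nk); rewrite addrC addKr.
have le2 : \int[m]_x normc (g x - f x) < eta.
  rewrite -(@ltr_pXn2r _ 2) ?nnegrE ?(ltW eta0)//; last first.
    by apply: Rintegral_ge0 => x _; exact: normc_ge0.
  exact: le_lt_trans (norm1_sq_le_nsq L2gf) fe.
have G3 : 0 < G + 3 by rewrite ltr_wpDl.
have le3 : eta * (G + 3) <= d by rewrite -ler_pdivlMr.
move: le1 le2 le3 eta0 G0; move: (Rintegral _ _ _) (Rintegral _ _ _).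
by clear => a b; nra.
Qed.

Local Notation M := bddW.
Local Notation zM := [set (fun x => zc x * f x) | f in M].

Lemma zM_L2 : zM `<=` L2.
Proof. by move=> _ [f Mf <-]; have /bddW_L2 := bddW_mulzX 1 Mf; under eq_fun do rewrite expr1. Qed.

Lemma zM_mulzX n f : M f -> zM (fun x => zc x ^+ n.+1 * f x).
Proof.
move=> Mf; exists (fun x => zc x ^+ n * f x); first exact: bddW_mulzX.
by apply/funext => x; rewrite exprS mulrA.
Qed.

(** A vector of the closure that is orthogonal to its shift has constant modulus: all the
   Fourier coefficients of [|phi| ^ 2] but the mean vanish. *)
Lemma wandering_unimodular phi : L2cl M phi -> (forall f, zM f -> ip phi f = 0) ->
  nsq phi != 0 ->
  exists psi, [/\ W psi, Linfty psi, {ae m, forall x, normc (psi x) = 1} &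
    forall f, zM f -> ip psi f = 0].
Proof.
move=> Np perp n0; have Lp := Np.1; have mp := L2_cmeas Lp.
pose a := Num.sqrt (nsq phi).
have np : 0 < nsq phi by rewrite lt_def n0 nsq_ge0.
have a0 : 0 < a by rewrite sqrtr_gt0.
have cst : {ae m, forall x, normc (phi x) ^+ 2 = nsq phi}.
  apply: real_coef0_cst; first by case: Lp.
  move=> n.
  have Lz : L2 (fun x => zc x ^+ n.+1 * phi x).
    by apply: L2_rotate => //; [exact: cmeas_zcX|move=> x; rewrite normc_zcX].
  have pz : ip phi (fun x => zc x ^+ n.+1 * phi x) = 0.
    apply: (ip_L2cl0 zM_L2) => //.
    apply: (L2cl_rotate bddW_L2 zM_L2 _ _ _ Np); [exact: cmeas_zcX|by move=> x; rewrite normc_zcX|].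
    by move=> h Mh; apply: (sub_L2cl zM_L2); exact: zM_mulzX.
  move/(congr1 conjc) : pz; rewrite conjc0 ip_conj// => <-.
  by apply: eq_cint => x _; rewrite -mul_conjc; ring.
pose psi x := (a^-1)%:C * phi x.
have psi1 : {ae m, forall x, normc (psi x) = 1}.
  apply: filterS cst => x px; rewrite normcM normc_real ger0_norm ?invr_ge0 ?(ltW a0)//.
  have -> : normc (phi x) = a by rewrite /a -px sqrtr_sqr ger0_norm ?normc_ge0.
  by rewrite mulVf// gt_eqF.
have Lpsi : Linfty psi.
  split; first by apply: cmeasM => //; exact: cmeas_cst.
  by exists 1; apply: filterS psi1 => x ->.
exists psi; split => //.
- by apply: L2cl_bddW => //; apply: L2clZ => //; [exact: bddW_L2|move=> c f; exact: bddW_scale].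
- by move=> f zf; rewrite ipZl// ?perp ?mulr0//; exact: zM_L2.
Qed.

(** Orthogonality says that [conj phi * f] is analytic for all bounded [f] in [W]; in the
   other direction [W] is stable under bounded analytic multipliers. *)
Lemma wandering_range phi : W phi -> Linfty phi -> {ae m, forall x, normc (phi x) = 1} ->
  (forall f, zM f -> ip phi f = 0) -> W = mul_space phi (Hgauge alpha).
Proof.
move=> Wp Lp p1 perp; have mp := Linfty_cmeas Lp; have Lcp := Linfty_conj Lp.
have mcp := Linfty_cmeas Lcp.
have pcp : {ae m, forall x, phi x * conjc (phi x) = 1}.
  by apply: filterS p1 => x px; rewrite mul_conjc px expr1n.
have p1' : {ae m, forall x, normc (phi x) <= 1} by apply: filterS p1 => x ->.
have cp1' : {ae m, forall x, normc (conjc (phi x)) <= 1}.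
  by apply: filterS p1 => x; rewrite normc_conj => ->.
have HM f : M f -> Hinfty (fun x => conjc (phi x) * f x).
  move=> Mf; have [_ Lf] := Mf; apply/HinftyE; split; first exact: LinftyM.
  split; first by apply: Linfty_intg; exact: LinftyM.
  move=> n; have := perp _ (zM_mulzX n Mf).
  have Lzf : L2 (fun x => zc x ^+ n.+1 * f x) by exact/bddW_L2/bddW_mulzX.
  move/(congr1 conjc); rewrite conjc0 ip_conj//; last exact: Linfty_L2.
  by move=> <-; apply: eq_cint => x _; ring.
apply/seteqP; split => [f Wf|f [mf [h Hh fh]]].
  have mf := W_cmeas Wf; split => //; exists (fun x => conjc (phi x) * f x); last first.
    by apply: filterS pcp => x px; rewrite /= mulrA px mul1r.
  have [Lf _] := W_Lgauge Wf.
  split; first exact: scrLM.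
  move=> e e0; have [g [Wg Lg fg]] := W_bounded_dense Wf e0.
  exists (fun x => conjc (phi x) * g x); first exact: HM.
  apply: le_lt_trans fg; have mg := Linfty_cmeas Lg.
  apply: (gauge_ext_mono halpha (cmeasB (cmeasM mcp mf) (cmeasM mcp mg)) (cmeasB mf mg)).
  by apply: filterS cp1' => x px; rewrite /= -mulrBr normcM ler_piMl ?normc_ge0.
have mh := gauge_closure_cmeas Hh.
apply: (subspace_ae hW (f := fun x => phi x * h x)) => //; last first.
  by apply: filterS fh => x ->.
apply: W_closed; first exact/LgaugeM/Hgauge_Lgauge.
move=> e e0; have [_ /(_ e e0)[g Hg hg]] := Hh; have mg := Hinfty_cmeas Hg.
exists (fun x => phi x * g x).
  by under eq_fun do rewrite mulrC; exact: W_mul_Hinfty.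
apply: le_lt_trans hg.
apply: (gauge_ext_mono halpha (cmeasB (cmeasM mp mh) (cmeasM mp mg)) (cmeasB mh mg)).
by apply: filterS p1' => x px; rewrite /= -mulrBr normcM ler_piMl ?normc_ge0.
Qed.

(** Without wandering vectors the closure of the bounded part reduces the shift; the
   projection of [1] onto it is then idempotent, hence an indicator function. *)
Lemma no_wandering_range :
  (forall phi, L2cl M phi -> (forall f, zM f -> ip phi f = 0) -> nsq phi = 0) ->
  exists2 E, measurable E & W = mul_space (char_fun E) (Lgauge alpha).
Proof.
move=> nowand; have ML := bddW_L2; have zML := zM_L2.
have MN := sub_L2cl ML.
have mz : cmeas setT zc by exact: cmeas_zcoord.
have mcz : cmeas setT (fun x => conjc (zc x)) by exact: cmeas_conj.
have z1 x : normc (zc x) = 1 by exact: normc_zcoord.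
have cz1 x : normc (conjc (zc x)) = 1 by rewrite normc_conj.
have zcz x : conjc (zc x) * zc x = 1 by rewrite mulrC mul_conjc z1 expr1n.
have one1 (x : circle R) : normc (1 : R[i]) = 1 by exact: normc1.
have m1 : cmeas setT (fun _ : circle R => (1 : R[i])) by exact: cmeas_cst.
have zMM : zM `<=` M.
  by move=> _ [f Mf <-]; have := bddW_mulzX 1 Mf; under eq_fun do rewrite expr1.
have MzM f : M f -> L2cl zM f.
  move=> Mf.
  have zM0 : zM !=set0 by have [g Mg] := bddW_set0; exists (fun x => zc x * g x), g.
  have [||q [Lq qzM] fq] := L2_projection zML (ML _ Mf) zM0.
  - move=> _ _ [g Mg <-] [h Mh <-]; exists (fun x => g x + h x); first exact: bddW_add.
    by apply/funext => x; rewrite mulrDr.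
  - move=> c _ [g Mg <-]; exists (fun x => c * g x); first exact: bddW_scale.
    by apply/funext => x; rewrite mulrCA.
  have Nq : L2cl M q.
    have H h : zM h -> L2cl M (fun x => 1 * h x).
      by move=> zMh; under eq_fun do rewrite mul1r; exact/MN/zMM.
    by have := L2cl_rotate zML ML m1 one1 H (conj Lq qzM); under eq_fun do rewrite mul1r.
  have fq0 : nsq (fun x => f x - q x) = 0.
    apply: nowand fq; exact: (L2clB ML bddW_add bddW_scale (MN _ Mf) Nq).
  split; first exact: ML.
  move=> e e0; have [h zh qh] := qzM _ (divr_gt0 e0 (@ltr0Sn R 1)).
  exists h => //.
  have -> : (fun x => f x - h x) = fun x => (f x - q x) + (q x - h x).
    by apply/funext => x; ring.
  have Lfq : L2 (fun x => f x - q x) by apply: L2B => //; exact: ML.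
  have Lqh : L2 (fun x => q x - h x) by apply: L2B => //; exact: zML.
  apply: (le_lt_trans (nsqD_le Lfq Lqh)); rewrite fq0.
  by rewrite add0r mulrC -ltr_pdivlMr.
(* [N] is stable under [conj z], because [M] lies in the closure of [zM]. *)
have NczX n f : L2cl M f -> L2cl M (fun x => conjc (zc x) ^+ n * f x).
  elim: n f => [|n ih] f Nf; first by under eq_fun do rewrite expr0 mul1r.
  under eq_fun do rewrite exprS -mulrA.
  apply: (L2cl_rotate ML ML mcz cz1 _ (ih _ Nf)) => h Mh.
  apply: (L2cl_rotate zML ML mcz cz1 _ (MzM _ Mh)) => _ [g Mg <-].
  under eq_fun do rewrite mulrA zcz mul1r.
  exact: MN.
have NzX n f : L2cl M f -> L2cl M (fun x => zc x ^+ n * f x).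
  move=> Nf; apply: (L2cl_rotate ML ML _ _ _ Nf); first exact: cmeas_zcX.
    by move=> x; rewrite normc_zcX.
  by move=> h Mh; apply: MN; exact: bddW_mulzX.
have L1 : L2 (fun=> 1) by exact/Linfty_L2/Linfty_cst.
have [q Nq qperp] := L2_projection ML L1 bddW_set0 bddW_add bddW_scale.
have Lq := Nq.1; have mq := L2_cmeas Lq.
have L1q : L2 (fun x => 1 - q x) by exact: L2B.
have Nperp f : L2cl M f -> ip (fun x => 1 - q x) f = 0 by exact: (ip_L2cl0 ML L1q qperp).
(* [1 - q] is orthogonal to [z ^ n * f] for all integers [n]. *)
have fix_q f : L2cl M f -> {ae m, forall x, (1 - q x) * conjc (f x) = 0}.
  move=> Nf; apply: fourier_uniqueness.
  - by apply: ip_cintegrable => //; case: Nf.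
  - move=> n; rewrite -(Nperp _ (NzX n f Nf)) /coef; apply: eq_cint => x _.
    by rewrite conjcM conjcX; ring.
  - move=> n; rewrite -(Nperp _ (NczX n.+1 f Nf)); apply: eq_cint => x _.
    by rewrite conjcM conjcX conjcK; ring.
pose E := [set x | 1 <= Re (q x)].
have mE : measurable E.
  by rewrite -[E]setTI; apply: measurable_fun_le => //; case: mq.
have qE : {ae m, forall x, q x = char_fun E x}.
  apply: filterS (fix_q q Nq) => x /eqP; rewrite mulf_eq0 subr_eq0 char_funE indicE.
  move=> /orP[/eqP q1|/eqP q0].
    by rewrite mem_set//= /E/= -q1.
  have {}q0 : q x = 0 by rewrite -(conjcK (q x)) q0 conjc0.
  by rewrite memNset//= /E/= q0 /= ler10.
have q1 : {ae m, forall x, normc (q x) <= 1}.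
  by apply: filterS qE => x ->; rewrite normc_char_fun indicE; case: (x \in E).
have Liq : Linfty q by split => //; exists 1.
have Wczq i : W (fun x => conjc (zc x) ^+ i * q x).
  apply: L2cl_bddW; first exact: NczX.
  apply: LinftyM => //; under eq_fun do rewrite -conjcX.
  exact/Linfty_conj/Linfty_zcX.
have Wzq i : W (fun x => zc x ^+ i * q x).
  by apply: W_mulzX; have := Wczq 0%N; under eq_fun do rewrite expr0 mul1r.
have Wq h : Lgauge alpha h -> W (fun x => q x * h x).
  have Wq' g : Linfty g -> W (fun x => q x * g x).
    move=> Lg; have [mg [B gB]] := Lg.
    apply: W_closed; first by apply: Linfty_Lgauge => //; exact: LinftyM.
    move=> e e0; pose G := `|B|.
    have gG : {ae m, forall x, normc (g x) <= G}.
      by apply: filterS gB => x /le_trans; apply; exact: ler_norm.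
    have G0 : 0 < G + (G + 1) by rewrite ltr_wpDl ?normr_ge0// ltr_wpDl ?normr_ge0.
    have [d d0 Hd] := gauge_ext_small halpha hcont G0 e0.
    have [N [r /= [_ _ pG pg]]] := abel_sum_bounded_approx mg gG d0.
    move: pG pg; rewrite /abel_sum; set c := (X in trigpoly N X); set c' := (X in trigpoly N _ X).
    move=> pG pg; have mp := cmeas_trigpoly N c c'.
    exists (fun x => trigpoly N c c' x * q x).
      under eq_fun do rewrite /trigpoly mulrDl.
      apply: (subspace_add hW).
        exact: (@W_lincomb N c (fun i x => zc x ^+ i) q Wzq).
      exact: (@W_lincomb N c' (fun i x => conjc (zc x) ^+ i) q Wczq).
    have mu : cmeas setT (fun x => q x * g x - trigpoly N c c' x * q x).
      by apply: cmeasB; exact: cmeasM.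
    have ubd : {ae m, forall x, normc (q x * g x - trigpoly N c c' x * q x) <=
        normc (trigpoly N c c' x - g x)}.
      apply: filterS q1 => x qx; rewrite (mulrC _ (q x)) -mulrBr normcM normc_distC.
      by rewrite ler_piMl ?normc_ge0.
    have uG : {ae m, forall x, normc (q x * g x - trigpoly N c c' x * q x) <= G + (G + 1)}.
      apply: filterS2 ubd gG => x ux gx; apply: (le_trans ux).
      by rewrite [leRHS]addrC (le_trans (normcB _ _))// lerD.
    apply: Hd => //; apply: le_lt_trans pg; apply: (ae_le_Rintegral mT).
    - by apply: (cintegrable_normc mT); exact: arc_cintegrable_bounded uG.
    - apply: (cintegrable_normc mT); apply: (cintegrableB mT); last exact: Linfty_intg.
      by apply: (arc_cintegrable_bounded mp (M := G + 1)); exact: aeW.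
    - by apply: filterS ubd.
  move=> Lh; have mh := gauge_closure_cmeas Lh.
  apply: W_closed; first exact: LgaugeM.
  move=> e e0; have [_ /(_ e e0)[g Lg hg]] := Lh; have mg := Linfty_cmeas Lg.
  exists (fun x => q x * g x); first exact: Wq'.
  apply: le_lt_trans hg.
  apply: (gauge_ext_mono halpha (cmeasB (cmeasM mq mh) (cmeasM mq mg)) (cmeasB mh mg)).
  by apply: filterS q1 => x px; rewrite /= -mulrBr normcM ler_piMl ?normc_ge0.
exists E => //; apply/seteqP; split => [f Wf|f [mf [h Lh fh]]].
  have mf := W_cmeas Wf; split => //; exists f; first exact: W_Lgauge.
  suff : {ae m, forall x, (1 - q x) * f x = 0}.
    apply: filterS2 qE => x -> /eqP; rewrite mulrBl mul1r subr_eq0 => /eqP; exact.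
  have m1q : cmeas setT (fun x => 1 - q x) by exact: cmeasB.
  apply: (gauge_ext_eq0 halpha); first exact: cmeasM.
  move=> e e0; have [g [Wg Lg fg]] := W_bounded_dense Wf e0.
  have mg := Linfty_cmeas Lg.
  apply: le_lt_trans fg; apply: (gauge_ext_mono halpha (cmeasM m1q mf) (cmeasB mf mg)).
  apply: filterS2 qE (fix_q g (MN _ (conj Wg Lg))) => x ->.
  rewrite char_funE indicE; case: (x \in E) => [_|].
    by rewrite subrr mul0r normc0 normc_ge0.
  rewrite subr0 !mul1r => gx.
  have -> : g x = 0 by rewrite -(conjcK (g x)) gx conjc0.
  by rewrite subr0.
apply: (subspace_ae hW (f := fun x => q x * h x)) => //; first exact: Wq.
by apply: filterS2 qE fh => x -> ->.
Qed.

Lemma invariant_subspace_dichotomy :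
  (exists phi, [/\ W phi, Linfty phi, {ae m, forall x, normc (phi x) = 1} &
     W = mul_space phi (Hgauge alpha)]) \/
  (exists2 E, measurable E & W = mul_space (char_fun E) (Lgauge alpha)).
Proof.
have [[phi [Np perp n0]]|nowand] :=
    pselect (exists phi, [/\ L2cl M phi, forall f, zM f -> ip phi f = 0 & nsq phi != 0]).
  left; have [psi [Wp Lp p1 pperp]] := wandering_unimodular Np perp n0.
  by exists psi; split => //; exact: wandering_range.
right; apply: no_wandering_range => phi Np perp; apply/eqP/negPn/negP => n0.
by apply: nowand; exists phi.
Qed.

End invariant.

Theorem theorem3p6 (R : realType) (alpha : (circle R -> R[i]) -> R)
    (W : set (circle R -> R[i]))
    (halpha : dominating_gauge_norm alpha)
    (hcont : continuous_gauge alpha) (hW : closed_subspace alpha W) :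
  (mul_space (@zcoord R) W `<=` W <->
     (exists2 phi : circle R -> R[i], unimodular phi &
        W = mul_space phi (Hgauge alpha)) \/
     (exists2 E : set (circle R), measurable E &
        W = mul_space (char_fun E) (Lgauge alpha))) /\
  (mul_space (@zcoord R) W `<=` W ->
   W <> [set f | cmeasurable f /\ aeq f (fun=> 0)] ->
   W `<=` Hgauge alpha ->
   exists2 phi : circle R -> R[i], inner phi &
     W = mul_space phi (Hgauge alpha)).
Proof.
have abs1 (phi : circle R -> R[i]) : {ae arc_measure R, forall x, normc (phi x) = 1} ->
    {ae arc_measure R, forall x, `|phi x| = 1}.
  by apply: filterS => x px; rewrite normrE px.
have Lz : Linfty (@zcoord R) by have := Linfty_zcX R 1; under eq_fun do rewrite expr1.
have zmul phi (S : set (circle R -> R[i])) : (forall h, S h -> S (fun x => zcoord x * h x)) ->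
    W = mul_space phi S -> mul_space (@zcoord R) W `<=` W.
  move=> zS -> f [mf [g [mg [h Sh gh]] fg]]; split => //.
  exists (fun x => zcoord x * h x); first exact: zS.
  by apply: filterS2 fg gh => x /= -> ->; rewrite mulrCA.
split; first split.
- move=> zW; have [[phi [_ Lp p1 E]]|] := invariant_subspace_dichotomy halpha hcont hW zW.
    by left; exists phi => //; split; [exact: Linfty_cmeas|exact: abs1].
  by right.
- case=> [[phi _]|[E mE]]; apply: zmul => h.
    apply: (gauge_closureM halpha (S := @Hinfty R) _ Lz); first by move=> g; exact: Hinfty_cmeas.
    move=> g /HinftyE[Lg ag]; apply/HinftyE; split; first exact: (LinftyM Lz Lg).
    have := analyticMzX 1 ag; by under eq_fun do rewrite expr1 mulrC.
  exact: LgaugeM.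
move=> zW W0 WH; have [[phi [Wp Lp p1 EW]]|[E mE EW]] :=
    invariant_subspace_dichotomy halpha hcont hW zW.
  exists phi => //; split; last exact: abs1.
  by apply/HinftyE; split => //; exact: (Hgauge_analytic halpha (WH _ Wp)).
(* [W] contains the products of [char_fun E] with all the powers of [conj z], so that all
   the Fourier coefficients of [char_fun E] vanish. *)
have LE := char_fun_Linfty mE; have mEc := Linfty_cmeas LE.
have aE n : analytic (fun x => char_fun E x * conjc (zcoord x) ^+ n).
  have Lzn : Linfty (fun x : circle R => conjc (zcoord x) ^+ n).
    by under eq_fun do rewrite -conjcX; exact/Linfty_conj/Linfty_zcX.
  apply: (Hgauge_analytic halpha); apply: WH; rewrite EW; split.
    by apply: cmeasM => //; exact: Linfty_cmeas.
  exists (fun x => conjc (zcoord x) ^+ n); first exact: Linfty_Lgauge.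
  exact: aeW.
have E0 : {ae arc_measure R, forall x, char_fun E x = 0}.
  apply: fourier_uniqueness; first exact: Linfty_intg.
  - move=> n; rewrite -[RHS]((aE n.+1).2 0%N) /coef; apply: eq_cint => x _.
    rewrite expr1 exprSr -mulrA -(mulrA _ (conjc _)) (mulrC (conjc _) (zcoord x)) mul_conjc normc_zcoord expr1n mulr1.
    by ring.
  - move=> n; rewrite -[RHS]((aE 0%N).2 n); apply: eq_cint => x _.
    by rewrite expr0 mulr1.
case: W0; apply/seteqP; split => f.
  rewrite EW => -[mf [h _ fh]]; split => //.
  by apply: filterS2 fh E0 => x -> /= ->; rewrite mul0r.
move=> [mf f0]; apply: (subspace_ae hW (subspace_zero hW)) => //.
by apply: filterS f0 => x ->.
Qed.
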